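(* Let $\mathcal{H}$ be the class of stars, the class of trees, or the class of forests. Then $\mathcal{H}$-Identification is NP-complete, and it is W[1]-hard when parameterized by $n-k$, where $n$ is the number of vertices of the input graph and $k$ the input integer.
   Context: All graphs are finite, simple and undirected. An identification of two distinct vertices $u,v$ replaces them with a new vertex adjacent to every vertex of $(N(u)\cup N(v))\setminus\{u,v\}$. For a graph class $\mathcal{H}$, $\mathcal{H}$-Identification takes as input a graph $G$ and an integer $k\ge 0$ and asks whether $G$ can be transformed into a graph in $\mathcal{H}$ by at most $k$ identifications. A star is a tree in which all vertices except at most one are of degree at most $1$. *)

(* Defs.v *)
From mathcomp Require Import all_boot.

Set Implicit Arguments.
Unset Strict Implicit.
Unset Printing Implicit Defensive.

(** * Multi-tape Turing machines over bit strings *)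

Variant direction := MoveL | MoveR | Stay.

(* Deterministic machine with [tm_tapes.+1] two-way infinite tapes.  The tape
   alphabet is [option (bool + tm_aux)]: [None] is the blank, [Some (inl b)] is
   the bit [b], [Some (inr a)] is an auxiliary symbol. *)
Record tm := TM {
  tm_tapes : nat;
  tm_state : finType;
  tm_aux : finType;
  tm_start : tm_state;
  tm_halt : pred tm_state;
  tm_trans : tm_state ->
    {ffun 'I_tm_tapes.+1 -> option (bool + tm_aux)} ->
    tm_state * {ffun 'I_tm_tapes.+1 -> option (bool + tm_aux) * direction}
}.

Definition tm_sym (M : tm) : Type := option (bool + tm_aux M).

(* [(l, r)]: the head scans the first symbol of [r]; [l] lists the symbols to
   its left, nearest first.  Everything beyond [l] and [r] is blank. *)
Definition tape (M : tm) : Type := (seq (tm_sym M) * seq (tm_sym M))%type.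

Section Run.
Variable M : tm.

Definition scanned (t : tape M) : tm_sym M := head None t.2.

Definition write_move (a : tm_sym M * direction) (t : tape M) : tape M :=
  let: (l, r) := t in
  match a.2 with
  | Stay => (l, a.1 :: behead r)
  | MoveR => (a.1 :: l, behead r)
  | MoveL => (behead l, head None l :: a.1 :: behead r)
  end.

Definition config : Type :=
  (tm_state M * ('I_(tm_tapes M).+1 -> tape M))%type.

Definition tm_step (c : config) : config :=
  if tm_halt c.1 then c else
  let: (q, act) := tm_trans c.1 [ffun i => scanned (c.2 i)] in
  (q, fun i => write_move (act i) (c.2 i)).

Definition tm_init (x : seq bool) : config :=
  (tm_start M,
   fun i => ([::], if i == ord0 then [seq Some (inl b) | b <- x] else [::])).

Fixpoint leading_bits (s : seq (tm_sym M)) : seq bool :=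
  if s is Some (inl b) :: s' then b :: leading_bits s' else [::].

(* The output is the maximal block of bits starting at the head of the input
   tape.  As halting configurations are fixed by [tm_step], this says that [M]
   halts on [x] after at most [t] steps, with output [y]. *)
Definition outputs_within (x y : seq bool) (t : nat) : Prop :=
  let c := iter t tm_step (tm_init x) in
  tm_halt c.1 /\ leading_bits (c.2 ord0).2 = y.

End Run.

Definition computable (f : nat -> nat) : Prop :=
  exists M : tm, forall n, exists t,
    outputs_within M (nseq n true) (nseq (f n) true) t.

Definition polytime (f : seq bool -> seq bool) : Prop :=
  exists (M : tm) (c : nat), forall x,
    outputs_within M x (f x) (c * (size x).+1 ^ c).

(** * NP-completeness *)

(* Self-delimiting pairing of bit strings: every bit of [x] is preceded by
   [true], and [false] marks the end of [x]. *)
Fixpoint pair_str (x y : seq bool) : seq bool :=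
  if x is b :: x' then [:: true, b & pair_str x' y] else false :: y.

Definition language := seq bool -> Prop.

Definition in_NP (L : language) : Prop :=
  exists (V : seq bool -> seq bool) (c : nat), polytime V /\
    forall x, L x <->
      exists y, size y <= c * (size x).+1 ^ c /\ V (pair_str x y) = [:: true].

Definition poly_reduces (L L' : language) : Prop :=
  exists f, polytime f /\ forall x, L x <-> L' (f x).

Definition NP_hard (L : language) : Prop :=
  forall L', in_NP L' -> poly_reduces L' L.

Definition NP_complete (L : language) : Prop := in_NP L /\ NP_hard L.

(** * Parameterized problems and W[1]-hardness *)

(* A set of pairs (instance, parameter). *)
Definition param_problem := seq bool -> nat -> Prop.

(* As an algorithm's input or output, the parameter is written in unary. *)
Definition param_str (x : seq bool) (k : nat) := pair_str (nseq k true) x.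

Definition fpt_reduces (P Q : param_problem) : Prop :=
  exists (M : tm) (R : seq bool -> nat -> seq bool * nat)
         (f g : nat -> nat) (c : nat),
    [/\ computable f, computable g &
     forall x k,
       [/\ outputs_within M (param_str x k) (param_str (R x k).1 (R x k).2)
             (f k * (size x).+1 ^ c),
           P x k <-> Q (R x k).1 (R x k).2 &
           (R x k).2 <= g k]].

Variant gate :=
  | Input
  | Not of nat
  | And of seq nat
  | Or of seq nat.

(* Nodes in topological order: the arguments of a gate are indices of earlier
   nodes.  The output is the last node. *)
Definition circuit := seq gate.

Definition is_input (g : gate) := if g is Input then true else false.

Definition gate_args (g : gate) : seq nat :=
  match g with Input => [::] | Not i => [:: i] | And s => s | Or s => s end.

Definition circuit_wf (C : circuit) : Prop :=
  forall j, j < size C -> all (fun i => i < j) (gate_args (nth Input C j)).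

(* Evaluates all nodes in order; [h vs g] is the value of a node of type [g]
   when [vs] lists the values of the nodes before it. *)
Definition node_values (T : Type) (h : seq T -> gate -> T) (C : circuit) :=
  foldl (fun vs g => rcons vs (h vs g)) [::] C.

(* [a] is indexed by node and only read at the input nodes. *)
Definition circuit_value (a : nat -> bool) (C : circuit) : bool :=
  last false (node_values (fun vs g => match g with
    | Input => a (size vs)
    | Not i => ~~ nth false vs i
    | And s => all (nth false vs) s
    | Or s => has (nth false vs) s
    end) C).

Definition circuit_weight (a : nat -> bool) (C : circuit) : nat :=
  count (fun j => is_input (nth Input C j) && a j) (iota 0 (size C)).

(* Maximal number of gates on a path from an input to the output. *)
Definition circuit_depth (C : circuit) : nat :=
  last 0 (node_values (fun ds g =>
    if is_input g then 0 else (\max_(i <- gate_args g) nth 0 ds i).+1) C).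

(* Maximal number of large gates (fan-in above 2) on such a path. *)
Definition circuit_weft (C : circuit) : nat :=
  last 0 (node_values (fun ws g =>
    \max_(i <- gate_args g) nth 0 ws i + (2 < size (gate_args g))) C).

Definition unary_str (n : nat) : seq bool := rcons (nseq n true) false.

Definition list_str (s : seq nat) : seq bool :=
  unary_str (size s) ++ flatten (map unary_str s).

Definition gate_str (g : gate) : seq bool :=
  match g with
  | Input => [:: false; false]
  | Not i => [:: false, true & unary_str i]
  | And s => [:: true, false & list_str s]
  | Or s => [:: true, true & list_str s]
  end.

Definition circuit_str (C : circuit) : seq bool :=
  unary_str (size C) ++ flatten (map gate_str C).

(* Weighted circuit satisfiability for circuits of weft at most [t] and depth
   at most [d], parameterized by the weight. *)
Definition WCS (t d : nat) : param_problem := fun x k =>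
  exists C : circuit,
    [/\ x = circuit_str C, circuit_wf C, circuit_weft C <= t,
        circuit_depth C <= d &
        exists a, circuit_weight a C = k /\ circuit_value a C].

Definition in_W (t : nat) (P : param_problem) : Prop :=
  exists d, fpt_reduces P (WCS t d).

Definition W1_hard (Q : param_problem) : Prop :=
  forall P, in_W 1 P -> fpt_reduces P Q.

(** * Graphs and identifications *)

Record sgraph := SGraph {
  vertex : finType;
  edge : rel vertex;
  edge_sym : symmetric edge;
  edge_irr : irreflexive edge
}.

Definition degree (G : sgraph) (x : vertex G) := #|[set y | edge x y]|.

Section Identify.
Variables (G : sgraph) (u v : vertex G).

(* [None] is the new vertex. *)
Definition ident_vertex : finType :=
  option {x : vertex G | (x != u) && (x != v)}.

Definition ident_edge : rel ident_vertex := fun a b =>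
  match a, b with
  | Some x, Some y => edge (val x) (val y)
  | None, Some x | Some x, None => edge u (val x) || edge v (val x)
  | None, None => false
  end.

Lemma ident_edge_sym : symmetric ident_edge.
Proof. by case=> [x|] [y|] //=; rewrite edge_sym. Qed.

Lemma ident_edge_irr : irreflexive ident_edge.
Proof. by case=> [x|] //=; rewrite edge_irr. Qed.

Definition identify : sgraph := SGraph ident_edge_sym ident_edge_irr.

End Identify.

(* [identifications m G G']: [G'] arises from [G] by exactly [m]
   identifications. *)
Inductive identifications : nat -> sgraph -> sgraph -> Prop :=
  | Ident0 G : identifications 0 G G
  | IdentS m G (u v : vertex G) G' :
      u != v -> identifications m (identify u v) G' ->
      identifications m.+1 G G'.

Definition is_forest (G : sgraph) : Prop :=
  forall s : seq (vertex G), 2 < size s -> ~ ucycle (@edge G) s.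

Definition is_connected (G : sgraph) : Prop :=
  0 < #|vertex G| /\ forall x y : vertex G, connect (@edge G) x y.

Definition is_tree (G : sgraph) : Prop := is_connected G /\ is_forest G.

Definition is_star (G : sgraph) : Prop :=
  is_tree G /\ #|[set x : vertex G | 1 < degree x]| <= 1.

Definition identifiable (H : sgraph -> Prop) (G : sgraph) (k : nat) : Prop :=
  exists m G', [/\ m <= k, identifications m G G' & H G'].

(* Value of a binary numeral, least significant bit first. *)
Definition binval (s : seq bool) : nat := foldr (fun (b : bool) n => b + n.*2) 0 s.

(* [x] encodes the graph with vertex set ['I_n] and adjacency relation [e],
   given by its adjacency matrix, together with [k] in binary. *)
Definition encodes (x : seq bool) (n : nat) (e : rel 'I_n) (k : nat) : Prop :=
  exists s, binval s = k /\
    x = pair_str (nseq n true)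
          (pair_str [seq e i j | i <- enum 'I_n, j <- enum 'I_n] s).

Definition Identification (H : sgraph -> Prop) : language := fun x =>
  exists n (e : rel 'I_n) (es : symmetric e) (ei : irreflexive e) k,
    encodes x e k /\ identifiable H (SGraph es ei) k.

(* The parameter is n - k; instances with k > n have no parameter. *)
Definition Identification_dual (H : sgraph -> Prop) : param_problem :=
  fun x p =>
  exists n (e : rel 'I_n) (es : symmetric e) (ei : irreflexive e) k,
    [/\ encodes x e k, p + k = n & identifiable H (SGraph es ei) k].

(* Main.v *)
(* Identifications turn a graph into its quotients, so [G] is a yes-instance iff
   some quotient of [G] with at least [n - k] vertices is in the class.  If [G]
   has a universal vertex [z], a quotient is a forest iff the parts other than
   that of [z] are pairwise non-adjacent (otherwise there is a triangle), and
   then it is even a star; choosing one vertex per part shows that all three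
   problems ask for an independent set of size [n - k - 1] in [G - z].

   Independent sets of size [q] in the complement of a graph encode binary
   constraint problems with [q] variables.
   - NP-hardness: one variable per time step of the verifier, whose value
     records the state, the scanned symbols, the head positions and, for each
     tape, the time of the previous visit to the scanned cell.  The last item
     makes the consistency of the tapes a condition on pairs of time steps.
   - W[1]-hardness: let [X_1 < ... < X_k] be the true inputs.  The variables are
     the [2^d]-tuples of indices, valued by the corresponding pairs
     [(X_i, X_{i+1})].  Such a pair decides all inputs between its components,
     so every fan-in-2 circuit of depth [d] is decided by some variable; the top
     part of the circuit is handled by a proof tree of constant size, guessed in
     every variable.

   All reductions are functions on bit strings and numbers that are bounded by
   polynomials, obtained from bounded iteration.  They run on programs over
   finitely many stacks, which translate into Turing machines and conversely. *)

Require Import Defs.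
From mathcomp Require Import all_boot zify.
From Stdlib Require Import FunctionalExtensionality.

Set Implicit Arguments.
Unset Strict Implicit.
Unset Printing Implicit Defensive.

(** * Stack programs and their Turing machines *)

(** Stacks hold numbers in unary, so only polynomially bounded numbers can be computed. This shapes
    both constructions: a vertex is a number below [B ^ m], that is, a tuple of [m] digits, where
    [m] depends only on the verifier or on the depth [d]. So a vertex can hold neither a tape nor a
    set of inputs, and a constraint sees just two vertices.

    For W[1]-hardness the number of variables may depend only on the weight and on [d]. The constant
    [2 ^ d] bounds the number of inputs below a node of depth at most [d] and weft 0, so one tuple
    of intervals covers them. In a proof tree, a gate that needs a single argument names it, a gate
    that needs all of at most two names these, and a gate that needs all of many names none: each
    argument has weft 0 and is decided by some variable, so it suffices that no variable refutes the
    gate. Hence fewer than [2 ^ d.+1] nodes are enough.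

    The machines hidden in [computable] and [fpt_reduces] are arbitrary and have to be composed with
    the reduction; there the translation of machines into stack programs is used. *)

Section StackPrograms.
Variable aux : finType.

Definition sym : finType := (bool + aux)%type.
Definition store := nat -> seq sym.
Definition upd (m : store) (i : nat) (s : seq sym) : store :=
  fun j => if j == i then s else m j.

Inductive prog :=
  | Skip
  | Push of nat & sym
  | Pop of nat
  | Seq of prog & prog
  | Case of nat & (option sym -> prog)
  | While of nat & pred (option sym) & prog.

(** The costs are the exact numbers of flowchart instructions that [code] executes: sequencing is
    free, and every test of a case or a loop takes one step. *)
Inductive exec : prog -> store -> nat -> store -> Prop :=
  | ESkip m : exec Skip m 1 m
  | EPush i a m : exec (Push i a) m 1 (upd m i (a :: m i))
  | EPop i m : exec (Pop i) m 1 (upd m i (behead (m i)))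
  | ESeq p q m n m1 n' m2 :
      exec p m n m1 -> exec q m1 n' m2 -> exec (Seq p q) m (n + n') m2
  | ECase i f m n m1 :
      exec (f (ohead (m i))) m n m1 -> exec (Case i f) m n.+1 m1
  | EWhile0 i (P : pred (option sym)) p m :
      ~~ P (ohead (m i)) -> exec (While i P p) m 1 m
  | EWhileS i (P : pred (option sym)) p m n m1 n' m2 :
      P (ohead (m i)) -> exec p m n m1 -> exec (While i P p) m1 n' m2 ->
      exec (While i P p) m (n + n').+1 m2.

Inductive instr (X : Type) :=
  | IPush of nat & sym & X
  | IPop of nat & X
  | ICase of nat & (option sym -> X).

Definition imap X Y (h : X -> Y) (i : instr X) : instr Y :=
  match i with
  | IPush i a x => IPush i a (h x)
  | IPop i x => IPop i (h x)
  | ICase i f => ICase i (fun a => h (f a))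
  end.

Definition istep X (i : instr X) (m : store) : X * store :=
  match i with
  | IPush i a x => (x, upd m i (a :: m i))
  | IPop i x => (x, upd m i (behead (m i)))
  | ICase i f => (f (ohead (m i)), m)
  end.

Definition ireg X (i : instr X) : nat :=
  match i with IPush i _ _ => i | IPop i _ => i | ICase i _ => i end.

Inductive reach (Q : Type) (cd : Q -> instr (option Q)) :
    option Q * store -> nat -> option Q * store -> Prop :=
  | Reach0 c : reach cd c 0 c
  | ReachS q m n c : reach cd (istep (cd q) m) n c -> reach cd (Some q, m) n.+1 c.

Lemma reach_trans Q (cd : Q -> instr (option Q)) c1 n1 c2 n2 c3 :
  reach cd c1 n1 c2 -> reach cd c2 n2 c3 -> reach cd c1 (n1 + n2) c3.
Proof. by elim=> // q m n c _ IH /IH; rewrite addSn; apply: ReachS. Qed.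

(** Embeds the code of a subprogram into that of the surrounding program. [h] extends [g] to the
    exit: [h None] is the point at which the surrounding program continues. *)
Lemma reach_map Q1 Q2 (c1 : Q1 -> instr (option Q1)) (c2 : Q2 -> instr (option Q2))
    (g : Q1 -> Q2) (h : option Q1 -> option Q2) :
  (forall q, h (Some q) = Some (g q)) ->
  (forall q, c2 (g q) = imap h (c1 q)) ->
  forall x n y, reach c1 x n y -> reach c2 (h x.1, x.2) n (h y.1, y.2).
Proof.
move=> hS hc x n y; elim=> [c|q m k c _ IH]; first exact: Reach0.
rewrite /= hS; apply: ReachS; rewrite hc.
by case: (c1 q) IH => [i a z|i z|i f].
Qed.

(* The labels of a program are its control points; leaving the program is
   encoded by [None]. *)
Fixpoint lab (p : prog) : finType :=
  match p with
  | Seq p q => (lab p + lab q)%type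
  | Case _ f => option {a : option sym & lab (f a)}
  | While _ _ p => option (lab p)
  | _ => unit
  end.

Fixpoint entry (p : prog) : lab p :=
  match p with
  | Seq p q => inl (entry p)
  | Case _ _ => None
  | While _ _ _ => None
  | _ => tt
  end.

Fixpoint code (p : prog) : lab p -> instr (option (lab p)) :=
  match p return lab p -> instr (option (lab p)) with
  | Skip => fun _ => ICase 0 (fun _ => None)
  | Push i a => fun _ => IPush i a None
  | Pop i => fun _ => IPop i None
  | Seq p q => fun l =>
      match l with
      | inl l => imap (fun o => Some (if o is Some l then inl l
                                      else inr (entry q))) (code l)
      | inr l => imap (omap inr) (code l)
      end
  | Case i f => fun l =>
      match l with
      | None => ICase i (fun a => Some (Some (existT _ a (entry (f a)))))
      | Some (existT a l) =>
          imap (omap (fun l => Some (existT (fun a => lab (f a)) a l))) (code l)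
      end
  | While i P p => fun l =>
      match l with
      | None => ICase i (fun a => if P a then Some (Some (entry p)) else None)
      | Some l => imap Some (code l)
      end
  end.

Lemma exec_reach p m n m' :
  exec p m n m' -> reach (@code p) (Some (entry p), m) n (None, m').
Proof.
elim=> {p m n m'}.
- by move=> m; apply: ReachS; apply: Reach0.
- by move=> i a m; apply: ReachS; apply: Reach0.
- by move=> i m; apply: ReachS; apply: Reach0.
- move=> p q m n m1 n' m2 _ IH1 _ IH2; apply: reach_trans.
    by refine (reach_map (g := inl) (c2 := @code (Seq p q)) (h := fun o =>
      Some (if o is Some l then inl l else inr (entry q))) _ _ IH1).
  by refine (reach_map (g := inr) (c2 := @code (Seq p q)) (h := omap inr) _ _ IH2).
- move=> i f m n m1 _ IH; apply: ReachS => /=.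
  set a := ohead (m i).
  by refine (reach_map (g := fun l => Some (existT (fun a => lab (f a)) a l))
    (c2 := @code (Case i f)) (h := omap (fun l => Some (existT (fun a => lab (f a)) a l))) _ _ IH).
- by move=> i P p m /negbTE hP; apply: ReachS; rewrite /= hP; apply: Reach0.
- move=> i P p m n m1 n' m2 hP _ IH1 _ IH2; apply: ReachS; rewrite /= hP.
  apply: reach_trans IH2.
  by refine (reach_map (g := Some) (c2 := @code (While i P p)) (h := Some) _ _ IH1).
Qed.

Fixpoint width (p : prog) : nat :=
  match p with
  | Skip => 0
  | Push i _ => i
  | Pop i => i
  | Seq p q => maxn (width p) (width q)
  | Case i f => maxn i (\max_a width (f a))
  | While i _ p => maxn i (width p)
  end.

Lemma ireg_map X Y (h : X -> Y) i : ireg (imap h i) = ireg i.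
Proof. by case: i. Qed.

Lemma ireg_code p (l : lab p) : ireg (code l) <= width p.
Proof.
elim: p l => [|i a|i|p IHp q IHq|i f IH|i P p IH] //=.
- by case=> l; rewrite ireg_map leq_max ?IHp ?IHq ?orbT.
- case=> [[a l]|] /=; last by rewrite leq_maxl.
  by rewrite ireg_map (leq_trans (IH a l)) // leq_max (leq_bigmax a) orbT.
- by case=> [l|] /=; rewrite ?leq_maxl // ireg_map leq_max IH orbT.
Qed.

Definition runs p m n m' := exists2 t, t <= n & exec p m t m'.

Lemma runs_le p m n n' m' : runs p m n m' -> n <= n' -> runs p m n' m'.
Proof. by case=> t ht he hn; exists t => //; apply: leq_trans hn. Qed.

Lemma runs_exec p m n m' : exec p m n m' -> runs p m n m'.
Proof. by exists n. Qed.

Lemma runs_seq p q m n m1 n' m2 :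
  runs p m n m1 -> runs q m1 n' m2 -> runs (Seq p q) m (n + n') m2.
Proof. by case=> t ht h [t' ht' h']; exists (t + t'); [lia | apply: ESeq h h']. Qed.

Lemma runs_case i f m n m' :
  runs (f (ohead (m i))) m n m' -> runs (Case i f) m n.+1 m'.
Proof. by case=> t ht h; exists t.+1 => //; apply: ECase. Qed.

Lemma runs_while i (P : pred (option sym)) p (ms : nat -> store) N T :
  (forall k, k < N -> P (ohead (ms k i)) /\ runs p (ms k) T (ms k.+1)) ->
  ~~ P (ohead (ms N i)) -> runs (While i P p) (ms 0) (N * T.+1).+1 (ms N).
Proof.
elim: N ms => [|N IH] ms hs hN; first by exists 1 => //; apply: EWhile0.
have [h0 [t0 ht0 e0]] := hs 0 isT.
have [t ht e] := IH (fun k => ms k.+1) (fun k hk => hs k.+1 hk) hN.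
exists (t0 + t).+1; last exact: EWhileS e.
by rewrite mulSn; lia.
Qed.

(** One step lengthens a stack by at most one symbol. Consequently a result in unary is bounded by
    the running time, which [runs_un_le] and [pc_pbd] exploit. *)
Lemma exec_size p m n m' : exec p m n m' -> forall i, size (m' i) <= size (m i) + n.
Proof.
elim=> {p m n m'} => [m i|i a m j|i m j|p q m n m1 n' m2 _ IH1 _ IH2 i|
   i f m n m1 _ IH j|i P p m _ j|i P p m n m1 n' m2 _ _ IH1 _ IH2 j].
- lia.
- by rewrite /upd; case: eqP => [->|] /=; lia.
- by rewrite /upd; case: eqP => [->|]; rewrite ?size_behead; lia.
- by have := IH1 i; have := IH2 i; lia.
- by have := IH j; lia.
- lia.
- by have := IH1 j; have := IH2 j; lia.
Qed.

End StackPrograms.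

(** * Compilation of flowcharts into Turing machines *)

Section ProgramMachine.
Variables (aux : finType) (Q : finType) (cd : Q -> instr aux (option Q)).
Variables (start : Q) (K : nat).
Hypothesis cdK : forall q, ireg (cd q) <= K.

Definition mstate : finType := (option Q + 'I_K.+1 * sym aux * option Q)%type.

(* A push takes two steps; the intermediate state records the symbol that is
   still to be written. *)
Definition mtrans (s : mstate) (rd : {ffun 'I_K.+1 -> option (sym aux)}) :
    mstate * {ffun 'I_K.+1 -> option (sym aux) * direction} :=
  match s with
  | inl None => (s, [ffun i => (rd i, Stay)])
  | inl (Some q) =>
      match cd q with
      | IPush i a x =>
          (inr (inord i, a, x),
           [ffun j => (rd j, if j == inord i then MoveL else Stay)])
      | IPop i x =>
          (inl x, [ffun j => if j == inord i then (None, MoveR) else (rd j, Stay)])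
      | ICase i f => (inl (f (rd (inord i))), [ffun j => (rd j, Stay)])
      end
  | inr (i, a, x) => (inl x, [ffun j => (if j == i then Some a else rd j, Stay)])
  end.

Definition mtm : tm :=
  @TM K mstate aux (inl (Some start) : mstate)
    (fun s => if s is inl None then true else false) mtrans.

(** Popping blanks the cell before the head moves right, so everything left of the head stays blank.
    Trailing blanks arise when the blank below an empty stack is rewritten. *)
Definition rep (t : tape mtm) (s : seq (sym aux)) : Prop :=
  all (fun a => a == None) t.1 /\ exists k, t.2 = map Some s ++ nseq k None.

Lemma rep_scanned t s : rep t s -> scanned t = ohead s.
Proof. by case: t => l r [_ [k /= ->]]; case: s => [|a s] //; case: k. Qed.

Lemma rep_stay t s : rep t s -> rep (write_move (scanned t, Stay) t) s.
Proof.
case: t => l r [/= hl [k ->]]; split=> //=.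
case: s => [|a s] /=; last by exists k.
by case: k => [|k] /=; [exists 1|exists k.+1].
Qed.

Lemma rep_pop t s : rep t s -> rep (write_move (None, MoveR) t) (behead s).
Proof.
case: t => l r [/= hl [k ->]]; split=> //=.
by case: s => [|a s] /=; [exists k.-1; case: k | exists k].
Qed.

Lemma rep_push t s a : rep t s ->
  rep (write_move (Some a, Stay) (write_move (scanned t, MoveL) t)) (a :: s).
Proof.
case: t => l r [/= hl [k ->]]; split=> /=; first by case: l hl => //= ? ? /andP[].
case: s => [|b s] /=; last by exists k.
by case: k => [|k] /=; [exists 1|exists k.+1].
Qed.

Definition crep (c : config mtm) (x : option Q) (m : store aux) : Prop :=
  c.1 = inl x /\ forall i : 'I_K.+1, rep (c.2 i) (m i).

Lemma istep_sim q m c : crep c (Some q) m ->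
  exists2 t, t <= 2 &
    crep (iter t (@tm_step mtm) c) (istep (cd q) m).1 (istep (cd q) m).2.
Proof.
case: c => s c [/= -> hc].
have vi i : i <= K -> nat_of_ord (inord i : 'I_K.+1) = i by move=> ?; rewrite inordK.
have := cdK q; case E: (cd q) => [i a x|i x|i f] /= /vi iK.
- exists 2 => //; rewrite /= {2}/tm_step /= E /=; split=> //= j; rewrite !ffunE /upd.
  have -> : (j == i :> nat) = (j == inord i) by rewrite -val_eqE /= iK.
  case: eqP => [->|_]; last exact/rep_stay/rep_stay.
  by have /rep_push := hc (inord i); rewrite iK; apply.
- exists 1 => //; rewrite /= /tm_step /= E /=; split=> //= j; rewrite !ffunE /upd.
  have -> : (j == i :> nat) = (j == inord i) by rewrite -val_eqE /= iK.
  by case: eqP => [->|_]; [have /rep_pop := hc (inord i); rewrite iK|apply: rep_stay].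
- exists 1 => //; rewrite /= /tm_step /= E /=; split=> [|j] /=.
    by rewrite !ffunE (rep_scanned (hc _)) iK.
  by rewrite !ffunE; apply: rep_stay.
Qed.

Lemma reach_sim x n y : reach cd x n y -> forall c, crep c x.1 x.2 ->
  exists2 t, t <= 2 * n & crep (iter t (@tm_step mtm) c) y.1 y.2.
Proof.
elim=> [z c hc|q m k z _ IH c hc]; first by exists 0.
have [t1 h1 /IH[t2 h2 hz]] := istep_sim hc.
by exists (t2 + t1); [lia | rewrite iterD].
Qed.

End ProgramMachine.

Lemma tm_halt_iter (M : tm) (c : config M) t :
  tm_halt c.1 -> iter t (@tm_step M) c = c.
Proof. by move=> h; elim: t => //= t ->; rewrite /tm_step h. Qed.

Definition init_store aux (x : seq bool) : store aux :=
  fun i => if i == 0 then map inl x else [::].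

Lemma prog_tm aux (p : prog aux) : exists M : tm, forall x y n m,
  runs p (init_store aux x) n m -> m 0 = map inl y ->
  forall t, 2 * n <= t -> outputs_within M x y t.
Proof.
exists (mtm (@code aux p) (entry p) (width p)) => x y n m [n' hn' /exec_reach hr] hy t ht.
set M := mtm _ _ _.
have h0 : crep (tm_init M x) (Some (entry p)) (init_store aux x).
  split=> //= i; rewrite /init_store; split=> //=; exists 0.
  by rewrite cats0 -val_eqE /=; case: eqP => //= _; rewrite -map_comp.
have [t' ht' hc] := reach_sim (@ireg_code aux p) hr h0.
have {ht'} lt : t' <= t by lia.
case: hc; rewrite /outputs_within -(subnK lt) iterD.
set c := iter t' _ _ => /= h1 h2; rewrite tm_halt_iter ?h1 //; split=> //.
have [_ [k ->]] := h2 ord0; rewrite /= hy -map_comp.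
by elim: (y) => [|b z /= ->] //=; case: k.
Qed.

Arguments Skip {aux}.
Arguments Pop {aux}.

(** * Functions computed by stack programs in polynomial time *)

Ltac store_eq :=
  apply: functional_extensionality => ?; rewrite /upd;
  do ?[case: eqP => [?|?]]; subst; rewrite ?eqxx //; try lia; try by auto.

Ltac updE := rewrite /upd ?eqxx; do ?[case: eqP => ? //]; try lia.

(** * Basic operations on registers *)

Section Registers.
Variable aux : finType.
Implicit Types (m : store aux).

Definition un n : seq (sym aux) := nseq n (inl true).
Definition clear i : prog aux := While i isSome (Pop i).
Definition shift i j : prog aux :=
  Case i (fun a => if a is Some a then Seq (Pop i) (Push j a) else Skip).
Definition move (P : pred (option (sym aux))) i j := While i P (shift i j).
(** Stacks are read destructively: the unary number is moved to [u] and then rebuilt in [i] and [t]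
    at the same time. *)
Definition copy i t u : prog aux :=
  Seq (move isSome i u)
      (While u isSome (Seq (Pop u) (Seq (Push i (inl true)) (Push t (inl true))))).

Lemma upd_id m i s : m i = s -> upd m i s = m.
Proof. by move=> h; store_eq. Qed.

Lemma upd_upd m i s s' : upd (upd m i s) i s' = upd m i s'.
Proof. by store_eq. Qed.

Lemma upd_eq m i s : upd m i s i = s.
Proof. by rewrite /upd eqxx. Qed.

Lemma upd_neq m i j s : j != i -> upd m i s j = m j.
Proof. by rewrite /upd => /negbTE->. Qed.

Lemma runs_whileS i (P : pred (option (sym aux))) p m n m1 n' m2 :
  P (ohead (m i)) -> runs p m n m1 -> runs (While i P p) m1 n' m2 ->
  runs (While i P p) m (n + n').+1 m2.
Proof.
move=> hP [t ht h] [t' ht' h']; exists (t + t').+1; first lia.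
exact: EWhileS h'.
Qed.

Lemma runs_push m i a : runs (Push i a) m 1 (upd m i (a :: m i)).
Proof. exact/runs_exec/EPush. Qed.

Lemma runs_pop m i : runs (Pop i) m 1 (upd m i (behead (m i))).
Proof. exact/runs_exec/EPop. Qed.

Lemma runs_skip m n : 0 < n -> runs Skip m n m.
Proof. by move=> h; exists 1 => //; apply: ESkip. Qed.

Lemma shift_runs m i j a s : i != j -> m i = a :: s ->
  runs (shift i j) m 3 (upd (upd m i s) j (a :: m j)).
Proof.
move=> ij hi; apply: runs_case; rewrite hi /=.
apply: runs_seq (runs_pop m i) _; rewrite hi /=.
rewrite -[m j](upd_neq m (i := i) s) 1?eq_sym //; exact: runs_push.
Qed.

Lemma move_runs P m i j s r : i != j -> m i = s ++ r ->
  all (fun a => P (Some a)) s -> ~~ P (ohead r) ->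
  runs (move P i j) m (4 * size s).+1 (upd (upd m i r) j (catrev s (m j))).
Proof.
move=> ij; elim: s m => [|a s IH] m /= hi.
  move=> _ hr; rewrite upd_id // ?upd_id // ?(upd_neq _ _ _) 1?eq_sym //; exists 1 => //.
  by apply: EWhile0; rewrite hi.
case/andP=> ha hs hr.
have h := IH (upd (upd m i (s ++ r)) j (a :: m j)).
rewrite upd_neq // !upd_eq in h; have {}h := h erefl hs hr.
have -> : upd (upd m i r) j (catrev s (a :: m j)) =
  upd (upd (upd (upd m i (s ++ r)) j (a :: m j)) i r) j (catrev s (a :: m j)).
  by store_eq.
have -> : (4 * (size s).+1).+1 = (3 + (4 * size s).+1).+1 by lia.
apply: runs_whileS h; first by rewrite hi.
exact: shift_runs.
Qed.

Lemma clear_runs m i : runs (clear i) m (2 * size (m i)).+1 (upd m i [::]).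
Proof.
move E: (m i) => s; elim: s m E => [|a s IH] m hi.
  by rewrite upd_id //; exists 1 => //; apply: EWhile0; rewrite hi.
have -> : (2 * (size s).+1).+1 = (1 + (2 * size s).+1).+1 by lia.
apply: runs_whileS; [by rewrite hi | exact: runs_pop|].
by rewrite hi /= -(upd_upd m i s [::]); apply: IH; rewrite upd_eq.
Qed.

Lemma catrev_un n k : catrev (un n) (un k) = un (n + k).
Proof. by elim: n k => //= n IH k; rewrite (IH k.+1) addnS. Qed.

Lemma move_un m i j n k : i != j -> m i = un n -> m j = un k ->
  runs (move isSome i j) m (4 * n).+1 (upd (upd m i [::]) j (un (n + k))).
Proof.
move=> ij hi hj; rewrite -catrev_un -hj.
have h := @move_runs isSome m i j (un n) [::] ij.
rewrite size_nseq cats0 in h; apply: h => //.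
by apply/allP.
Qed.

Lemma copy_runs m i t u n : uniq [:: i; t; u] -> m i = un n -> m t = [::] ->
  m u = [::] -> runs (copy i t u) m (8 * n).+2 (upd m t (un n)).
Proof.
rewrite /= !inE negb_or => /and3P[/andP[it iu] tu _] hi ht hu.
have -> : (8 * n).+2 = (4 * n).+1 + (n * 4).+1 by lia.
apply: runs_seq; first by apply: (@move_un _ _ _ n 0).
set m0 := upd _ _ _.
pose ms k := upd (upd (upd m i (un k)) t (un k)) u (un (n - k)).
have -> : m0 = ms 0 by rewrite /m0 /ms addn0 subn0; store_eq.
have -> : upd m t (un n) = ms n.
  by rewrite /ms subnn; store_eq.
apply: runs_while => [k kn|]; last by rewrite /ms upd_eq subnn.
split; first by rewrite /ms upd_eq -(ltn_predK (_ : 0 < n - k)) ?subn_gt0.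
apply: (runs_seq (n := 1) (n' := 2)); first exact: runs_pop.
apply: (runs_seq (n := 1) (n' := 1)); first exact: runs_push.
rewrite [ms k.+1]/ms.
set m1 := upd _ i _; have -> : upd (upd (upd m i (un k.+1)) t (un k.+1)) u (un (n - k.+1))
  = upd m1 t (inl true :: m1 t).
  rewrite /m1 /ms.
  have -> : behead (upd (upd (upd m i (un k)) t (un k)) u (un (n - k)) u) = un (n - k.+1).
    by rewrite upd_eq subnS; case: (n - k).
  by apply: functional_extensionality => j; rewrite /upd; move: it iu tu;
     rewrite ?eqxx; do !case: eqP => ? //=; subst; do ?case: eqP => ? //.
exact: runs_push.
Qed.

End Registers.

(** * Polynomial bounds, and functions of a string and an environment *)

Lemma leq_expl m n e : m <= n -> m ^ e <= n ^ e.
Proof. by move=> h; case: e => // e; rewrite leq_exp2r. Qed.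

(** For bases above 1 the exponent absorbs all constants and sums, so that a single number describes
    a polynomial bound. [csize] is at least 2 for this reason. *)
Definition pb (f : nat -> nat) := exists e, forall a, 1 < a -> f a <= a ^ e.

Lemma pb_const k : pb (fun=> k).
Proof.
by exists k => a ha; apply/ltnW/ltn_expl.
Qed.

Lemma pb_exp e : pb (fun a => a ^ e).
Proof. by exists e. Qed.

Lemma pb_id : pb (fun a => a).
Proof. by exists 1. Qed.

Lemma pb_mul f g : pb f -> pb g -> pb (fun a => f a * g a).
Proof.
by case=> e he [e' he']; exists (e + e') => a ha; rewrite expnD leq_mul ?he ?he'.
Qed.

Lemma pb_add f g : pb f -> pb g -> pb (fun a => f a + g a).
Proof.
case=> e he [e' he']; exists (e + e').+1 => a ha.
have h1 : a ^ e <= a ^ (e + e') by apply: leq_pexp2l; lia.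
have h2 : a ^ e' <= a ^ (e + e') by apply: leq_pexp2l; lia.
have := he a ha; have := he' a ha; rewrite expnS.
have : 2 * a ^ (e + e') <= a * a ^ (e + e') by rewrite leq_mul2r ha orbT.
by lia.
Qed.

Lemma pb_pow f e : pb f -> pb (fun a => f a ^ e).
Proof.
case=> k hk; exists (k * e) => a ha; rewrite expnM.
by apply: leq_expl; apply: hk.
Qed.

Lemma pb_S f : pb f -> pb (fun a => (f a).+1).
Proof.
move=> h; have [e he] := pb_add h (pb_const 1).
by exists e => a /he; rewrite addn1.
Qed.

Ltac pb_tac := do ?[apply: pb_S | apply: pb_add | apply: pb_mul | exact: pb_exp
  | apply: pb_pow | exact: pb_id | exact: pb_const].

(** The argument of a computed function: an input string and an environment of numbers. Variables
    are de Bruijn indices, written as [top] after some [pop]s. *)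
Definition ctx := (seq bool * seq nat)%type.
Definition top (c : ctx) : nat := head 0 c.2.
Definition pop (c : ctx) : ctx := (c.1, behead c.2).
Definition push (n : nat) (c : ctx) : ctx := (c.1, n :: c.2).
Definition csize (c : ctx) : nat := (size c.1 + sumn c.2).+2.

Lemma csize_pop c : csize (pop c) <= csize c.
Proof. by case: c => x [|n e]; rewrite /csize /=; lia. Qed.

Lemma csize_push n c : csize (push n c) = csize c + n.
Proof. by rewrite /csize /=; lia. Qed.

(* The store [m] represents the context [c]: the string is in register [b], its
   variables are in unary in the registers [r], register [b.+1] and all
   registers from [s] on are empty. *)
Record holds aux (m : store aux) (b : nat) (r : seq nat) (s : nat) (c : ctx) : Prop :=
  Holds {
    holds_str : m b = map inl c.1;
    holds_tmp : m b.+1 = [::];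
    holds_base : b.+1 < s;
    holds_env : map m r = map (un aux) c.2;
    holds_regs : all (fun i => i < s) r;
    holds_free : forall i, s <= i -> m i = [::] }.

(** The result goes to the first free register and all others are restored, so programs compose.
    Alphabet and layout are arbitrary because the same function runs inside different programs, also
    next to a simulated machine. *)
Definition pc (F : ctx -> nat) : Prop :=
  forall (aux : finType) b r s, exists (p : prog aux) (e : nat), forall m c,
    holds m b r s c -> runs p m (csize c ^ e) (upd m s (un aux (F c))).

Definition pcb (P : ctx -> bool) : Prop := pc (fun c => P c : nat).

Lemma pc_intro F :
  (forall (aux : finType) b r s, exists (p : prog aux) f, pb f /\ forall m c,
    holds m b r s c -> runs p m (f (csize c)) (upd m s (un aux (F c)))) -> pc F.
Proof.
move=> h aux b r s; have [p [f [[e he] hp]]] := h aux b r s.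
by exists p, e => m c /hp hr; apply: runs_le hr _; apply: he.
Qed.

Lemma holds_weak aux (m : store aux) b r s c l :
  holds m b r s c -> holds (upd m s l) b r s.+1 c.
Proof.
case=> h1 h2 h3 h4 h5 h6; split; rewrite ?upd_neq //; try lia.
- rewrite -h4; apply/eq_in_map => i /(allP h5) hi; rewrite upd_neq //; lia.
- by apply/allP => i /(allP h5) /ltnW.
- by move=> i hi; rewrite upd_neq; [apply: h6|]; lia.
Qed.

Lemma holds_push aux (m : store aux) b r s c n :
  holds m b r s c -> holds (upd m s (un aux n)) b (s :: r) s.+1 (push n c).
Proof.
move=> h; case: (holds_weak (un aux n) h) => h1 h2 h3 h4 h5 h6.
by split; rewrite //= ?upd_eq ?h4 // ltnSn.
Qed.

Lemma holds_pop aux (m : store aux) b r s c :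
  holds m b r s c -> holds m b (behead r) s (pop c).
Proof.
case=> h1 h2 h3 h4 h5 h6; split=> //=; first by rewrite -!behead_map h4.
by case: r h5 {h4} => //= ? ? /andP[].
Qed.

Lemma runs_un_le aux (p : prog aux) m n s v :
  runs p m n (upd m s (un aux v)) -> m s = [::] -> v <= n.
Proof.
case=> t ht /exec_size /(_ s) hs ms; move: hs; rewrite upd_eq size_nseq ms /=.
by move/leq_trans; apply.
Qed.

Lemma pc_pop F : pc F -> pc (fun c => F (pop c)).
Proof.
move=> h aux b r s; have [p [e hp]] := h aux b (behead r) s.
exists p, e => m c /holds_pop /hp hr; apply: runs_le hr _.
by apply: leq_expl; apply: csize_pop.
Qed.

Lemma pc_0 : pc (fun=> 0).
Proof.
apply: pc_intro => aux b r s; exists Skip, (fun=> 1); split; first exact: pb_const.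
by move=> m c h; rewrite upd_id ?(holds_free h) //; apply: runs_skip.
Qed.

Lemma pc_S F : pc F -> pc (fun c => (F c).+1).
Proof.
move=> h; apply: pc_intro => aux b r s; have [p [e hp]] := h aux b r s.
exists (Seq p (Push s (inl true))), (fun a => a ^ e + 1); split; first by pb_tac.
move=> m c /hp hr; apply: runs_seq hr _.
by have := runs_push (upd m s (un aux (F c))) s (inl true); rewrite upd_eq upd_upd.
Qed.

Lemma pc_pred F : pc F -> pc (fun c => (F c).-1).
Proof.
move=> h; apply: pc_intro => aux b r s; have [p [e hp]] := h aux b r s.
exists (Seq p (Pop s)), (fun a => a ^ e + 1); split; first by pb_tac.
move=> m c /hp hr; apply: runs_seq hr _.
have := runs_pop (upd m s (un aux (F c))) s.
by rewrite upd_eq upd_upd; case: (F c).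
Qed.

Lemma pc_top : pc top.
Proof.
apply: pc_intro => aux b [|i r] s.
  exists Skip, (fun=> 1); split; first exact: pb_const.
  move=> m [x [|v e]] h; last by have := holds_env h.
  by rewrite upd_id ?(holds_free h) //; apply: runs_skip.
exists (copy aux i s s.+1), (fun a => (8 * a).+2); split; first by pb_tac.
move=> m [x [|v e]] h; first by have := holds_env h.
have [hi _] : m i = un aux v /\ True.
  by have := holds_env h => -[].
have is_s : i < s by have := holds_regs h => /= /andP[].
apply: runs_le (copy_runs _ hi _ _) _; rewrite ?(holds_free h) //.
  by rewrite /= !inE; lia.
by rewrite /csize /=; lia.
Qed.

Lemma holds_popn aux (m : store aux) b r s c j :
  holds m b r s c -> holds m b (iter j behead r) s (iter j pop c).
Proof. by move=> h; elim: j => //= j; apply: holds_pop. Qed.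

Lemma csize_popn j c : csize (iter j pop c) <= csize c.
Proof. by elim: j => //= j; apply: leq_trans (csize_pop _). Qed.

(** A local variable: the value of [F] stays in [s] while [G] runs. As the result of [G] then lies
    in [s.+1], the variable is cleared and the result moved down to [s]. *)
Lemma pc_let_pop j F G : pc F -> pc G -> pc (fun c => G (push (F c) (iter j pop c))).
Proof.
move=> hF hG; apply: pc_intro => aux b r s.
have [p [e hp]] := hF aux b r s.
have [q [e' hq]] := hG aux b (s :: iter j behead r) s.+1.
exists (Seq p (Seq q (Seq (clear aux s) (move isSome s.+1 s)))).
exists (fun a => a ^ e + ((a + a ^ e) ^ e' + ((2 * a ^ e).+1 + (4 * (a + a ^ e) ^ e').+1))).
split; first by pb_tac.
move=> m c hm; have hr := hp _ _ hm; set n := F c in hr *; set a := csize c.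
have hn : n <= a ^ e by apply: (runs_un_le hr); rewrite (holds_free hm).
apply: runs_seq (hr) _; have hm' := holds_push n (holds_popn j hm).
have {}hr := hq _ _ hm'; set k := G _ in hr *.
have hr' : runs q (upd m s (un aux n)) ((a + a ^ e) ^ e')
    (upd (upd m s (un aux n)) s.+1 (un aux k)).
  apply: runs_le hr _; apply: leq_expl; rewrite csize_push.
  by apply: leq_add => //; apply: csize_popn.
have hk : k <= (a + a ^ e) ^ e'.
  by apply: (runs_un_le hr'); rewrite (holds_free hm').
apply: runs_seq (hr') _; set m1 := upd (upd _ _ _) _ _.
apply: (runs_seq (m1 := upd m1 s [::])).
  apply: runs_le (clear_runs m1 s) _.
  by rewrite /m1 upd_neq ?upd_eq ?size_nseq; lia.
apply: runs_le (_ : runs _ _ (4 * k).+1 _) _; last lia.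
have -> : upd m s (un aux k) = upd (upd (upd m1 s [::]) s.+1 [::]) s (un aux (k + 0)).
  by rewrite addn0 /m1; store_eq; rewrite (holds_free hm).
by apply: move_un; [lia | rewrite /m1 upd_neq ?upd_eq //; lia | rewrite upd_eq].
Qed.

Lemma pc_if P F G : pcb P -> pc F -> pc G -> pc (fun c => if P c then F c else G c).
Proof.
move=> hP hF hG; apply: pc_intro => aux b r s.
have [p [e hp]] := hP aux b r s; have [q [e' hq]] := hF aux b r s.
have [q' [e2 hq']] := hG aux b r s.
exists (Seq p (Case s (fun a => if a then Seq (Pop s) q else q'))).
exists (fun a => a ^ e + (1 + a ^ e' + a ^ e2).+1); split; first by pb_tac.
move=> m c hm; apply: runs_seq (hp _ _ hm) _; apply: runs_case; rewrite upd_eq.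
case: (P c) => /=.
  apply: (runs_le (n := 1 + csize c ^ e')); last lia.
  apply: runs_seq (runs_pop _ _) _.
  rewrite upd_eq /= upd_upd (upd_id (holds_free hm (leqnn s))); exact: hq.
rewrite (upd_id (holds_free hm (leqnn s))).
by apply: runs_le (hq' _ _ hm) _; lia.
Qed.

(** The string is read by moving it to the spare register [b.+1], which reverses it; moving it back
    restores it. *)
Lemma pc_size : pc (fun c => size c.1).
Proof.
apply: pc_intro => aux b r s.
exists (Seq (While b isSome (Seq (shift aux b b.+1) (Push s (inl true))))
            (move isSome b.+1 b)).
exists (fun a => (a * 5).+1 + (4 * a).+1); split; first by pb_tac.
move=> m c hm; set x := map inl c.1 : seq (sym aux).
have hx : m b = x := holds_str hm.
have sx : size c.1 = size x by rewrite size_map.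
have hs := holds_base hm; have h0 := holds_free hm (leqnn s).
have sa : size x <= csize c by rewrite -sx /csize; lia.
pose ms k := upd (upd (upd m b (drop k x)) b.+1 (catrev (take k x) [::])) s (un aux k).
have hw : runs (While b isSome (Seq (shift aux b b.+1) (Push s (inl true)))) (ms 0)
    (size x * 5).+1 (ms (size x)).
  apply: runs_while => [k kn|]; last first.
    by rewrite /ms drop_size; updE.
  have hd := drop_nth (inl true) kn; set z := nth _ x k in hd.
  have hb : ms k b = z :: drop k.+1 x.
    by rewrite /ms hd; updE.
  split; first by rewrite hb.
  apply: (runs_seq (n := 3) (n' := 1)); first by apply: shift_runs hb; lia.
  set m1 := upd _ _ _; have -> : ms k.+1 = upd m1 s (inl true :: m1 s); last exact: runs_push.
  have -> : m1 s = un aux k by rewrite /m1 /ms; updE.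
  have -> : m1 = upd (upd (ms k) b (drop k.+1 x)) b.+1 (z :: catrev (take k x) [::]).
    by rewrite /m1 /ms; store_eq.
  rewrite /ms (take_nth (inl true) kn) -/z !catrevE !cats0 rev_rcons.
  by store_eq.
have e0 : ms 0 = m.
  by rewrite /ms take0 drop0 /=; store_eq; rewrite ?(holds_tmp hm) ?h0.
apply: (runs_seq (m1 := ms (size x))); first by rewrite -{1}e0; apply: runs_le hw _; lia.
clear hw e0.
rewrite /ms drop_size take_size; set m1 := upd _ _ _.
have -> : upd m s (un aux (size c.1)) =
   upd (upd m1 b.+1 [::]) b (catrev (catrev x [::]) (m1 b)).
  have -> : m1 b = [::] by rewrite /m1; updE.
  rewrite /m1 !catrevE !cats0 revK sx; store_eq; rewrite ?(holds_tmp hm) //; lia.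
apply: runs_le (move_runs (s := catrev x [::]) (r := [::]) _ _ _ _) _ => //; try lia.
- by rewrite /m1 cats0; updE.
- by apply/allP.
- by rewrite catrevE cats0 size_rev; lia.
Qed.

Lemma pc_nth_str F : pc F -> pcb (fun c => nth false c.1 (F c)).
Proof.
move=> hF; apply: pc_intro => aux b r s.
have [p [e hp]] := hF aux b r s.
exists (Seq p (Seq (While s isSome (Seq (Pop s) (shift aux b b.+1)))
  (Seq (Case b (fun a => if a == Some (inl true) then Push s (inl true) else Skip))
       (move isSome b.+1 b)))).
exists (fun a => a ^ e + ((a ^ e * 5).+1 + (2 + (4 * a).+1))); split; first by pb_tac.
move=> m c hm; have hr := hp _ _ hm; set n := F c in hr *.
have hn : n <= csize c ^ e by apply: (runs_un_le hr); rewrite (holds_free hm).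
apply: runs_seq (hr) _; set x := map inl c.1 : seq (sym aux).
have hx : m b = x := holds_str hm.
have sx : size c.1 = size x by rewrite size_map.
have hs := holds_base hm; have h0 := holds_free hm (leqnn s).
have sa : size x <= csize c by rewrite -sx /csize; lia.
pose ms k := upd (upd (upd m b (drop k x)) b.+1 (catrev (take k x) [::])) s (un aux (n - k)).
have hw : runs (While s isSome (Seq (Pop s) (shift aux b b.+1))) (ms 0)
    (n * 5).+1 (ms n).
  apply: runs_while => [k kn|]; last by rewrite /ms upd_eq subnn.
  split; first by rewrite /ms upd_eq; case E: (n - k) => //; lia.
  apply: (runs_seq (n := 1) (n' := 3)); first exact: runs_pop.
  have -> : behead (ms k s) = un aux (n - k.+1).
    by rewrite /ms upd_eq subnS; case: (n - k).
  set m1 := upd _ _ _; have hb : m1 b = drop k x.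
    by rewrite /m1 /ms; updE.
  have hb1 : m1 b.+1 = catrev (take k x) [::].
    by rewrite /m1 /ms; updE.
  (* An index beyond the end exhausts register [b]; the remaining rounds only decrease the counter,
     and the default bit [false] results. *)
  case: (ltnP k (size x)) => kx.
    have hd := drop_nth (inl true) kx; set z := nth _ x k in hd.
    have -> : ms k.+1 = upd (upd m1 b (drop k.+1 x)) b.+1 (z :: m1 b.+1).
      rewrite hb1 /m1 /ms (take_nth (inl true) kx) -/z !catrevE !cats0 rev_rcons.
      by store_eq.
    by apply: shift_runs; rewrite ?hb ?hd //; lia.
  have -> : ms k.+1 = m1.
    by rewrite /m1 /ms !take_oversize ?drop_oversize //; try lia; store_eq.
  by apply: runs_case; rewrite hb drop_oversize //; apply: runs_skip.
have e0 : ms 0 = upd m s (un aux n).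
  by rewrite /ms take0 drop0 subn0 /=; store_eq; rewrite ?(holds_tmp hm) ?h0.
apply: (runs_seq (m1 := ms n)); first by rewrite -{1}e0; apply: runs_le hw _; lia.
clear hw e0.
rewrite /ms subnn; set m1 := upd _ _ _.
apply: (runs_seq (m1 := upd m1 s (un aux (nth false c.1 n)))).
  apply: runs_case; have -> : m1 b = drop n x by rewrite /m1; updE.
  have -> : (ohead (drop n x) == Some (inl true)) = nth false c.1 n.
    have -> : nth false c.1 n = nth false (drop n c.1) 0 by rewrite nth_drop addn0.
    by rewrite /x -map_drop; case: (drop n c.1) => [|[] l].
  have m1s : m1 s = [::] by rewrite /m1 upd_eq.
  case: (nth _ _ _); last by rewrite upd_id //; apply: runs_skip.
  by have := runs_push m1 s (inl true); rewrite m1s.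
set m2 := upd m1 _ _.
have -> : upd m s (un aux (nth false c.1 n)) =
   upd (upd m2 b.+1 [::]) b (catrev (catrev (take n x) [::]) (m2 b)).
  have -> : m2 b = drop n x by rewrite /m2 /m1; updE.
  rewrite /m2 /m1 !catrevE !cats0 revK cat_take_drop; store_eq; rewrite ?(holds_tmp hm) //; lia.
apply: runs_le (move_runs (s := catrev (take n x) [::]) (r := [::]) _ _ _ _) _ => //; try lia.
- by rewrite /m2 /m1 cats0; updE.
- by apply/allP.
- by rewrite catrevE cats0 size_rev size_take; case: ifP; lia.
Qed.

Definition pbd (F : ctx -> nat) : Prop :=
  forall n, exists e, forall c, size c.2 = n -> F c <= csize c ^ e.

(** The result is in unary, hence at most the running time. The exponent in [pc] depends on the
    layout; fixing one layout for each number of variables makes it uniform. *)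
Lemma pc_pbd F : pc F -> pbd F.
Proof.
move=> h n; have [p [e hp]] := h unit 0 (iota 2 n) n.+2.
exists e => c hc.
pose m : store unit := fun i =>
  if i == 0 then map inl c.1 else if i == 1 then [::] else un unit (nth 0 c.2 (i - 2)).
have hm : holds m 0 (iota 2 n) n.+2 c.
  split=> //; rewrite ?/m //.
  - rewrite -[2]addn0 iotaDl -map_comp.
    apply: (@eq_from_nth _ [::]); rewrite !size_map size_iota ?hc // => i hi.
    rewrite (nth_map 0) ?size_iota //= (nth_map 0) ?hc // nth_iota // /m.
    by rewrite !add2n /= subn2.
  - by apply/allP => i; rewrite mem_iota; lia.
  - move=> i hi; case: eqP => [?|_]; first lia; case: eqP => [?|_]; first lia.
    by rewrite nth_default // hc; lia.
by apply: runs_un_le (hp _ _ hm) _; rewrite (holds_free hm).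
Qed.

(** The bound [B] on the intermediate values is essential: iterating a cheap step such as doubling
    can produce exponential values. *)
Lemma pc_iteri (N a B : ctx -> nat) (f : ctx -> nat -> nat -> nat) :
  pc N -> pc a -> pbd B ->
  pc (fun c => f (pop (pop c)) (top (pop c)) (top c)) ->
  (forall c i, i <= N c -> iteri i (f c) (a c) <= B c) ->
  pc (fun c => iteri (N c) (f c) (a c)).
Proof.
move=> hN ha hB hf bnd; apply: pc_intro => aux b r s.
have [pN [eN hpN]] := hN aux b r s.
have [pa [ea hpa]] := ha aux b r s.+1.
have [eB hpB] := hB (size r).
have [p [e hp]] := hf aux b [:: s.+1, s.+2 & r] s.+3.
pose body := Seq (Pop s) (Seq p (Seq (clear aux s.+1)
  (Seq (move isSome s.+3 s.+1) (Push s.+2 (inl true))))).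
exists (Seq pN (Seq pa (Seq (While s isSome body)
  (Seq (clear aux s.+2) (move isSome s.+1 s))))).
pose T a := (1 + ((a + a ^ eN + a ^ eB) ^ e +
  ((2 * a ^ eB).+1 + ((4 * a ^ eB).+1 + 1)))).
exists (fun a => a ^ eN + (a ^ ea + ((a ^ eN * (T a).+1).+1 +
  ((2 * a ^ eN).+1 + (4 * a ^ eB).+1)))).
split; first by rewrite /T; pb_tac.
move=> m c hm; set A := csize c; set n := N c.
have fr i : s <= i -> m i = [::] := @holds_free _ _ _ _ _ _ hm i.
have hrN := hpN _ _ hm.
have hn : n <= A ^ eN by apply: (runs_un_le hrN); rewrite fr.
have hBd : B c <= A ^ eB.
  by apply: hpB; have /(congr1 size) := holds_env hm; rewrite !size_map.
apply: runs_seq hrN _; rewrite -/n; have hm1 := holds_weak (un aux n) hm.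
apply: runs_seq (hpa _ _ hm1) _.
pose acc k := iteri k (f c) (a c).
have hacc k : k <= n -> acc k <= A ^ eB by move=> /bnd h; apply: leq_trans hBd.
(* Register [s] counts down, [s.+1] holds the accumulator and [s.+2] the number of the round. *)
pose ms k := upd (upd (upd m s (un aux (n - k))) s.+1 (un aux (acc k))) s.+2 (un aux k).
have e0 : upd (upd m s (un aux n)) s.+1 (un aux (a c)) = ms 0.
  by rewrite /ms subn0; store_eq; rewrite fr.
have e1 : upd m s (un aux (acc n)) =
    upd (upd (upd (ms n) s.+2 [::]) s.+1 [::]) s (un aux (acc n + 0)).
  by rewrite /ms addn0 subnn; clear e0; store_eq; rewrite fr.
rewrite -/(acc n) e1 e0; apply: (runs_seq (m1 := ms n)); last first.
  apply: (runs_seq (m1 := upd (ms n) s.+2 [::])).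
    apply: runs_le (clear_runs _ _) _.
    by rewrite /ms upd_eq size_nseq ltnS leq_mul2l.
  apply: (runs_le (n := (4 * acc n).+1)); last by rewrite ltnS leq_mul2l hacc.
  apply: move_un; first by lia.
    by rewrite /ms; updE.
  by rewrite /ms subnn; updE.
apply: runs_le (runs_while (T := T A) (N := n) _ _) _; first last.
- by rewrite ltnS leq_mul2r hn orbT.
- by rewrite /ms subnn; updE.
move=> k kn; split.
  have -> : ms k s = un aux (n - k) by rewrite /ms; updE.
  by case E: (n - k) => //; lia.
apply: runs_seq (runs_pop _ _) _; clear e0 e1.
have -> : upd (ms k) s (behead (ms k s)) =
    upd (upd (upd m s (un aux (n - k.+1))) s.+2 (un aux k)) s.+1 (un aux (acc k)).
  have -> : behead (ms k s) = un aux (n - k.+1).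
    have -> : ms k s = un aux (n - k) by rewrite /ms; updE.
    by rewrite subnS; case: (n - k).
  by rewrite /ms; store_eq.
set m1 := upd _ _ _; pose c' := push (acc k) (push k c).
have hc' : holds m1 b [:: s.+1, s.+2 & r] s.+3 c'.
  case: hm => h1 h2 h3 h4 h5 h6; rewrite /m1; split.
  - by rewrite -h1; updE.
  - by rewrite -h2; updE.
  - by lia.
  - rewrite /= -h4; congr [:: _, _ & _]; rewrite ?upd_eq //; first by updE.
    by apply/eq_in_map => i /(allP h5) hi; updE.
  - by rewrite /= ltnSn leqnSn /=; apply/allP => i /(allP h5); lia.
  - by move=> i hi; rewrite -(h6 i) ?/upd; [updE|lia].
have fc' : f (pop (pop c')) (top (pop c')) (top c') = acc k.+1.
  by rewrite /c' /pop /push /top /=; case: (c).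
have := hp _ _ hc'; rewrite fc' => hr.
apply: runs_seq (runs_le hr _) _.
  apply: leq_expl; rewrite /c' !csize_push; have := hacc k (ltnW kn); lia.
set m2 := upd m1 _ _; apply: (runs_seq (m1 := upd m2 s.+1 [::])).
  apply: runs_le (clear_runs _ _) _.
  have -> : m2 s.+1 = un aux (acc k) by rewrite /m2 /m1; updE.
  by rewrite size_nseq ltnS leq_mul2l /=; exact: hacc (ltnW kn).
apply: (runs_seq (m1 := upd (upd (upd m2 s.+1 [::]) s.+3 [::]) s.+1 (un aux (acc k.+1 + 0)))).
  apply: (runs_le (n := (4 * acc k.+1).+1)); last by rewrite ltnS leq_mul2l hacc.
  apply: move_un; first by lia.
    by rewrite /m2; updE.
  by updE.
set m3 := upd (upd _ _ _) _ _.
have h3 : m3 s.+2 = un aux k by rewrite /m3 /m2 /m1; updE.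
have := runs_push m3 s.+2 (inl true); rewrite h3.
have -> // : upd m3 s.+2 (inl true :: un aux k) = ms k.+1.
have fr3 : m s.+3 = [::] by apply: fr; lia.
by rewrite /m3 /m2 /m1 /ms addn0; clear -fr3; store_eq.
Qed.

Lemma pc_ext F G : F =1 G -> pc G -> pc F.
Proof. by move=> /functional_extensionality ->. Qed.

Lemma pbd_add F G : pbd F -> pbd G -> pbd (fun c => F c + G c).
Proof.
move=> hF hG n; have [e he] := hF n; have [e' he'] := hG n.
have [k hk] := pb_add (pb_exp e) (pb_exp e').
by exists k => c hc; apply: leq_trans (hk _ _); rewrite ?leq_add ?he ?he'.
Qed.

Lemma pbd_mul F G : pbd F -> pbd G -> pbd (fun c => F c * G c).
Proof.
move=> hF hG n; have [e he] := hF n; have [e' he'] := hG n.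
by exists (e + e') => c hc; rewrite expnD leq_mul ?he ?he'.
Qed.

Lemma pc_const k : pc (fun=> k).
Proof. by elim: k => [|k]; [apply: pc_0 | apply: pc_S]. Qed.

Definition cm (k : ctx -> ctx) : Prop := exists j, forall c, k c = iter j pop c.

Lemma cm_id : cm id.
Proof. by exists 0. Qed.

Lemma cm_pop k : cm k -> cm (fun c => pop (k c)).
Proof. by case=> j hj; exists j.+1 => c; rewrite hj. Qed.

Lemma pc_cm k F : cm k -> pc F -> pc (fun c => F (k c)).
Proof.
case=> j hj hF; apply: (pc_ext (G := fun c => F (iter j pop c))) => [c|]; first by rewrite hj.
elim: j F hF {hj} => [|j IH] F hF //.
exact: (IH (fun c => F (pop c)) (pc_pop hF)).
Qed.

Lemma pop_push n c : pop (push n c) = c.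
Proof. by case: c. Qed.

Lemma pc_subst k V (f : ctx -> nat -> nat) :
  cm k -> pc V -> pc (fun c => f (pop c) (top c)) -> pc (fun c => f (k c) (V c)).
Proof.
case=> j hj hV /(pc_let_pop j hV); apply: pc_ext => c.
by rewrite pop_push hj.
Qed.

Lemma pc_iter (N a B : ctx -> nat) (f : ctx -> nat -> nat) :
  pc N -> pc a -> pbd B -> pc (fun c => f (pop c) (top c)) ->
  (forall c i, i <= N c -> iter i (f c) (a c) <= B c) ->
  pc (fun c => iter (N c) (f c) (a c)).
Proof.
move=> hN ha hB hf bnd.
have e n c : iter n (f c) (a c) = iteri n (fun=> f c) (a c) by elim: n => //= n ->.
apply: (pc_ext (G := fun c => iteri (N c) (fun=> f c) (a c))) => [c|]; first exact: e.
apply: (pc_iteri (f := fun c _ => f c)) hB _ _ => //.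
by apply: pc_subst pc_top hf; exists 2.
Qed.

Lemma pc_add F G : pc F -> pc G -> pc (fun c => F c + G c).
Proof.
move=> hF hG; have it m n : m + n = iter n S m by elim: n => [|n IH]; rewrite ?addn0 // addnS IH.
apply: (pc_ext (G := fun c => iter (G c) S (F c))) => [c|]; first exact: it.
apply: (pc_iter (f := fun _ => S)) (pbd_add (pc_pbd hF) (pc_pbd hG)) _ _ => //.
  exact/pc_S/pc_top.
by move=> c i hi; rewrite -it leq_add2l.
Qed.

Lemma pc_sub F G : pc F -> pc G -> pc (fun c => F c - G c).
Proof.
move=> hF hG; have it m n : m - n = iter n predn m.
  by elim: n => [|n IH]; rewrite ?subn0 // subnS IH.
apply: (pc_ext (G := fun c => iter (G c) predn (F c))) => [c|]; first exact: it.
apply: (pc_iter (f := fun _ => predn)) (pc_pbd hF) _ _ => //.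
  exact/pc_pred/pc_top.
by move=> c i hi; rewrite -it leq_subr.
Qed.

Lemma pc_mul F G : pc F -> pc G -> pc (fun c => F c * G c).
Proof.
move=> hF hG; have it m n : m * n = iter n (addn m) 0.
  by elim: n => [|n IH]; rewrite ?muln0 // mulnS IH.
apply: (pc_ext (G := fun c => iter (G c) (addn (F c)) 0)) => [c|]; first exact: it.
apply: (pc_iter (f := fun c => addn (F c))) (pbd_mul (pc_pbd hF) (pc_pbd hG)) _ _ => //.
- exact: pc_0.
- exact: pc_add (pc_pop hF) pc_top.
- by move=> c i hi; rewrite -it leq_mul2l hi orbT.
Qed.

Lemma pc_exp F k : pc F -> pc (fun c => F c ^ k).
Proof.
move=> hF; elim: k => [|k IH]; first exact: pc_const.
by apply: (pc_ext (G := fun c => F c * F c ^ k)) (pc_mul hF IH) => c; rewrite expnS.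
Qed.

Lemma pcb_const b : pcb (fun=> b).
Proof. exact: pc_const. Qed.

Lemma pcb_eq0 F : pc F -> pcb (fun c => F c == 0).
Proof.
by move=> hF; apply: pc_ext (pc_sub (pc_const 1) hF) => c; case: (F c).
Qed.

Lemma pcb_leq F G : pc F -> pc G -> pcb (fun c => F c <= G c).
Proof. by move=> hF hG; apply: pcb_eq0 (pc_sub hF hG). Qed.

Lemma pcb_if P Q R : pcb P -> pcb Q -> pcb R -> pcb (fun c => if P c then Q c else R c).
Proof.
move=> hP hQ hR; apply: pc_ext (pc_if hP hQ hR) => c; by case: (P c).
Qed.

Lemma pcb_neg P : pcb P -> pcb (fun c => ~~ P c).
Proof. by move=> hP; apply: (pcb_if hP (pcb_const false) (pcb_const true)). Qed.

Lemma pcb_and P Q : pcb P -> pcb Q -> pcb (fun c => P c && Q c).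
Proof. by move=> hP hQ; apply: (pcb_if hP hQ (pcb_const false)). Qed.

Lemma pcb_or P Q : pcb P -> pcb Q -> pcb (fun c => P c || Q c).
Proof. by move=> hP hQ; apply: (pcb_if hP (pcb_const true) hQ). Qed.

Lemma pcb_imp P Q : pcb P -> pcb Q -> pcb (fun c => P c ==> Q c).
Proof. by move=> hP hQ; apply: (pcb_if hP hQ (pcb_const true)). Qed.

Lemma pcb_eqn F G : pc F -> pc G -> pcb (fun c => F c == G c).
Proof.
move=> hF hG; apply: pc_ext (pcb_and (pcb_leq hF hG) (pcb_leq hG hF)) => c.
by rewrite eqn_leq.
Qed.

Lemma pcb_eqb P Q : pcb P -> pcb Q -> pcb (fun c => P c == Q c).
Proof.
move=> hP hQ; apply: pc_ext (pcb_if hP hQ (pcb_neg hQ)) => c.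
by case: (P c); case: (Q c).
Qed.

Lemma pc_min F G : pc F -> pc G -> pc (fun c => minn (F c) (G c)).
Proof. by move=> hF hG; apply: pc_if => //; apply: pcb_leq => //; apply: pc_S. Qed.

Lemma pcb_all N (P : ctx -> nat -> bool) :
  pc N -> pcb (fun c => P (pop c) (top c)) ->
  pcb (fun c => all (P c) (iota 0 (N c))).
Proof.
move=> hN hP; pose f c i acc := nat_of_bool ((acc != 0) && P c i).
have e n c : nat_of_bool (all (P c) (iota 0 n)) = iteri n (f c) 1.
  elim: n => [|n IH] //; rewrite -addn1 iotaD all_cat addn1 iteriS -IH /f /= andbT add0n.
  by case: all.
apply: (pc_ext (G := fun c => iteri (N c) (f c) 1)) => [c|]; first exact: e.
apply: (pc_iteri (f := f)) (pc_pbd (pc_const 1)) _ _ => //; first exact: pc_const.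
- by apply: pcb_and (pc_pop hP); apply: pcb_neg; apply: pcb_eq0; apply: pc_top.
- by move=> c i _; rewrite -e; case: all.
Qed.

Lemma pcb_has N (P : ctx -> nat -> bool) :
  pc N -> pcb (fun c => P (pop c) (top c)) ->
  pcb (fun c => has (P c) (iota 0 (N c))).
Proof.
move=> hN hP.
have := pcb_neg (pcb_all (P := fun c i => ~~ P c i) hN (pcb_neg hP)).
apply: pc_ext => c; rewrite -has_predC; congr nat_of_bool.
by apply: eq_has => i /=; rewrite negbK.
Qed.

Lemma pc_find N (P : ctx -> nat -> bool) :
  pc N -> pcb (fun c => P (pop c) (top c)) ->
  pc (fun c => find (P c) (iota 0 (N c))).
Proof.
move=> hN hP.
(* The accumulator equals [i] as long as no index below [i] satisfies [P c]; otherwise it is the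
   first such index. *)
pose f c i acc := if (acc == i) && ~~ P c i then i.+1 else acc.
have e n c : find (P c) (iota 0 n) = iteri n (f c) 0.
  elim: n => [|n IH] //; rewrite -addn1 iotaD find_cat addn1 iteriS -IH /f /= add0n.
  rewrite size_iota has_find size_iota; have := find_size (P c) (iota 0 n).
  rewrite size_iota; move: (find _ _) => q qn.
  case: (ltnP q n) => hq; first by rewrite (ltn_eqF hq).
  have -> : q = n by lia.
  by rewrite eqxx; case: (P c n); rewrite ?addn0 ?addn1.
apply: (pc_ext (G := fun c => iteri (N c) (f c) 0)) => [c|]; first exact: e.
apply: (pc_iteri (f := f)) (pc_pbd hN) _ _ => //; first exact: pc_const.
- apply: pc_if; [apply: pcb_and|apply: pc_S; apply: pc_pop|]; try exact: pc_top.
    by apply: pcb_eqn pc_top (pc_pop pc_top).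
  exact/pcb_neg/(pc_pop hP).
- by move=> c i hi; rewrite -e (leq_trans (find_size _ _)) ?size_iota.
Qed.

Lemma pc_count N (P : ctx -> nat -> bool) :
  pc N -> pcb (fun c => P (pop c) (top c)) ->
  pc (fun c => count (P c) (iota 0 (N c))).
Proof.
move=> hN hP; pose f c i acc := acc + P c i.
have e n c : count (P c) (iota 0 n) = iteri n (f c) 0.
  by elim: n => [|n IH] //; rewrite -addn1 iotaD count_cat addn1 iteriS -IH /f /= addn0 add0n.
apply: (pc_ext (G := fun c => iteri (N c) (f c) 0)) => [c|]; first exact: e.
apply: (pc_iteri (f := f)) (pc_pbd hN) _ _ => //; first exact: pc_const.
- exact: pc_add pc_top (pc_pop hP).
- by move=> c i hi; rewrite -e (leq_trans (count_size _ _)) ?size_iota.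
Qed.

(** The quotient is the first [i] with [F c < G c * i.+1]. Searching below [F c] suffices: the
    quotient is at most [F c], which is also what [find] returns on failure. *)
Lemma pc_div F G : pc F -> pc G -> pc (fun c => F c %/ G c).
Proof.
move=> hF hG; apply: (pc_ext (G := fun c => if G c == 0 then 0 else
    find (fun i => F c < G c * i.+1) (iota 0 (F c)))) => [c|]; last first.
  apply: pc_if; [exact: pcb_eq0 | exact: pc_0|].
  apply: (pc_find (P := fun c i => F c < G c * i.+1)) => //.
  apply: pcb_leq; first exact/pc_S/pc_pop.
  by apply: pc_mul; [apply: pc_pop | apply/pc_S/pc_top].
case: (posnP (G c)) => [->|d0]; first by rewrite divn0.
move: (F c) (G c) d0 => m d d0.
have hP i : (m < d * i.+1) = (m %/ d <= i) by rewrite mulnC -ltn_divLR.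
rewrite (eq_find hP); have := leq_div m d; move: (m %/ d) => q qm.
rewrite -{1}(subnKC qm) iotaD find_cat size_iota add0n.
have -> : has (fun i => q <= i) (iota 0 q) = false.
  by apply/hasPn => i; rewrite mem_iota -ltnNge.
by case: (m - q) => [|k] /=; rewrite ?addn0 // leqnn addn0.
Qed.

Lemma pc_mod F G : pc F -> pc G -> pc (fun c => F c %% G c).
Proof.
move=> hF hG; apply: pc_ext (pc_sub hF (pc_mul (pc_div hF hG) hG)) => c.
by rewrite {2}(divn_eq (F c) (G c)) addKn.
Qed.

Lemma pc_half F : pc F -> pc (fun c => (F c)./2).
Proof. by move=> hF; apply: pc_ext (pc_div hF (pc_const 2)) => c; rewrite divn2. Qed.

Lemma pc_double F : pc F -> pc (fun c => (F c).*2).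
Proof. by move=> hF; apply: pc_ext (pc_add hF hF) => c; rewrite addnn. Qed.

Lemma pcb_odd F : pc F -> pcb (fun c => odd (F c)).
Proof. by move=> hF; apply: pc_ext (pc_mod hF (pc_const 2)) => c; rewrite modn2. Qed.

Lemma pc_table (t : seq nat) F : pc F -> pc (fun c => nth 0 t (F c)).
Proof.
elim: t F => [|a t IH] F hF; first by apply: pc_ext pc_0 => c; rewrite nth_nil.
apply: pc_ext (pc_if (pcb_eq0 hF) (pc_const a) (IH _ (pc_pred hF))) => c.
by case: (F c).
Qed.

(** A string is given by its length and by its bits on demand. It is never stored; [ps_emit] writes
    it out bit by bit at the very end. *)
Definition ps (S : ctx -> seq bool) : Prop :=
  pc (fun c => size (S c)) /\ pcb (fun c => nth false (S (pop c)) (top c)).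

Lemma ps_size S : ps S -> pc (fun c => size (S c)).
Proof. by case. Qed.

Lemma ps_nth S F : ps S -> pc F -> pcb (fun c => nth false (S c) (F c)).
Proof.
by case=> _ hS hF; apply: (pc_subst (f := fun c n => nat_of_bool (nth false (S c) n)) cm_id).
Qed.

Lemma ps_cm k S : cm k -> ps S -> ps (fun c => S (k c)).
Proof.
move=> hk [hs hS]; split; first exact: (pc_cm hk hs).
apply: (pc_subst (f := fun c n => nat_of_bool (nth false (S c) n))
  (k := fun c => k (pop c))) pc_top hS.
by case: hk => j hj; exists j.+1 => c; rewrite hj iterSr.
Qed.

Lemma ps_input : ps (fun c => c.1).
Proof. by split; [apply: pc_size | apply: (pc_nth_str pc_top)]. Qed.

Lemma ps_mkseq N (P : ctx -> nat -> bool) :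
  pc N -> pcb (fun c => P (pop c) (top c)) -> ps (fun c => mkseq (P c) (N c)).
Proof.
move=> hN hP; split; first by apply: pc_ext hN => c; rewrite size_mkseq.
apply: pc_ext (pcb_and (pcb_leq (pc_S pc_top) (pc_pop hN)) hP) => c.
case: ltnP => h; first by rewrite nth_mkseq.
by rewrite nth_default ?size_mkseq.
Qed.

Lemma ps_drop S F : ps S -> pc F -> ps (fun c => drop (F c) (S c)).
Proof.
move=> hS hF; split.
  by apply: pc_ext (pc_sub (ps_size hS) hF) => c; rewrite size_drop.
have hS' := ps_cm (cm_pop cm_id) hS.
by apply: pc_ext (ps_nth hS' (pc_add (pc_pop hF) pc_top)) => c; rewrite nth_drop.
Qed.

Lemma ps_ext S S' : S =1 S' -> ps S' -> ps S.
Proof. by move=> /functional_extensionality ->. Qed.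

Lemma size_pair_str x y : size (pair_str x y) = (size x).*2.+1 + size y.
Proof. by elim: x => //= b x ->. Qed.

Lemma nth_pair_str x y i : nth false (pair_str x y) i =
  if i < (size x).*2 then ~~ odd i || nth false x i./2
  else if i == (size x).*2 then false else nth false y (i - (size x).*2.+1).
Proof.
elim: x i => [|b x IH] i; first by case: i => [|i] //=; rewrite subn1.
by case: i => [|[|i]] //=; rewrite IH ltnS ltnS negbK.
Qed.

Lemma ps_pair S S' : ps S -> ps S' -> ps (fun c => pair_str (S c) (S' c)).
Proof.
move=> hS hS'; split.
  apply: pc_ext (pc_add (pc_S (pc_double (ps_size hS))) (ps_size hS')) => c.
  by rewrite size_pair_str.
have pS := ps_cm (cm_pop cm_id) hS; have pS' := ps_cm (cm_pop cm_id) hS'.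
have d := pc_double (ps_size pS).
apply: pc_ext (pcb_if (pcb_leq (pc_S pc_top) d)
  (pcb_or (pcb_neg (pcb_odd pc_top)) (ps_nth pS (pc_half pc_top)))
  (pcb_if (pcb_eqn pc_top d) (pcb_const false)
    (ps_nth pS' (pc_sub pc_top (pc_S d))))) => c.
by rewrite nth_pair_str.
Qed.

Lemma ps_nseq F : pc F -> ps (fun c => nseq (F c) true).
Proof.
move=> hF; apply: ps_ext (ps_mkseq (P := fun _ _ => true) hF (pcb_const _)) => c.
by apply: (@eq_from_nth _ false); rewrite size_nseq ?size_mkseq // => i hi;
   rewrite nth_nseq hi nth_mkseq.
Qed.

Lemma ps_bit P : pcb P -> ps (fun c => [:: P c]).
Proof. move=> hP.
exact: (ps_mkseq (N := fun=> 1) (P := fun c _ => P c) (pc_const 1) (pc_pop hP)). Qed.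

(** A hook called by [pc_step]; it is redefined below whenever further functions have been shown
    computable. *)
Ltac pc_user := fail.
Ltac cm_tac := repeat first [exact cm_id | apply cm_pop].
Ltac pc_step :=
  first [ assumption | lazymatch goal with
  | |- cm _ => cm_tac
  | |- ps (fun c => c.1) => exact ps_input
  | |- ps (fun c => (?k c).1) => apply (@ps_cm k (fun c => c.1)); [cm_tac | exact ps_input]
  | |- ps (fun c => (pop (@?k c)).1) =>
      apply (@ps_cm (fun c => pop (k c)) (fun c => c.1)); [cm_tac | exact ps_input]
  | |- ps (fun c => ?S (pop (@?k c))) =>
      apply (@ps_cm (fun c => pop (k c)) S); [cm_tac | ]
  | |- ps (fun c => pair_str (@?S c) (@?S' c)) => apply (@ps_pair S S')
  | |- ps (fun c => drop (@?F c) (@?S c)) => apply (@ps_drop S F)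
  | |- ps (fun c => mkseq (@?P c) (@?N c)) => apply (@ps_mkseq N P)
  | |- ps (fun c => nseq (@?N c) true) => apply (@ps_nseq N)
  | |- ps (fun c => [:: @?P c]) => apply (@ps_bit P)
  | |- pc (fun c => nat_of_bool (@?P c)) => change (pcb P)
  | |- pc (fun _ => ?k) => exact (pc_const k)
  | |- pcb (fun _ => ?k) => exact (pcb_const k)
  | |- pc (fun c => S (@?F c)) => apply (@pc_S F)
  | |- pc (fun c => predn (@?F c)) => apply (@pc_pred F)
  | |- pc (fun c => addn (@?F c) (@?G c)) => apply (@pc_add F G)
  | |- pc (fun c => subn (@?F c) (@?G c)) => apply (@pc_sub F G)
  | |- pc (fun c => muln (@?F c) (@?G c)) => apply (@pc_mul F G)
  | |- pc (fun c => divn (@?F c) (@?G c)) => apply (@pc_div F G)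
  | |- pc (fun c => modn (@?F c) (@?G c)) => apply (@pc_mod F G)
  | |- pc (fun c => minn (@?F c) (@?G c)) => apply (@pc_min F G)
  | |- pc (fun c => expn (@?F c) ?k) => apply (@pc_exp F k)
  | |- pc (fun c => half (@?F c)) => apply (@pc_half F)
  | |- pc (fun c => double (@?F c)) => apply (@pc_double F)
  | |- pc (fun c => size (@?F c)) => apply (@ps_size F)
  | |- pc (fun c => nth 0 ?t (@?F c)) => apply (@pc_table t F)
  | |- pc (fun c => find (@?P c) (iota 0 (@?N c))) => apply (@pc_find N P)
  | |- pc (fun c => count (@?P c) (iota 0 (@?N c))) => apply (@pc_count N P)
  | |- pcb (fun c => all (@?P c) (iota 0 (@?N c))) => apply (@pcb_all N P)
  | |- pcb (fun c => has (@?P c) (iota 0 (@?N c))) => apply (@pcb_has N P)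
  | |- pcb (fun c => negb (@?P c)) => apply (@pcb_neg P)
  | |- pcb (fun c => andb (@?P c) (@?Q c)) => apply (@pcb_and P Q)
  | |- pcb (fun c => orb (@?P c) (@?Q c)) => apply (@pcb_or P Q)
  | |- pcb (fun c => implb (@?P c) (@?Q c)) => apply (@pcb_imp P Q)
  | |- pcb (fun c => leq (@?F c) (@?G c)) => apply (@pcb_leq F G)
  | |- pcb (fun c => eq_op (@?F c) (@?G c)) =>
      first [apply (@pcb_eqn F G) | apply (@pcb_eqb F G)]
  | |- pcb (fun c => odd (@?F c)) => apply (@pcb_odd F)
  | |- pcb (fun c => nth false (@?S c) (@?F c)) => apply (@ps_nth S F)
  | |- pc (fun c => top c) => exact pc_top
  | |- pc top => exact pc_top
  | |- pc (fun c => ?F (pop (@?k c))) => apply (@pc_cm (fun c => pop (k c)) F); [cm_tac | ]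
  | |- pcb (fun c => ?F (pop (@?k c))) =>
      apply (@pc_cm (fun c => pop (k c)) (fun c => nat_of_bool (F c))); [cm_tac | ]
  end | pc_user | simple apply pc_if | simple apply pcb_if].
Ltac pc_tac := repeat (cbv beta; pc_step).

(* Output bits are pushed from the last one to the first. *)
Lemma ps_emit S aux b r s : ps S -> 0 < b -> all (leq 1) r ->
  exists (p : prog aux) e, forall m c, holds m b r s c -> m 0 = [::] ->
    runs p m (csize c ^ e) (upd m 0 (map inl (S c))).
Proof.
move=> [hN hS] b0 r0; have [pN [eN hpN]] := hN aux b r s.
have [p [e hp]] := hS aux b (s :: r) s.+1.
pose body := Seq (Pop s) (Seq p (Case s.+1 (fun a =>
  if a then Seq (Pop s.+1) (Push 0 (inl true)) else Push 0 (inl false)))).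
have [k hk] : pb (fun a => a ^ eN + (a ^ eN * (1 + ((a + a ^ eN) ^ e + 3)).+1).+1).
  by pb_tac.
exists (Seq pN (While s isSome body)), k => m c hm m0.
apply: runs_le (hk _ _) => //; set A := csize c.
have hr := hpN _ _ hm; set n := size (S c) in hr.
have hn : n <= A ^ eN by apply: (runs_un_le hr); rewrite (holds_free hm).
apply: runs_seq hr _; have hs := holds_base hm.
pose ms j := upd (upd m s (un aux (n - j))) 0 (map inl (drop (n - j) (S c))).
have -> : upd m s (un aux n) = ms 0 by rewrite /ms subn0 drop_size /=; store_eq; rewrite m0.
have -> : upd m 0 [seq inl i | i <- S c] = ms n.
  by rewrite /ms subnn drop0; store_eq; rewrite (holds_free hm).
apply: runs_le (runs_while (T := 1 + ((A + A ^ eN) ^ e + 3)) (N := n) _ _) _; first last.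
- by rewrite ltnS leq_mul2r hn orbT.
- by rewrite /ms subnn; updE.
move=> j jn; have [i hi] : exists i, n - j = i.+1 by exists (n - j).-1; lia.
have hi' : n - j.+1 = i by lia.
split; first by have -> : ms j s = un aux i.+1 by rewrite /ms hi; updE.
apply: runs_seq (runs_pop _ _) _.
set m1 := upd _ _ _.
have em1 : m1 = upd (upd m s (un aux i)) 0 (map inl (drop i.+1 (S c))).
  have e1 : behead (ms j s) = un aux i by rewrite /ms hi; updE.
  by rewrite /m1 e1 /ms hi; store_eq.
have hm1 : holds m1 b (s :: r) s.+1 (push i c).
  case: (holds_push i hm) => h1 h2 h3 h4 h5 h6; rewrite em1; split=> //.
  - by rewrite -h1; updE.
  - rewrite -h4; apply/eq_in_map => q; rewrite inE => /orP[/eqP->|/(allP r0) ?]; updE.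
  - by move=> q hq; rewrite -(h6 q hq); updE.
have := hp _ _ hm1; rewrite csize_push pop_push => hr.
have ia : i <= A ^ eN by lia.
apply: runs_seq (runs_le hr _) _; first by apply: leq_expl; rewrite leq_add2l.
have hd : drop i (S c) = nth false (S c) i :: drop i.+1 (S c) by rewrite -drop_nth //; lia.
apply: (runs_case (n := 2)); rewrite upd_eq [top _]/=.
have -> : ms j.+1 = upd m1 0 (inl (nth false (S c) i) :: m1 0).
  by rewrite /ms hi' em1 hd; store_eq.
have fr : m1 s.+1 = [::] by rewrite (holds_free hm1).
case: (nth false (S c) i) => /=; last first.
  by rewrite (upd_id fr); apply: runs_le (runs_push _ _ _) _.
apply: (runs_seq (n := 1) (n' := 1)); first exact: runs_pop.
rewrite upd_eq /= upd_upd (upd_id fr); exact: runs_push.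
Qed.

Lemma load_runs aux (m : store aux) x n : m 0 = map inl x -> m n.+1 = [::] ->
  m n.+2 = [::] ->
  runs (Seq (move isSome 0 n.+2) (move isSome n.+2 n.+1)) m
    ((4 * size x).+1 + (4 * size x).+1) (upd (upd m 0 [::]) n.+1 (map inl x)).
Proof.
move=> h0 h1 h2; apply: runs_seq.
  have := @move_runs aux isSome m 0 n.+2 (map inl x) [::].
  by rewrite cats0 size_map h2; apply=> //; apply/allP.
set m1 := upd _ _ _; have e2 : m1 n.+2 = rev (map inl x).
  by rewrite /m1 catrevE cats0 upd_eq.
have := @move_runs aux isSome m1 n.+2 n.+1 (rev (map inl x)) [::].
rewrite cats0 size_rev size_map.
have -> : m1 n.+1 = [::] by rewrite /m1; updE.
rewrite catrevE cats0 revK => h.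
have -> : upd (upd m 0 [::]) n.+1 (map inl x) = upd (upd m1 n.+2 [::]) n.+1 (map inl x).
  by rewrite /m1; clear -h2; store_eq.
by apply: h => //; [lia | apply/allP].
Qed.

Lemma ps_polytime S : ps S -> polytime (fun x => S (x, [::])).
Proof.
move=> hS; have [p [e hp]] := @ps_emit S unit 1 [::] 3 hS isT isT.
have [M hM] := prog_tm (Seq (Seq (move isSome 0 2) (move isSome 2 1)) p).
have [k hk] : pb (fun a => 2 * ((4 * a).+1 + (4 * a).+1 + a ^ e)) by pb_tac.
(* Costs are bounded by a power of [(size x).+2], whereas [polytime] asks for powers of
   [(size x).+1]. The factor [2 ^ k] pays for the difference. *)
exists M, (k + 2 ^ k) => x.
have h0 : runs (Seq (Seq (move isSome 0 2) (move isSome 2 1)) p) (init_store unit x)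
   ((4 * size x).+1 + (4 * size x).+1 + csize (x, [::]) ^ e)
   (upd (upd (upd (init_store unit x) 0 [::]) 1 (map inl x)) 0 (map inl (S (x, [::])))).
  apply: runs_seq; first exact: load_runs.
  by apply: hp; rewrite ?upd_eq //; split=> // i; rewrite /upd /init_store; do !case: eqP => //; lia.
apply: hM h0 _ _ _; first by rewrite upd_eq.
have -> : csize (x, [::]) = (size x).+2 by rewrite /csize /= addn0.
apply: leq_trans (_ : 2 * ((4 * (size x).+2).+1 + (4 * (size x).+2).+1 + (size x).+2 ^ e) <= _).
  by rewrite leq_mul2l /= leq_add2r; lia.
apply: leq_trans (hk _ _) _ => //.
have h2 : (size x).+2 ^ k <= (2 * (size x).+1) ^ k by apply: leq_expl; lia.
apply: leq_trans h2 _; rewrite expnMn; apply: leq_mul; first lia.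
by apply: leq_pexp2l; lia.
Qed.

(** * Simulation of Turing machines by stack programs *)

Section Simulation.
Variable M : tm.
Notation K := (tm_tapes M).
Notation tapes := ('I_K.+1 -> tape M).

(** A stack has no gaps, so blanks between tape symbols are stored explicitly, as [inl None]. States
    are symbols too, since the current one is kept on a stack. *)
Definition saux : finType := (option (tm_aux M) + tm_state M)%type.

Definition enc (a : tm_sym M) : sym saux :=
  match a with
  | None => inr (inl None)
  | Some (inl b) => inl b
  | Some (inr a) => inr (inl (Some a))
  end.

Definition dec (o : option (sym saux)) : tm_sym M :=
  match o with
  | Some (inl b) => Some (inl b)
  | Some (inr (inl (Some a))) => Some (inr a)
  | _ => None
  end.

Lemma dec_enc s : dec (ohead (map enc s)) = head None s.
Proof. by case: s => [|[[b|a]|] s]. Qed.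

(* Tape [i] occupies the registers [2 i] (head and right part) and [2 i + 1]
   (left part); the state is kept in the next free register. *)
Definition sreg := K.+1.*2.

Definition sstore (m : store saux) (q : tm_state M) (tp : tapes) : store saux :=
  fun j => if j < sreg then
             (if odd j then map enc (tp (inord j./2)).1 else map enc (tp (inord j./2)).2)
           else if j == sreg then [:: inr (inr q)] else m j.

Definition updt (tp : tapes) i t : tapes := fun j => if j == i then t else tp j.

Lemma reg_ltn (i : 'I_K.+1) : i.*2.+1 < sreg.
Proof. by rewrite /sreg; have := ltn_ord i; lia. Qed.

Lemma sstoreR m q tp (i : 'I_K.+1) : sstore m q tp i.*2 = map enc (tp i).2.
Proof. by rewrite /sstore (ltnW (reg_ltn i)) odd_double doubleK inord_val. Qed.

Lemma sstoreL m q tp (i : 'I_K.+1) : sstore m q tp i.*2.+1 = map enc (tp i).1.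
Proof.
by rewrite /sstore reg_ltn /= odd_double /= uphalf_double inord_val.
Qed.

Lemma sstoreS m q tp : sstore m q tp sreg = [:: inr (inr q)].
Proof. by rewrite /sstore ltnn eqxx. Qed.

Lemma upd_sstoreR m q tp (i : 'I_K.+1) r :
  upd (sstore m q tp) i.*2 (map enc r) = sstore m q (updt tp i ((tp i).1, r)).
Proof.
apply: functional_extensionality => j; rewrite /upd /sstore /updt.
case: eqP => [->|h]; first by rewrite (ltnW (reg_ltn i)) odd_double doubleK inord_val eqxx.
case: ltnP => // hj; rewrite -val_eqE /= inordK; last by rewrite /sreg in hj; lia.
case: eqP => // e; case: ifP => //= o; last by lia.
by congr (map enc (tp _).1); apply: val_inj; rewrite /= inordK e.
Qed.

Lemma upd_sstoreL m q tp (i : 'I_K.+1) l :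
  upd (sstore m q tp) i.*2.+1 (map enc l) = sstore m q (updt tp i (l, (tp i).2)).
Proof.
apply: functional_extensionality => j; rewrite /upd /sstore /updt.
case: eqP => [->|h].
  by rewrite reg_ltn /= odd_double /= uphalf_double inord_val eqxx.
case: ltnP => // hj; rewrite -val_eqE /= inordK; last by rewrite /sreg in hj; lia.
case: eqP => // e; case: ifP => //= o; first by lia.
by congr (map enc (tp _).2); apply: val_inj; rewrite /= inordK e.
Qed.

Lemma updt_updt tp i t t' : updt (updt tp i t) i t' = updt tp i t'.
Proof. by apply: functional_extensionality => j; rewrite /updt; case: eqP. Qed.

Lemma updt_eq tp i t : updt tp i t i = t.
Proof. by rewrite /updt eqxx. Qed.

Definition aprog (i : 'I_K.+1) (a : tm_sym M * direction) : prog saux :=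
  Seq (Pop i.*2)
    match a.2 with
    | Stay => Push i.*2 (enc a.1)
    | MoveR => Push i.*2.+1 (enc a.1)
    | MoveL => Seq (Push i.*2 (enc a.1))
        (Case i.*2.+1 (fun o => Seq (Pop i.*2.+1) (Push i.*2 (enc (dec o)))))
    end.

Lemma aprog_runs m q tp i a :
  runs (aprog i a) (sstore m q tp) 5 (sstore m q (updt tp i (write_move a (tp i)))).
Proof.
case: a => a d; apply: (runs_seq (n := 1) (n' := 4)); first exact: runs_pop.
rewrite sstoreR behead_map upd_sstoreR; set tp1 := updt _ _ _.
case E : (tp i) => [l r]; rewrite E /= in tp1 *.
have t1 : tp1 i = (l, behead r) by rewrite /tp1 updt_eq.
case: d => /=.
- apply: (runs_seq (n := 1) (n' := 3)); first exact: runs_push.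
  rewrite sstoreR -map_cons upd_sstoreR; set tp2 := updt _ _ _.
  have t2 : tp2 i = (l, a :: behead r) by rewrite /tp2 updt_eq t1.
  apply: (runs_case (n := 2)); rewrite sstoreL t2 dec_enc.
  apply: (runs_seq (n := 1) (n' := 1)); first exact: runs_pop.
  rewrite sstoreL behead_map upd_sstoreL t2 /=.
  set tp3 := updt tp2 _ _.
  have := runs_push (sstore m q tp3) i.*2 (enc (head None l)).
  by rewrite sstoreR -map_cons upd_sstoreR /tp3 /tp2 /tp1 !updt_eq !updt_updt.
- apply: runs_le (runs_exec _) (_ : 1 <= _) => //.
  have := EPush i.*2.+1 (enc a) (sstore m q tp1).
  by rewrite sstoreL -map_cons upd_sstoreL t1 /tp1 updt_updt.
- apply: runs_le (runs_exec _) (_ : 1 <= _) => //.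
  have := EPush i.*2 (enc a) (sstore m q tp1).
  by rewrite sstoreR -map_cons upd_sstoreR t1 /tp1 updt_updt.
Qed.

Definition aall (l : seq 'I_K.+1) (act : 'I_K.+1 -> tm_sym M * direction) : prog saux :=
  foldr (fun i p => Seq (aprog i (act i)) p) Skip l.

Lemma aall_runs m q tp l act : uniq l ->
  runs (aall l act) (sstore m q tp) (5 * size l).+1
    (sstore m q (fun j => if j \in l then write_move (act j) (tp j) else tp j)).
Proof.
elim: l tp => [|i l IH] tp /=; first by move=> _; apply: runs_skip.
case/andP=> hi hl.
have -> : (5 * (size l).+1).+1 = 5 + (5 * size l).+1 by lia.
apply: runs_seq (aprog_runs _ _ _ _ _) _.
set tp2 := (fun j => if j \in i :: l then _ else _).
have -> : tp2 = (fun j => if j \in l then write_move (act j)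
  (updt tp i (write_move (act i) (tp i)) j) else updt tp i (write_move (act i) (tp i)) j).
  apply: functional_extensionality => j; rewrite /tp2 /updt inE.
  by case: eqP => [->|_] /=; [rewrite (negbTE hi)|].
exact: IH.
Qed.

(** Continuation-passing: the rest of the program depends on all scanned symbols, and the nested
    cases collect them in the finite control. *)
Fixpoint rdall (l : seq 'I_K.+1) (f : 'I_K.+1 -> tm_sym M)
    (k : ('I_K.+1 -> tm_sym M) -> prog saux) : prog saux :=
  if l is i :: l' then
    Case i.*2 (fun o => rdall l' (fun j => if j == i then dec o else f j) k)
  else k f.

Lemma rdall_runs m q tp l f k n m' :
  runs (k (fun j => if j \in l then scanned (tp j) else f j)) (sstore m q tp) n m' ->
  runs (rdall l f k) (sstore m q tp) (size l + n) m'.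
Proof.
elim: l f => [|i l IH] f //= h; apply: runs_case; apply: IH.
rewrite sstoreR dec_enc.
have -> // : (fun j => if j \in l then scanned (tp j) else
   if j == i then head None (tp i).2 else f j) =
   (fun j => if j \in i :: l then scanned (tp j) else f j).
apply: functional_extensionality => j; rewrite inE.
by case: eqP => [->|_] //=; case: ifP.
Qed.

Definition sstep : prog saux :=
  Case sreg (fun o => if o is Some (inr (inr q)) then
    rdall (enum 'I_K.+1) (fun=> None) (fun f =>
      let: (q', act) := tm_trans q [ffun i => f i] in
      Seq (aall (enum 'I_K.+1) act) (Seq (Pop sreg) (Push sreg (inr (inr q')))))
    else Skip).

Definition sloop : prog saux :=
  While sreg (fun o => if o is Some (inr (inr q)) then ~~ tm_halt q else false) sstep.

Definition scost := (K.+1 + ((5 * K.+1).+1 + 2)).+1.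

Lemma sstep_runs m (c : config M) : ~~ tm_halt c.1 ->
  runs sstep (sstore m c.1 c.2) scost (sstore m (tm_step c).1 (tm_step c).2).
Proof.
move=> hh; apply: runs_case; rewrite sstoreS /=.
have sz := size_enum_ord K.+1.
apply: (runs_le (n := size (enum 'I_K.+1) + ((5 * size (enum 'I_K.+1)).+1 + 2)));
  last by rewrite sz.
apply: rdall_runs.
have -> : [ffun i => if i \in enum 'I_K.+1 then scanned (c.2 i) else None] =
   [ffun i => scanned (c.2 i)].
  by apply/ffunP => i; rewrite !ffunE mem_enum.
rewrite /tm_step (negbTE hh); case: tm_trans => q' act /=.
apply: runs_seq (aall_runs _ _ _ _ (enum_uniq _)) _.
set tp := (fun j => _).
have -> : tp = (fun i => write_move (act i) (c.2 i)).
  by apply: functional_extensionality => i; rewrite /tp mem_enum.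
apply: (runs_seq (n := 1) (n' := 1)); first exact: runs_pop.
rewrite sstoreS /=; set m1 := upd _ _ _; set m2 := sstore _ q' _.
have -> : m2 = upd m1 sreg (inr (inr q') :: m1 sreg).
  rewrite /m2 /m1 upd_eq /sstore; apply: functional_extensionality => j; rewrite /upd.
  by case: eqP => [->|]; rewrite ?ltnn.
exact: runs_push.
Qed.

Lemma sloop_runs m t (c : config M) : tm_halt (iter t (@tm_step M) c).1 ->
  runs sloop (sstore m c.1 c.2) (t * scost.+1).+1
    (sstore m (iter t (@tm_step M) c).1 (iter t (@tm_step M) c).2).
Proof.
elim: t c => [|t IH] c hc.
  by exists 1 => //; apply: EWhile0; rewrite sstoreS negbK.
case: (boolP (tm_halt c.1)) => h.
  by rewrite tm_halt_iter //; exists 1 => //; apply: EWhile0; rewrite sstoreS negbK.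
rewrite iterSr in hc *.
have -> : (t.+1 * scost.+1).+1 = (scost + (t * scost.+1).+1).+1 by lia.
by apply: runs_whileS (sstep_runs _ h) (IH _ hc); rewrite sstoreS.
Qed.

Definition isbit (o : option (sym saux)) := if o is Some (inl _) then true else false.

Lemma enc_leading s : exists r : seq (sym saux),
  map enc s = map inl (leading_bits s) ++ r /\ ~~ isbit (ohead r).
Proof.
elim: s => [|[[b|a]|] s [r [IH hr]]] /=; first by exists [::].
- by exists r; rewrite IH.
- by exists (inr (inl (Some a)) :: map enc s).
- by exists (inr (inl None) :: map enc s).
Qed.

(** The final store has the shape that [holds] and [ps_emit] expect: output in [b], with [b.+1] and
    register 0 empty. Registers beyond [b.+1] are preserved, so numbers saved there survive the
    simulation. The symbols that follow the leading bits on the output tape are cleared. *)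
Lemma sim_prog : exists (p : prog saux) (C b : nat), 0 < b /\
  forall m x y t, outputs_within M x y t -> m 0 = map inl x ->
  (forall i, 0 < i <= b.+1 -> m i = [::]) ->
  let T := C * (t + size x).+1 in
  size y <= T /\ exists m', [/\ runs p m T m', m' b = map inl y,
    m' 0 = [::], m' b.+1 = [::] & forall i, b.+1 < i -> m' i = m i].
Proof.
pose b := sreg.+1; pose p0 := Seq (Push sreg (inr (inr (tm_start M)))) sloop.
exists (Seq p0 (Seq (move isbit 0 b.+1) (Seq (move isSome b.+1 b) (clear saux 0)))).
exists (20 * scost.+2), b; split=> // m x y t [hh hy] m0 mz T.
pose T1 := 1 + (t * scost.+1).+1.
set c := iter t _ _ in hh hy.
have s0 : 0 < sreg by rewrite /sreg; lia.
have hb : b = sreg.+1 by [].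
have r0 : runs p0 m T1 (sstore m c.1 c.2).
  have := sloop_runs m hh.
  have -> : sstore m (tm_init M x).1 (tm_init M x).2 =
    upd m sreg (inr (inr (tm_start M)) :: m sreg).
    apply: functional_extensionality => j; rewrite /sstore /upd.
    case: (j =P sreg) => [->|hj]; first by rewrite ltnn mz //; lia.
    case: ltnP => // lj; rewrite /tm_init /= -val_eqE /= inordK; last by rewrite /sreg in lj; lia.
    case: (posnP j) => [->|j0]; first by rewrite /= m0 -map_comp.
    rewrite mz; last by lia.
    case: ifP => // o; case: eqP => //; lia.
  by apply: runs_seq; apply: runs_push.
have [t0 ht0 e0] := r0.
have hs0 := exec_size e0 0; rewrite m0 (size_map _ x) in hs0.
have e00 : sstore m c.1 c.2 0 = map enc (c.2 ord0).2 by apply: (sstoreR m c.1 c.2 ord0).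
have sb : sstore m c.1 c.2 b = [::].
  rewrite /sstore ltnNge gtn_eqF; last by lia.
  by rewrite (_ : sreg <= b); [apply: mz|]; lia.
have sb1 : sstore m c.1 c.2 b.+1 = [::].
  rewrite /sstore ltnNge gtn_eqF; last by lia.
  by rewrite (_ : sreg <= b.+1); [apply: mz|]; lia.
have sbi i : b.+1 < i -> sstore m c.1 c.2 i = m i.
  rewrite /sstore => hi; rewrite ltnNge (_ : sreg <= i); last by lia.
  by rewrite gtn_eqF //; lia.
set m1 := sstore m c.1 c.2 in r0 e0 hs0 e00 sb sb1 sbi.
have [r [er hr]] := enc_leading (c.2 ord0).2; rewrite hy -e00 in er.
have sm : size y + size r <= size x + T1.
  by move: hs0; rewrite er size_cat size_map => h; apply: leq_trans h _; rewrite leq_add2l.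
have hT : T1 + ((4 * size y).+1 + ((4 * size y).+1 + (2 * size r).+1)) <= T.
  have : T1 <= scost.+2 * t.+1 by rewrite /T1; lia.
  have : size x <= scost.+2 * size x by rewrite leq_pmull.
  rewrite /T -!mulnA -[(t + _).+1]addSn mulnDr; lia.
have h2 : runs (move isbit 0 b.+1) m1 (4 * size y).+1
    (upd (upd m1 0 r) b.+1 (rev (map inl y))).
  have := @move_runs saux isbit m1 0 b.+1 (map inl y) r.
  rewrite size_map sb1 catrevE cats0; apply=> //.
  by rewrite all_map; apply/allP.
have h3 : runs (move isSome b.+1 b) (upd (upd m1 0 r) b.+1 (rev (map inl y)))
   (4 * size y).+1 (upd (upd (upd m1 0 r) b.+1 [::]) b (map inl y)).
  set m2 := upd _ b.+1 (rev _).
  have := @move_runs saux isSome m2 b.+1 b (rev (map inl y)) [::].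
  rewrite cats0 size_rev size_map /m2 upd_eq upd_neq; last by lia.
  rewrite upd_neq // sb upd_upd catrevE revK cats0; apply=> //; first by lia.
  by apply/allP.
set m3 := upd _ b _ in h3.
have h4 := clear_runs m3 0.
have m30 : m3 0 = r by rewrite /m3; updE.
rewrite m30 in h4.
split; first lia.
exists (upd m3 0 [::]); split.
- apply: runs_le hT; apply: runs_seq r0 _; apply: runs_seq h2 _.
  exact: runs_seq h3 h4.
- by rewrite /m3; updE.
- by rewrite upd_eq.
- by rewrite /m3; updE.
- by move=> i hi; rewrite -(sbi i hi) /m3; updE.
Qed.

End Simulation.

(** The simulation consumes its input, so a copy of [n] is kept in register [b.+2]. In
    [h (top c) (size c.1)] the variable is this copy and the string is the unary output [f n]. *)
Lemma computable_pc f (h : nat -> nat -> nat) :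
  computable f -> pc (fun c => h (top c) (size c.1)) -> computable (fun n => h n (f n)).
Proof.
case=> M hM hh; have [p [C [b [b0 hp]]]] := sim_prog M.
have hS : ps (fun c => nseq (h (top c) (size c.1)) true) by apply: ps_nseq.
have [q [e hq]] := @ps_emit _ (saux M) b [:: b.+2] b.+3 hS b0 isT.
have [M' hM'] := prog_tm (Seq (copy _ 0 b.+2 b.+3) (Seq p q)).
exists M' => n; have [t ht] := hM n.
pose m := upd (init_store (saux M) (nseq n true)) b.+2 (un _ n).
have h1 : runs (copy _ 0 b.+2 b.+3) (init_store (saux M) (nseq n true)) (8 * n).+2 m.
  apply: copy_runs => //; last by rewrite /init_store /= map_nseq.
  by rewrite /= !inE; lia.
have [||_ [m' [h2 mb m0 mb1 mi]]] := hp m _ _ _ ht.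
- by rewrite /m upd_neq.
- by move=> i hi; rewrite /m upd_neq ?/init_store; [case: eqP => //; lia | lia].
have hm' : holds m' b [:: b.+2] b.+3 (nseq (f n) true, [:: n]).
  split=> //=; rewrite ?ltnS ?leqnn //.
  - by rewrite mi // /m upd_eq.
  - by move=> i hi; rewrite mi ?/m ?upd_neq //; try lia; rewrite /init_store; case: eqP => //; lia.
have h3 := hq _ _ hm' m0; rewrite /= size_nseq in h3.
eexists; apply: (hM' _ _ _ _ (runs_seq h1 (runs_seq h2 h3))); last exact: leqnn.
by rewrite upd_eq.
Qed.

(** Composes an arbitrary reduction machine, run by simulation, with a polynomial-time function of
    its output. The new parameter is a monotone function of the old one, so that the bound [g]
    carries over. *)
Lemma fpt_ps (P P' Q : param_problem) (gs : seq bool -> seq bool) (pp : seq bool -> nat)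
    (h : nat -> nat) :
  fpt_reduces P P' ->
  ps (fun c => pair_str (nseq (pp c.1) true) (gs c.1)) ->
  (forall x k, P' x k <-> Q (gs (param_str x k)) (pp (param_str x k))) ->
  (forall x k, pp (param_str x k) = h k) ->
  {homo h : m n / m <= n} -> pc (fun c => h (size c.1)) ->
  fpt_reduces P Q.
Proof.
case=> M [R [f [g [c [cf cg hR]]]]] hS hQ hpp hmono hh.
have [p [C [b [b0 hp]]]] := sim_prog M.
have [q [e hq]] := @ps_emit _ (saux M) b [::] b.+2 hS b0 isT.
have [M' hM'] := prog_tm (Seq p q).
have [E hE] : pb (fun a => 2 * (C * a + ((C * a).+2) ^ e)) by pb_tac.
exists M', (fun x k => let z := param_str (R x k).1 (R x k).2 in (gs z, pp z)).
(* Since [param_str x k] has length [2 k + 1 + size x], this length and the given running time are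
   together below [(f k + 2 * k + 2) * (size x).+1 ^ c.+1]; the whole run costs at most the [E]-th
   power of this product. *)
exists (fun k => (f k + 2 * k + 2) ^ E), (fun k => h (g k)), (c.+1 * E); split.
- apply: (computable_pc (h := fun n m => (m + 2 * n + 2) ^ E) cf); pc_tac.
- exact: (computable_pc (h := fun n m => h m) cg).
move=> x k; have [h1 h2 h3] := hR x k; set z := param_str (R x k).1 _ in h1.
split; last by rewrite /= hpp; apply: hmono.
  set m := init_store (saux M) (param_str x k).
  have [||sz [m' [r1 mb m0 mb1 mi]]] := hp m _ _ _ h1; first by [].
    by move=> i hi; rewrite /m /init_store; case: eqP => //; lia.
  have hm' : holds m' b [::] b.+2 (z, [::]).
    split; [exact: mb | exact: mb1 | by [] | by [] | by [] |] => i hi.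
    by rewrite mi // /m /init_store; case: eqP => //; lia.
  have r2 := hq _ _ hm' m0.
  apply: (hM' _ _ _ _ (runs_seq r1 r2)); first by rewrite upd_eq.
  set Z := (_ + size (param_str x k)).+1 in r1 sz *.
  have hZ : Z <= (f k + 2 * k + 2) * (size x).+1 ^ c.+1.
    rewrite /Z size_pair_str size_nseq.
    have e1 : (size x).+1 ^ c <= (size x).+1 ^ c.+1 by apply: leq_pexp2l.
    have e2 : size x < (size x).+1 ^ c.+1.
      by rewrite expnS; apply: leq_pmulr; rewrite expn_gt0.
    rewrite -addnA mulnDl; have := leq_mul (leqnn (f k)) e1; move: e2.
    move: (_ ^ c) (_ ^ c.+1) => u v; nia.
  have z2 : 1 < (f k + 2 * k + 2) * (size x).+1 ^ c.+1.
    by apply: leq_trans (leq_pmulr _ _); rewrite ?expn_gt0 //; lia.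
  rewrite expnM -expnMn; apply: leq_trans (hE _ z2).
  rewrite leq_mul2l /=; apply: leq_add; first by rewrite leq_mul2l hZ orbT.
  apply: leq_expl; rewrite /csize /= addn0 ltnS ltnS.
  by apply: leq_trans sz _; rewrite leq_mul2l hZ orbT.
by rewrite h2 hQ.
Qed.

(** * Identifications as quotients *)

Record quotient (G Q : sgraph) (f : vertex G -> vertex Q) : Prop := Quotient {
  quot_surj : forall a, exists u, f u = a;
  quot_edge : forall a b, edge a b <->
    a != b /\ exists u v, [/\ f u = a, f v = b & edge u v] }.

Lemma edge_neq (G : sgraph) (u v : vertex G) : edge u v -> u != v.
Proof. by apply: contraTneq => ->; rewrite edge_irr. Qed.

Lemma quotient_id (G : sgraph) : quotient (fun u : vertex G => u).
Proof.
split=> [a|a b]; first by exists a.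
split=> [h|[_ [u [v [-> -> //]]]]]; split; first exact: edge_neq.
by exists a, b.
Qed.

Lemma quotient_comp (G1 G2 G3 : sgraph) (f : vertex G1 -> vertex G2)
    (g : vertex G2 -> vertex G3) :
  quotient f -> quotient g -> quotient (g \o f).
Proof.
move=> [fs fe] [gs ge]; split=> [a|a b].
  by have [b <-] := gs a; have [u <-] := fs b; exists u.
split.
  case/ge=> ab [u [v [ua vb /fe[_ [u' [v' [eu ev h]]]]]]].
  by split=> //; exists u', v'; rewrite /= eu ev.
case=> ab [u [v [ua vb h]]]; apply/ge; split=> //; exists (f u), (f v); split=> //.
apply/fe; split; last by exists u, v.
by apply: contraNneq ab => e; rewrite -ua -vb /= e.
Qed.

Section IdentifyQuotient.
Variables (G : sgraph) (u v : vertex G).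
Hypothesis uv : u != v.

Definition ident_map (x : vertex G) : vertex (identify u v) := insub x.

Lemma ident_map_quotient : quotient ident_map.
Proof.
have hu : ident_map u = None by rewrite /ident_map insubF // eqxx.
have hv : ident_map v = None by rewrite /ident_map insubF // eqxx andbF.
split=> [[x|]|a b]; first by exists (val x); rewrite /ident_map valK.
  by exists u.
have hx (x : {x : vertex G | (x != u) && (x != v)}) : ident_map (val x) = Some x.
  by rewrite /ident_map valK.
have hN x : ident_map x = None -> x = u \/ x = v.
  rewrite /ident_map; case: insubP => // /nandP[]; rewrite negbK => /eqP; by auto.
have hS x y : ident_map x = Some y -> x = val y.
  by rewrite /ident_map; case: insubP => // z _ <- [->].
split=> [h|[ab [x [y [xa yb h]]]]].
  split; first exact: edge_neq.
  case: a b h => [x|] [y|] //= h.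
  - by exists (val x), (val y).
  - by case/orP: h => h; [exists (val x), u | exists (val x), v]; rewrite edge_sym.
  - by case/orP: h => h; [exists u, (val y) | exists v, (val y)].
case: a b xa yb ab => [a|] [b|] //=.
- by move=> /hS <- /hS <-.
- by move=> /hS e1 /hN e2 _; rewrite -e1 edge_sym orbC edge_sym orbC;
     case: e2 => <-; rewrite h ?orbT.
- by move=> /hN e1 /hS e2 _; rewrite -e2; case: e1 => <-; rewrite h ?orbT.
Qed.

Lemma card_identify : #|vertex G| = #|vertex (identify u v)|.+1.
Proof.
rewrite /= card_option card_sig.
have e : [predC [pred x | (x != u) && (x != v)]] =i pred2 u v.
  by move=> x; rewrite !inE negb_and !negbK.
by rewrite -(cardC [pred x | (x != u) && (x != v)]) (eq_card e) card2 uv addn2.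
Qed.

Lemma ident_quotient_factor (Q : sgraph) (f : vertex G -> vertex Q) :
  quotient f -> f u = f v ->
  exists g : vertex (identify u v) -> vertex Q, quotient g.
Proof.
move=> [fs fe] fuv.
pose g (a : vertex (identify u v)) := if a is Some x then f (val x) else f u.
have gf x : g (ident_map x) = f x.
  rewrite /g /ident_map; case: insubP => [y _ -> //|].
  by rewrite negb_and !negbK => /orP[] /eqP->.
exists g; have [is_ ie] := ident_map_quotient; split=> [a|a b].
  by have [x <-] := fs a; exists (ident_map x).
split.
  case/fe=> ab [x [y [xa yb h]]]; split=> //; exists (ident_map x), (ident_map y).
  rewrite !gf; split=> //; apply/ie; split; last by exists x, y.
  by apply: contraNneq ab => e; rewrite -xa -yb -!gf e.
case=> ab [x [y [xa yb /ie[_ [x' [y' [ex ey h]]]]]]].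
by apply/fe; split=> //; exists x', y'; rewrite -!gf ex ey.
Qed.

End IdentifyQuotient.

Lemma ident_quotient m (G G' : sgraph) : identifications m G G' ->
  exists f : vertex G -> vertex G', quotient f /\ #|vertex G| = #|vertex G'| + m.
Proof.
elim=> [{}G|{}m {}G u v {}G' uv _ [f [hf e]]].
  by exists id; rewrite addn0; split=> //; apply: quotient_id.
exists (f \o @ident_map G u v); split; last by rewrite (card_identify uv) e addnS.
exact: quotient_comp (ident_map_quotient u v) hf.
Qed.

(** Vertices with the same image are identified until the map is injective. The last graph is
    isomorphic to [Q] but not equal to it, hence the injective quotient in the conclusion. *)
Lemma quotient_ident (G Q : sgraph) (f : vertex G -> vertex Q) : quotient f ->
  exists m G' (g : vertex G' -> vertex Q),
    [/\ identifications m G G', quotient g, injective g & #|vertex G| = #|vertex Q| + m].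
Proof.
move E : #|vertex G| => n; elim: n G E f => [|n IH] G E f hf.
  exists 0, G, f; split; [exact: Ident0 | by [] | | ].
    by move=> x; have := card0_eq E x.
  have e0 : #|vertex Q| = 0.
    apply: eq_card0 => a; have [u _] := quot_surj hf a; by have := card0_eq E u.
  by rewrite e0.
case: (boolP (injectiveb f)) => [/injectiveP fi|/injectivePn[u [v uv fuv]]].
  exists 0, G, f; split=> //; first exact: Ident0.
  rewrite addn0 -E -(card_codom fi); apply: eq_card => a.
  by rewrite inE; have [u <-] := quot_surj hf a; rewrite codom_f.
have [g hg] := ident_quotient_factor hf fuv.
have [|m [G' [g' [h1 h2 h3 h4]]]] := IH (identify u v) _ g hg.
  by apply: succn_inj; rewrite -card_identify.
by exists m.+1, G', g'; split=> //; [apply: IdentS h1 | rewrite h4 addnS].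
Qed.

(** * Local descriptions of stars, connected graphs and forests *)

Definition center (G : sgraph) (z : vertex G) : Prop :=
  (forall x, x != z -> edge z x) /\ (forall x y, edge x y -> x = z \/ y = z).

(** A local certificate of connectedness: descending levels lead from every vertex to [r]. *)
Definition level (G : sgraph) (r : vertex G) (l : vertex G -> nat) : Prop :=
  forall x, x != r -> exists2 y, edge y x & l y < l x.

(** A local certificate of acyclicity. The NP verifier can test it without looking at cycles. *)
Definition forest_order (G : sgraph) (rk : vertex G -> nat) : Prop :=
  injective rk /\
  forall u v w, edge u w -> edge v w -> rk u < rk w -> rk v < rk w -> u = v.

Lemma level_connected (G : sgraph) (r : vertex G) l : level r l -> is_connected G.
Proof.
move=> hl.
have h x : connect (@edge G) r x.
  move E : (l x) => n; elim/ltn_ind: n x E => n IH x E.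
  case: (eqVneq x r) => [->|/hl[y yx ly]]; first exact: connect0.
  by apply: connect_trans (connect1 yx); apply: IH erefl; rewrite -E.
split=> [|x y]; first by apply/card_gt0P; exists r.
by apply: connect_trans (h y); rewrite (sym_connect_sym (@edge_sym G)).
Qed.

(** The level is the distance from [r]. Simple paths bound it by the number of vertices, so that
    levels fit into a certificate. *)
Lemma connected_level (G : sgraph) (r : vertex G) : is_connected G ->
  exists2 l, level r l & forall x, l x < #|vertex G|.
Proof.
case=> _ hc; pose P x n := [exists t : n.-tuple (vertex G),
  path (@edge G) r t && (last r t == x)].
have hP x (p : seq (vertex G)) : path (@edge G) r p -> last r p = x -> P x (size p).
  by move=> h1 h2; apply/existsP; exists (in_tuple p); rewrite h1 h2 eqxx.
have ex x : exists n, P x n.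
  by have /connectP[p h e] := hc r x; exists (size p); apply: hP.
exists (fun x => ex_minn (ex x)).
  move=> x xr; case: (ex_minnP (ex x)) => n /existsP[t /andP[ht /eqP lt]] hn.
  case: t ht lt => p0 /= /eqP st ht lt.
  case/lastP: p0 st ht lt => [|p y] st; first by move=> _ /= e; rewrite e eqxx in xr.
  rewrite rcons_path last_rcons => /andP[hp yx] e.
  exists (last r p); first by rewrite -e.
  case: ex_minnP => k _ hk; have := hk _ (hP _ _ hp erefl).
  by move: st; rewrite size_rcons => <-.
move=> x; case: ex_minnP => n _ hn; have /connectP[p h e] := hc r x.
case: (shortenP h) e => p' hp' up' _ e.
apply: leq_ltn_trans (hn _ (hP _ _ hp' (esym e))) _.
by have := max_card [in r :: p']; rewrite (card_uniqP up').
Qed.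

(** On a cycle, the vertex of largest rank would have two smaller neighbors. *)
Lemma order_forest (G : sgraph) (rk : vertex G -> nat) : forest_order rk -> is_forest G.
Proof.
case=> ri ho s s2 /andP[cs us].
have [x0 xs] : exists x, x \in s by case: s s2 {cs us} => // x s _; exists x; rewrite mem_head.
case: (@arg_maxnP _ x0 [in s] rk xs) => w ws wmax.
have [i p e] := rot_to ws.
have : cycle (@edge G) (w :: p) && uniq (w :: p) by rewrite -e rot_cycle rot_uniq cs us.
have ps : size p > 1 by rewrite -ltnS -[(size p).+1]/(size (w :: p)) -e size_rot.
have inp x : x \in p -> x \in s by move=> xp; rewrite -(mem_rot i) e inE xp orbT.
case/lastP: p ps inp {e} => [//|p y]; case: p => [//|x p] _ inp.
rewrite /= !rcons_path last_rcons inE negb_or !mem_rcons !inE !negb_or.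
case/andP=> /and3P[wx _ yw] /andP[/and3P[wx' wy' _] /andP[/andP[xy _] _]].
have rlt z : edge w z || edge z w -> z \in s -> rk z < rk w.
  move=> h zs; have zw : rk z <= rk w := wmax z zs.
  rewrite ltn_neqAle zw andbT; apply: contraTneq h => /ri ->.
  by rewrite edge_irr.
have xi : x \in s by apply: inp; rewrite /= mem_head.
have yi : y \in s by apply: inp; rewrite mem_rcons mem_head.
have exy : x = y.
  apply: (ho _ _ w) => //; first (by rewrite edge_sym); apply: rlt => //.
    by rewrite wx.
  by rewrite yw orbT.
by rewrite exy eqxx in xy.
Qed.

(** Otherwise every vertex of [S] has two neighbors in [S], and paths in [S] can be prolonged beyond
    the number of vertices. *)
Lemma forest_leaf (G : sgraph) (S : {set vertex G}) : is_forest G -> S != set0 ->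
  exists2 x, x \in S & {in S &, forall u v, edge u x -> edge v x -> u = v}.
Proof.
move=> hf /set0Pn[x0 x0S].
case: (boolP [exists x in S, [forall u in S, forall v in S,
    edge u x ==> edge v x ==> (u == v)]]) => [/exists_inP[x xS /forall_inP h]|/exists_inPn h].
  exists x => // u v uS vS ux vx; apply/eqP.
  by have /forall_inP/(_ v vS) := h u uS; rewrite ux vx.
have next x y : x \in S -> exists z, [/\ z \in S, edge z x & z != y].
  move=> xS; have := h x xS; rewrite negb_forall_in => /exists_inP[u uS].
  rewrite negb_forall_in => /exists_inP[v vS]; rewrite !negb_imply => /and3P[ux vx uv].
  case: (eqVneq u y) => [e|]; last by exists u.
  by exists v; split=> //; rewrite eq_sym -e.
(* The path grows at its front by a neighbor [y] of [x] other than the second vertex. If [y] already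
   lies on the path, a cycle of length at least three is closed. *)
have long n : exists x p, [/\ x \in S, path (@edge G) x p, uniq (x :: p) & size p = n].
  elim: n => [|n [x [p [xS hp up sp]]]]; first by exists x0, [::].
  have [y [yS yx yh]] := next x (head x p) xS.
  case: (boolP (y \in x :: p)) => [yp|yp]; last first.
    by exists y, (x :: p); rewrite /= yx hp sp; split=> //; apply/andP.
  have {}yp : y \in p by move: yp; rewrite inE (negbTE (edge_neq yx)).
  case/splitPr: yp hp up yh => p1 p2 hp up yh.
  have : ucycle (@edge G) (x :: rcons p1 y).
    rewrite /ucycle /= rcons_path last_rcons yx andbT.
    move: hp; rewrite -cat_rcons cat_path => /andP[-> _] /=.
    by move: up; rewrite -cat_rcons -cat_cons cat_uniq => /andP[].
  move/hf; case=> //; rewrite /= size_rcons !ltnS.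
  by case: p1 yh {hp up} => //=; rewrite eqxx.
have [x [p [_ _ up sp]]] := long #|vertex G|.
by have := max_card [in x :: p]; rewrite (card_uniqP up) /= sp ltnn.
Qed.

(** Remove a vertex with at most one neighbor in the remaining set and give it the largest rank
    there. *)
Lemma forest_has_order (G : sgraph) : is_forest G ->
  exists2 rk : vertex G -> nat, forest_order rk & forall x, rk x < #|vertex G|.
Proof.
move=> hf.
have [rk [h1 h2 h3]] : exists rk : vertex G -> nat,
   [/\ {in [set: vertex G] &, injective rk}, {in [set: vertex G], forall x, rk x < #|[set: vertex G]|} &
   {in [set: vertex G] &, forall u v, {in [set: vertex G], forall w,
     edge u w -> edge v w -> rk u < rk w -> rk v < rk w -> u = v}}].
  move: [set: vertex G] => S; move E : #|S| => n; elim: n S E => [|n IH] S E.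
    by exists (fun=> 0); split=> [x|x|x]; rewrite (cards0_eq E) inE.
  have [|x xS hx] := @forest_leaf G S hf; first by rewrite -card_gt0 E.
  have En : #|S :\ x| = n by move: E; rewrite (cardsD1 x) xS => -[].
  have [rk [h1 h2 h3]] := IH _ En.
  have inD y : y \in S -> y != x -> y \in S :\ x by move=> *; rewrite !inE; apply/andP.
  exists (fun y => if y == x then n else rk y); split.
  - move=> u v uS vS; case: eqVneq => [->|ux]; case: eqVneq => [->|vx] //.
    + by move=> e; have := h2 v (inD _ vS vx); rewrite -e ltnn.
    + by move=> e; have := h2 u (inD _ uS ux); rewrite e ltnn.
    + by apply: h1; apply: inD.
  - by move=> y yS; case: eqVneq => [//|yx]; rewrite ltnS ltnW // h2 ?inD.
  - move=> u v uS vS w wS uw vw; case: (eqVneq w x) => [e _ _|wx].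
      by apply: hx; rewrite -?e.
    have rw := h2 w (inD _ wS wx).
    case: eqVneq => [_|ux]; first by rewrite ltnNge (ltnW rw).
    case: eqVneq => [_ _|vx]; first by rewrite ltnNge (ltnW rw).
    by apply: h3; rewrite ?inD.
exists rk; first by split=> [u v|u v w]; [apply: h1 | apply: h3]; rewrite inE.
by move=> x; rewrite -cardsT; apply: h2; rewrite inE.
Qed.

Lemma center_star (G : sgraph) (z : vertex G) : center z -> is_star G.
Proof.
case=> c1 c2; split.
  split; first by apply: (@level_connected G z (fun x => x != z)) => x xz;
    exists z; rewrite ?c1 // eqxx xz.
  apply: (@order_forest G (fun x => if x == z then 0 else (enum_rank x).+1)).
  split=> [u v|u v w uw vw].
    case: eqVneq => [->|_]; case: eqVneq => [->|_] // [] /ord_inj /enum_rank_inj //.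
  case: (c2 _ _ uw) => [->|->]; last by rewrite eqxx.
  case: (c2 _ _ vw) => [->|->] //; by rewrite eqxx.
rewrite -(cards1 z); apply: subset_leq_card; apply/subsetP => x; rewrite !inE.
rewrite /degree; apply: contraLR => xz; rewrite -leqNgt.
apply: subset_leq_card; apply/subsetP => y; rewrite !inE => /c2[] e; last by rewrite e.
by rewrite e eqxx in xz.
Qed.

Lemma star_center (G : sgraph) : is_star G -> exists z : vertex G, center z.
Proof.
case=> [[[n0 hc] _] hd].
have [z hz] : exists z, forall x : vertex G, x != z -> degree x <= 1.
  case: (set_0Vmem [set x : vertex G | 1 < degree x]) => [e|[z zin]].
    have [z _] := card_gt0P n0; exists z => x _; rewrite leqNgt.
    by apply/negP => h; have := in_set0 x; rewrite -e inE h.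
  exists z => x xz; rewrite leqNgt; apply: contra xz => h; apply/eqP.
  by have /card_le1_eqP h1 := hd; apply: h1; rewrite // inE.
have two x y w : x != z -> edge x y -> edge x w -> y = w.
  move=> xz xy xw; have /card_le1_eqP h1 := hz x xz; by apply: h1; rewrite inE.
(* Induction along a path from [z]: the predecessor of [x], if it is not [z], is adjacent to [z] by
   induction and has degree at most 1, so it cannot be adjacent to [x] as well. *)
have zadj x : x != z -> edge z x.
  move=> xz; have /connectP[p] := hc z x.
  elim/last_ind: p x xz => [|p y IH] x xz; first by move=> _ e; rewrite e eqxx in xz.
  rewrite rcons_path last_rcons => /andP[hp ey] xy; rewrite -xy in ey *.
  case: (eqVneq (last z p) z) => [e|lz]; first by rewrite e in ey.
  have zl := IH _ lz hp erefl.
  by have := two _ x z lz ey; rewrite edge_sym => /(_ zl) e; rewrite e eqxx in xz.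
exists z; split=> // x y xy; case: (eqVneq x z) => [|xz]; [by left | right].
by apply: (two x) => //; rewrite edge_sym; apply: zadj.
Qed.

Section InjectiveQuotient.
Variables (G Q : sgraph) (f : vertex G -> vertex Q).
Hypotheses (hf : quotient f) (fi : injective f).

Lemma quot_inj_edge u v : edge (f u) (f v) = edge u v.
Proof.
apply/idP/idP => [/(quot_edge hf)[_ [u' [v' [/fi -> /fi -> //]]]]|h].
by apply/(quot_edge hf); rewrite (inj_eq fi) edge_neq //; split=> //; exists u, v.
Qed.

Lemma quot_inj_forest : is_forest Q -> is_forest G.
Proof.
move=> h s s2 /andP[cs us]; apply: (h (map f s)); rewrite ?size_map //.
by rewrite /ucycle map_inj_uniq // us (mono_cycle quot_inj_edge) cs.
Qed.

Lemma quot_inj_connected : is_connected Q -> is_connected G.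
Proof.
move=> hc; have [/card_gt0P[a _] _] := hc; have [l hl _] := connected_level a hc.
have [r ra] := quot_surj hf a.
apply: (@level_connected G r (fun x => l (f x))) => x xr.
have [|b bx lb] := hl (f x); first by rewrite -ra (inj_eq fi).
have [y yb] := quot_surj hf b; exists y; rewrite ?yb //.
by rewrite -quot_inj_edge yb.
Qed.

Lemma quot_inj_star : is_star Q -> is_star G.
Proof.
case/star_center=> a [c1 c2]; have [z za] := quot_surj hf a.
apply: (@center_star G z); split=> [x xz|x y].
  by rewrite -quot_inj_edge za c1 // -za (inj_eq fi).
by rewrite -quot_inj_edge => /c2; rewrite -za => -[/fi->|/fi->]; [left | right].
Qed.

End InjectiveQuotient.

Definition sparse_class (H : sgraph -> Prop) :=
  H = is_star \/ H = is_tree \/ H = is_forest.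

Lemma sparse_iso H (G Q : sgraph) (f : vertex G -> vertex Q) :
  sparse_class H -> quotient f -> injective f -> H Q -> H G.
Proof.
move=> [->|[->|->]] hf fi; first exact: (quot_inj_star hf fi).
  case=> h1 h2; split; first exact: (quot_inj_connected hf fi h1).
  exact: (quot_inj_forest hf fi h2).
exact: (quot_inj_forest hf fi).
Qed.

Lemma identifiableP H (G : sgraph) k : sparse_class H ->
  identifiable H G k <-> exists (Q : sgraph) (f : vertex G -> vertex Q),
    [/\ quotient f, H Q & #|vertex G| <= #|vertex Q| + k].
Proof.
move=> hH; split=> [[m [G' [mk hi hG']]]|[Q [f [hf hQ hk]]]].
  have [f [hf e]] := ident_quotient hi; exists G', f; split=> //.
  by rewrite e leq_add2l.
have [m [G' [g [h1 h2 h3 h4]]]] := quotient_ident hf.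
exists m, G'; split=> //; first by rewrite h4 leq_add2l in hk.
exact: (sparse_iso hH h2 h3 hQ).
Qed.

(** * Membership in NP *)

Lemma all_iotaP (P : pred nat) n : reflect (forall i, i < n -> P i) (all P (iota 0 n)).
Proof.
by apply: (iffP allP) => h i; [move=> hi; apply: h | move=> hi; apply: h];
   move: hi; rewrite mem_iota.
Qed.

Lemma has_iotaP (P : pred nat) n : reflect (exists2 i, i < n & P i) (has P (iota 0 n)).
Proof.
by apply: (iffP hasP) => -[i hi Pi]; exists i => //; move: hi; rewrite mem_iota.
Qed.

Lemma all_enum_ordP m (P : pred 'I_m) : reflect (forall i, P i) (all P (enum 'I_m)).
Proof.
by apply: (iffP allP) => h i; [apply: h; rewrite mem_enum | move=> _; apply: h].
Qed.

Lemma has_enum_ordP m (P : pred 'I_m) : reflect (exists i, P i) (has P (enum 'I_m)).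
Proof.
apply: (iffP hasP) => [[i _ h]|[i h]]; exists i => //; by rewrite mem_enum.
Qed.

Lemma card_count_iota n (P : pred nat) : #|[pred a : 'I_n | P a]| = count P (iota 0 n).
Proof.
rewrite -val_enum_ord count_map cardE -size_filter /enum_mem.
by congr (size _); rewrite -filter_predI; apply: eq_filter => a; rewrite /= !inE andbT.
Qed.

Section ColoringCheck.
Variables (n : nat) (adj : rel nat).

(* The colors number the parts so that each part has at most one smaller
   neighbor; such a numbering exists exactly for forests. *)
Definition forest_chk (c : nat -> nat) : bool :=
  all (fun u => all (fun v => all (fun w => all (fun w' =>
    [&& adj u w, adj v w', c w == c w', c u < c w & c v < c w] ==> (c u == c v))
  (iota 0 n)) (iota 0 n)) (iota 0 n)) (iota 0 n).

Definition conn_chk (c l : nat -> nat) : bool :=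
  has (fun r => all (fun w => (c w == c r) ||
    has (fun u => has (fun v => [&& c v == c w, adj u v & l (c u) < l (c w)])
      (iota 0 n)) (iota 0 n)) (iota 0 n)) (iota 0 n).

Definition star_chk (c : nat -> nat) : bool :=
  has (fun z => all (fun u =>
    ((c u == c z) ||
      has (fun v => has (fun v' => [&& c v == c z, c v' == c u & adj v v'])
        (iota 0 n)) (iota 0 n)) &&
    all (fun v => adj u v ==> [|| c u == c v, c u == c z | c v == c z]) (iota 0 n))
  (iota 0 n)) (iota 0 n).

Definition ncol (c : nat -> nat) : nat :=
  count (fun a => has (fun u => c u == a) (iota 0 n)) (iota 0 n).

Definition class_of (k : nat) : sgraph -> Prop :=
  match k with 0 => is_star | 1 => is_tree | _ => is_forest end.

Definition class_chk (k : nat) (c l : nat -> nat) : bool :=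
  match k with
  | 0 => star_chk c
  | 1 => conn_chk c l && forest_chk c
  | _ => forest_chk c
  end.

Variables (es : symmetric (fun i j : 'I_n => adj i j))
          (ei : irreflexive (fun i j : 'I_n => adj i j)).
Let G := SGraph es ei.

Section Sound.
Variable c : nat -> nat.
Hypothesis hc : forall u, u < n -> c u < n.

Definition col_vertex : finType :=
  {a : 'I_n | has (fun u => c u == a) (iota 0 n)}.

Definition col_edge : rel col_vertex := fun a b =>
  (a != b) && [exists u : 'I_n, exists v : 'I_n,
    [&& c u == val (val a), c v == val (val b) & adj u v]].

Lemma col_edge_sym : symmetric col_edge.
Proof.
move=> a b; rewrite /col_edge eq_sym; congr andb.
by apply/existsP/existsP => -[u /existsP[v /and3P[h1 h2 h3]]];
  exists v; apply/existsP; exists u; rewrite h1 h2 es h3.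
Qed.

Lemma col_edge_irr : irreflexive col_edge.
Proof. by move=> a; rewrite /col_edge eqxx. Qed.

Let Q := SGraph col_edge_sym col_edge_irr.

Lemma col_map_proof (u : 'I_n) :
  has (fun v => c v == Ordinal (hc (ltn_ord u))) (iota 0 n).
Proof. by apply/has_iotaP; exists u. Qed.

Definition col_map (u : vertex G) : vertex Q :=
  exist _ (Ordinal (hc (ltn_ord u))) (col_map_proof u).

Lemma col_mapE (u : vertex G) (a : vertex Q) : (col_map u == a) = (c u == val (val a)).
Proof. by rewrite -!val_eqE. Qed.

Lemma col_quotient : quotient col_map.
Proof.
split=> [a|a b].
  have /has_iotaP[u un ua] := valP a.
  by exists (Ordinal un); apply/eqP; rewrite col_mapE.
split=> [/andP[ab /existsP[u /existsP[v /and3P[h1 h2 h3]]]]|[ab [u [v [ua vb h]]]]].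
  by split=> //; exists u, v; split=> //; apply/eqP; rewrite col_mapE.
apply/andP; split=> //; apply/existsP; exists u; apply/existsP; exists v.
by rewrite -!col_mapE ua vb !eqxx.
Qed.

Lemma col_edgeP (a b : vertex Q) : edge a b -> exists u v : 'I_n,
  [/\ c u = val (val a), c v = val (val b) & adj u v].
Proof.
case/andP=> _ /existsP[u /existsP[v /and3P[/eqP h1 /eqP h2 h3]]].
by exists u, v.
Qed.

Lemma chk_sound k l : class_chk k c l -> class_of k Q.
Proof.
have fo : forest_chk c -> is_forest Q.
  move=> /all_iotaP h; apply: (@order_forest Q (fun a => val (val a))); split.
    by move=> a b /val_inj/val_inj.
  move=> a b d /col_edgeP[u [w [ua wd uw]]] /col_edgeP[v [w' [vb wd' vw]]] ad bd.
  apply: val_inj; apply: val_inj; rewrite -ua -vb; apply/eqP.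
  have /all_iotaP/(_ v (ltn_ord v))/all_iotaP/(_ w (ltn_ord w))/all_iotaP := h u (ltn_ord u).
  by move/(_ w' (ltn_ord w')); rewrite uw vw wd wd' ua vb ad bd eqxx.
case: k => [|[|k]] /=.
- case/has_iotaP=> z zn /all_iotaP h.
  apply: (@center_star Q (col_map (Ordinal zn))); split=> [a az|a b ab].
    have /has_iotaP[u un ua] := valP a; have /andP[+ _] := h u un.
    rewrite (eqP ua); case/orP=> [e|/has_iotaP[v vn /has_iotaP[v' vn' /and3P[h1 h2 h3]]]].
      by move: az; rewrite eq_sym col_mapE eq_sym e.
    apply/andP; split; first by rewrite eq_sym.
    apply/existsP; exists (Ordinal vn); apply/existsP; exists (Ordinal vn').
    by rewrite /= h1 h2.
  have [u [v [ua vb uv]]] := col_edgeP ab.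
  have /andP[_ /all_iotaP/(_ v (ltn_ord v))] := h u (ltn_ord u).
  rewrite uv /= ua vb => /or3P[] /eqP e.
  + by have := edge_neq ab; rewrite -!val_eqE /= e eqxx.
  + by left; apply/eqP; rewrite eq_sym col_mapE /= e.
  + by right; apply/eqP; rewrite eq_sym col_mapE /= e.
- case/andP=> /has_iotaP[r rn /all_iotaP h] /fo hf; split=> //.
  apply: (@level_connected Q (col_map (Ordinal rn)) (fun a => l (val (val a)))) => a ar.
  have /has_iotaP[w wn /eqP wa] := valP a; have := h w wn; rewrite wa.
  case/orP=> [e|/has_iotaP[u un /has_iotaP[v vn /and3P[h1 h2 h3]]]].
    by move: ar; rewrite eq_sym col_mapE eq_sym e.
  exists (col_map (Ordinal un)) => //=; apply/andP; split.
    by rewrite -val_eqE -val_eqE /=; apply: contraTneq h3 => ->; rewrite ltnn.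
  apply/existsP; exists (Ordinal un); apply/existsP; exists (Ordinal vn).
  by rewrite /= h1 h2 eqxx.
- exact: fo.
Qed.

Lemma card_col : #|vertex Q| = ncol c.
Proof. by rewrite /= card_sig /ncol -card_count_iota. Qed.

End Sound.

(** Stated for all [c] and [l] that agree with the constructed ones on the relevant arguments,
    because the functions decoded from a certificate are known only there. *)
Lemma chk_complete k (Q : sgraph) (f : vertex G -> vertex Q) : quotient f -> class_of k Q ->
  exists (c0 : 'I_n -> nat) (l0 : nat -> nat),
    [/\ forall u, c0 u < n, forall a, a < n -> l0 a < n &
        forall (c l : nat -> nat), (forall u : 'I_n, c u = c0 u) -> (forall a, a < n -> l a = l0 a) ->
          class_chk k c l /\ ncol c = #|vertex Q|].
Proof.
move=> hf hQ; have fe := quot_edge hf.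
have Qn : #|vertex Q| <= n.
  rewrite -[n]card_ord -[#|vertex Q|]/(#|predT|).
  apply: leq_trans (leq_image_card f predT); apply: subset_leq_card; apply/subsetP => a _.
  by have [u <-] := quot_surj hf a; apply: image_f.
have card_col' (rk : vertex Q -> nat) (c : nat -> nat) :
    injective rk -> (forall a, rk a < #|vertex Q|) ->
    (forall u : 'I_n, c u = rk (f u)) -> ncol c = #|vertex Q|.
  move=> ri rn hc; rewrite /ncol -size_filter cardE -(size_map rk).
  apply/perm_size/uniq_perm; rewrite ?filter_uniq ?iota_uniq // ?map_inj_uniq -?enumT ?enum_uniq //.
  move=> a; rewrite mem_filter mem_iota /= add0n; apply/andP/mapP.
    case=> /has_iotaP[u un /eqP ua] an; exists (f (Ordinal un)); first by rewrite mem_enum.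
    by rewrite -ua -(hc (Ordinal un)).
  case=> q _ ->; split; last exact: leq_trans (rn q) Qn.
  have [u <-] := quot_surj hf q; apply/has_iotaP; exists u; first exact: ltn_ord.
  by rewrite hc.
have eQ (u v : 'I_n) : f u != f v -> adj u v -> edge (f u) (f v).
  by move=> h1 h2; apply/fe; split=> //; exists u, v.
have fchk rk (c : nat -> nat) : forest_order rk -> (forall u : 'I_n, c u = rk (f u)) ->
    forest_chk c.
  case=> ri ro colE; apply/all_iotaP => u un; apply/all_iotaP => v vn.
  apply/all_iotaP => w wn; apply/all_iotaP => w' wn'; apply/implyP.
  rewrite -[u]/(val (Ordinal un)) -[v]/(val (Ordinal vn)) -[w]/(val (Ordinal wn)).
  rewrite -[w']/(val (Ordinal wn')) !colE; set u1 := Ordinal un; set v1 := Ordinal vn.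
  set w1 := Ordinal wn; set w2 := Ordinal wn'.
  case/and5P=> uw vw /eqP/ri e r1 r2; apply/eqP; congr rk.
  have h1 : f u1 != f w1 by apply: contraTneq r1 => ->; rewrite ltnn.
  have h2 : f v1 != f w2 by rewrite -e; apply: contraTneq r2 => ->; rewrite ltnn.
  by apply: (ro _ _ (f w1)) => //; [apply: eQ | rewrite e; apply: eQ].
case: k hQ => [|[|k]] /= hQ.
- have [z [c1 c2]] := star_center hQ.
  pose rk (a : vertex Q) : nat := enum_rank a.
  have ri : injective rk by move=> a b /ord_inj/enum_rank_inj.
  have rn a : rk a < #|vertex Q| by apply: (ltn_ord (enum_rank a)).
  exists (fun u => rk (f u)), id; split=> // [u|c l colE _].
    exact: leq_trans (rn _) Qn.
  split; last exact: (card_col' rk).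
  have [z0 hz] := quot_surj hf z; apply/has_iotaP; exists z0; first exact: ltn_ord.
  apply/all_iotaP => u un; rewrite -[u]/(val (Ordinal un)) !colE hz.
  set u1 := Ordinal un; apply/andP; split.
    rewrite (inj_eq ri); case: eqVneq => //= /c1 /fe[_ [v [v' [vz vu h]]]].
    apply/has_iotaP; exists v; first exact: ltn_ord.
    apply/has_iotaP; exists v'; first exact: ltn_ord.
    by rewrite !colE vz vu !eqxx.
  apply/all_iotaP => v vn; rewrite -[v]/(val (Ordinal vn)) colE; apply/implyP => uv.
  rewrite !(inj_eq ri); case: eqVneq => //= /eQ /(_ uv) /c2[] ->; by rewrite eqxx ?orbT.
- case: hQ => hcon /[dup] hF /forest_has_order[rk ro rn].
  have [ri _] := ro; have [/card_gt0P[r _] _] := hcon.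
  have [lq hl lqn] := connected_level r hcon.
  (* The check looks up levels by color, so the level of a quotient vertex is filed under its rank;
     numbers that are no ranks get 0. *)
  pose l0 a := if [pick q | rk q == a] is Some q then lq q else 0.
  exists (fun u => rk (f u)), l0; split=> [u|a an|c l colE hl0].
  - exact: leq_trans (rn _) Qn.
  - by rewrite /l0; case: pickP => [q _|_]; [apply: leq_trans Qn | lia].
  have lE q : l (rk q) = lq q.
    rewrite hl0; last exact: leq_trans (rn q) Qn.
    by rewrite /l0; case: pickP => [q' /eqP/ri -> //|/(_ q)]; rewrite eqxx.
  split; last exact: (card_col' rk).
  rewrite (fchk rk) // andbT; have [r0 hr] := quot_surj hf r.
  apply/has_iotaP; exists r0; first exact: ltn_ord.
  apply/all_iotaP => w wn; rewrite -[w]/(val (Ordinal wn)) !colE hr (inj_eq ri).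
  case: eqVneq => //= /hl[b /fe[_ [u [v [ub vw uv]]]] lb].
  apply/has_iotaP; exists u; first exact: ltn_ord.
  apply/has_iotaP; exists v; first exact: ltn_ord.
  by rewrite !colE !lE vw ub lb eqxx andbT; exact: uv.
- have [rk ro rn] := forest_has_order hQ; have [ri _] := ro.
  exists (fun u => rk (f u)), id; split=> // [u|c l colE _].
    exact: leq_trans (rn _) Qn.
  by split; [apply: (fchk rk) | apply: (card_col' rk)].
Qed.

End ColoringCheck.

Lemma sparse_kind H : sparse_class H -> exists k, H = class_of k.
Proof. by case=> [->|[->|->]]; [exists 0 | exists 1 | exists 2]. Qed.

(** * Decoding of instances and certificates *)

Lemma pair_str_inj x y x' y' : pair_str x y = pair_str x' y' -> x = x' /\ y = y'.
Proof.
elim: x x' => [|b x IH] [|b' x'] //= [] => [-> //|-> /IH[-> ->] //].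
Qed.

Lemma nth_flatten_rows n (rows : seq (seq bool)) i j :
  all (fun r => size r == n) rows -> j < n ->
  nth false (flatten rows) (i * n + j) = nth false (nth [::] rows i) j.
Proof.
elim: rows i => [|r rows IH] i /=; first by rewrite !nth_nil.
case/andP=> /eqP sr hr jn; rewrite nth_cat sr.
case: i => [|i]; first by rewrite mul0n add0n jn.
by rewrite mulSn -addnA ltnNge leq_addr /= addKn IH.
Qed.

Lemma size_adj n (e : rel 'I_n) :
  size [seq e i j | i <- enum 'I_n, j <- enum 'I_n] = n * n.
Proof. by rewrite size_allpairs -cardE card_ord. Qed.

Lemma nth_adj n (e : rel 'I_n) (i j : 'I_n) :
  nth false [seq e i j | i <- enum 'I_n, j <- enum 'I_n] (i * n + j) = e i j.
Proof.
rewrite nth_flatten_rows ?ltn_ord //; last first.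
  by apply/allP => r /mapP[k _ ->]; rewrite size_map -cardE card_ord.
have nE := size_enum_ord n.
rewrite (nth_map i) ?nE ?ltn_ord // (nth_map i) ?nE ?ltn_ord //.
by rewrite !nth_ord_enum.
Qed.

Definition seq_adj (A : seq bool) n : rel 'I_n := fun i j => nth false A (i * n + j).

Lemma adj_of_seq n (A : seq bool) : size A = n * n ->
  [seq @seq_adj A n i j | i <- enum 'I_n, j <- enum 'I_n] = A.
Proof.
move=> sA; apply: (@eq_from_nth _ false); rewrite (size_adj (@seq_adj A n)) ?sA // => t ht.
have n0 : 0 < n by case: (n) ht.
have hi : t %/ n < n by rewrite ltn_divLR.
have hj : t %% n < n by rewrite ltn_mod.
rewrite {1}(divn_eq t n) (nth_adj (@seq_adj A n) (Ordinal hi) (Ordinal hj)).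
by rewrite /seq_adj -divn_eq.
Qed.

Lemma encodesP x n (e : rel 'I_n) k : encodes x e k <-> exists A s,
  [/\ binval s = k, x = pair_str (nseq n true) (pair_str A s), size A = n * n &
      e = @seq_adj A n].
Proof.
split=> [[s [<- ->]]|[A [s [<- -> sA ->]]]]; last by exists s; rewrite adj_of_seq.
exists [seq e i j | i <- enum 'I_n, j <- enum 'I_n], s; split=> //; first exact: size_adj.
apply: functional_extensionality => i; apply: functional_extensionality => j.
by rewrite /seq_adj nth_adj.
Qed.

(** The end mark of the first component is the first [false] at an even position, counted here in
    pairs. If there is none, the search ends past the string, and [pok] fails. *)
Definition cut (z : seq bool) : nat :=
  find (fun i => ~~ nth false z i.*2) (iota 0 (size z)).
Definition pok (z : seq bool) : bool := (cut z).*2 < size z.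
Definition fstp (z : seq bool) : seq bool := mkseq (fun i => nth false z i.*2.+1) (cut z).
Definition sndp (z : seq bool) : seq bool := drop (cut z).*2.+1 z.

Lemma find_iota (P : pred nat) q n : q < n -> P q -> (forall i, i < q -> ~~ P i) ->
  find P (iota 0 n) = q.
Proof.
move=> qn Pq hq; rewrite -(subnKC (ltnW qn)) iotaD find_cat size_iota add0n.
have -> : has P (iota 0 q) = false.
  by apply/hasPn => i; rewrite mem_iota; apply: hq.
have : 0 < n - q by lia.
by case: (n - q) => // k _ /=; rewrite Pq addn0.
Qed.

Lemma pair_strK x y :
  [/\ pok (pair_str x y), fstp (pair_str x y) = x & sndp (pair_str x y) = y].
Proof.
have hc : cut (pair_str x y) = size x.
  apply: find_iota; rewrite ?size_pair_str ?nth_pair_str ?ltnn ?eqxx //; first lia.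
  by move=> i hi; rewrite nth_pair_str ltn_double hi odd_double.
split; rewrite /pok /fstp /sndp hc.
- by rewrite size_pair_str; lia.
- apply: (@eq_from_nth _ false); rewrite size_mkseq // => i hi.
  rewrite nth_mkseq // nth_pair_str (_ : i.*2.+1 < _); last lia.
  by rewrite /= odd_double /= uphalf_double.
- by elim: x {hc} => [|b x IH] /=; rewrite ?drop0 ?doubleS.
Qed.

Lemma unpair z : pok z -> z = pair_str (fstp z) (sndp z).
Proof.
rewrite /pok => h; have sz : size (fstp z) = cut z by rewrite size_mkseq.
have hfind i : i < cut z -> nth false z i.*2.
  move=> hi; have := before_find 0 hi; rewrite nth_iota; first by move/negbT; rewrite negbK.
  by apply: leq_trans hi _; rewrite /cut (leq_trans (find_size _ _)) ?size_iota.
have hz : nth false z (cut z).*2 = false.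
  have hh : has (fun i => ~~ nth false z i.*2) (iota 0 (size z)).
    by rewrite has_find size_iota -/(cut z); lia.
  have := nth_find 0 hh; rewrite -/(cut z) nth_iota; last by lia.
  by move/negbTE.
apply: (@eq_from_nth _ false); first by rewrite size_pair_str sz size_drop; lia.
move=> i hi; rewrite nth_pair_str sz; case: ltnP => hc.
  have hi2 : i./2 < cut z by lia.
  rewrite nth_mkseq //; case: (boolP (odd i)) => o /=.
    by congr nth; lia.
  by rewrite -(hfind _ hi2); congr nth; lia.
case: eqP => [-> //|ne]; rewrite nth_drop; congr nth; lia.
Qed.

Lemma pc_cut S : ps S -> pc (fun c => cut (S c)).
Proof. by move=> hS; rewrite /cut; pc_tac. Qed.

Lemma pcb_pok S : ps S -> pcb (fun c => pok (S c)).
Proof. by move=> hS; have := pc_cut hS => h; rewrite /pok; pc_tac. Qed.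

Lemma ps_fstp S : ps S -> ps (fun c => fstp (S c)).
Proof. by move=> hS; have := pc_cut hS => h; rewrite /fstp; pc_tac. Qed.

Lemma ps_sndp S : ps S -> ps (fun c => sndp (S c)).
Proof. by move=> hS; have := pc_cut hS => h; rewrite /sndp; pc_tac. Qed.

(* A certificate is a bit matrix with [2 n] rows of length [n]: the first true
   bit of a row gives the color of a vertex, resp. (in the last [n] rows) the
   level of a color. *)
Definition vn z := size (fstp (fstp z)).
Definition vA z := fstp (sndp (fstp z)).
Definition vs z := sndp (sndp (fstp z)).
Definition vadj z u v := nth false (vA z) (u * vn z + v).
Definition vcol z u := find (fun a => nth false (sndp z) (u * vn z + a)) (iota 0 (vn z)).
Definition vlev z a := vcol z (vn z + a).
Definition vk z := iteri (size (vs z))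
  (fun i acc => minn (vn z) (nth false (vs z) (size (vs z) - i.+1) + acc.*2)) 0.
Definition vvalid z := [&& pok z, pok (fstp z),
  all (nth false (fstp (fstp z))) (iota 0 (vn z)), pok (sndp (fstp z)),
  size (vA z) == vn z * vn z &
  all (fun i => ~~ vadj z i i && all (fun j => vadj z i j == vadj z j i) (iota 0 (vn z)))
      (iota 0 (vn z))].
Definition verify k z := [&& vvalid z,
  all (fun u => vcol z u < vn z) (iota 0 (vn z)),
  class_chk (vn z) (vadj z) k (vcol z) (vlev z) &
  vn z <= ncol (vn z) (vcol z) + vk z].

(** The number [k] is given in binary and may be exponential, which unary registers cannot hold.
    Capping at [n] after every digit commutes with the evaluation of the numeral, and it does not
    affect the test whether [n] is at most the number of colors plus [k]. *)
Lemma vkE z : vk z = minn (vn z) (binval (vs z)).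
Proof.
rewrite /vk; set n := vn z; move: (vs z) => s.
have h i : i <= size s -> iteri i (fun i acc =>
    minn n (nth false s (size s - i.+1) + acc.*2)) 0 = minn n (binval (drop (size s - i) s)).
  elim: i => [|i IH] hi; first by rewrite subn0 drop_size minn0.
  rewrite iteriS IH ?(ltnW hi) //.
  rewrite (@drop_nth _ false (size s - i.+1)); last lia.
  rewrite /= -subSn // subSS.
  by case: (nth _ _ _) => /=; move: (binval _) => v; lia.
by rewrite h // subnn drop0.
Qed.

Lemma pc_vn S : ps S -> pc (fun c => vn (S c)).
Proof. by move=> hS; apply/ps_size/ps_fstp/ps_fstp. Qed.

Lemma ps_vA S : ps S -> ps (fun c => vA (S c)).
Proof. by move=> hS; apply/ps_fstp/ps_sndp/ps_fstp. Qed.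

Lemma ps_vs S : ps S -> ps (fun c => vs (S c)).
Proof. by move=> hS; apply/ps_sndp/ps_sndp/ps_fstp. Qed.

Ltac pc_user ::= lazymatch goal with
  | |- ps (fun c => vA (@?S c)) => apply (@ps_vA S)
  | |- ps (fun c => vs (@?S c)) => apply (@ps_vs S)
  | |- ps (fun c => fstp (@?S c)) => apply (@ps_fstp S)
  | |- ps (fun c => sndp (@?S c)) => apply (@ps_sndp S)
  | |- pc (fun c => vn (@?S c)) => apply (@pc_vn S)
  | |- pcb (fun c => pok (@?S c)) => apply (@pcb_pok S)
  end.

Lemma pcb_vadj S F F' : ps S -> pc F -> pc F' -> pcb (fun c => vadj (S c) (F c) (F' c)).
Proof. by move=> hS hF hF'; rewrite /vadj; pc_tac. Qed.

Lemma pc_vcol S F : ps S -> pc F -> pc (fun c => vcol (S c) (F c)).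
Proof. by move=> hS hF; rewrite /vcol; pc_tac. Qed.

Lemma pc_vk S : ps S -> pc (fun c => vk (S c)).
Proof.
move=> hS; apply: (pc_iteri (f := fun c i acc => minn (vn (S c))
  (nth false (vs (S c)) (size (vs (S c)) - i.+1) + acc.*2))) (pc_pbd (pc_vn hS)) _ _.
1-3: by pc_tac.
by move=> c [|i] _ //; rewrite iteriS geq_minl.
Qed.

Ltac pc_user ::= lazymatch goal with
  | |- ps (fun c => vA (@?S c)) => apply (@ps_vA S)
  | |- ps (fun c => fstp (@?S c)) => apply (@ps_fstp S)
  | |- ps (fun c => sndp (@?S c)) => apply (@ps_sndp S)
  | |- pc (fun c => vn (@?S c)) => apply (@pc_vn S)
  | |- pc (fun c => vk (@?S c)) => apply (@pc_vk S)
  | |- pc (fun c => vcol (@?S c) (@?F c)) => apply (@pc_vcol S F)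
  | |- pcb (fun c => vadj (@?S c) (@?F c) (@?F' c)) => apply (@pcb_vadj S F F')
  | |- pcb (fun c => pok (@?S c)) => apply (@pcb_pok S)
  end.

Lemma verify_ps k : ps (fun c => [:: verify k c.1]).
Proof.
rewrite /verify /vvalid /ncol /class_chk /star_chk /conn_chk /forest_chk /vlev.
by case: k => [|[|k]]; pc_tac.
Qed.

(** The matrix is one-hot: bit [a] of row [u] is set exactly for [a = c u]. *)
Lemma vcol_mkseq n (c : nat -> nat) x u : 
  let z := pair_str x (mkseq (fun t => c (t %/ n) == t %% n) (2 * n * n)) in
  vn z = n -> u < 2 * n -> c u < n -> vcol z u = c u.
Proof.
move=> z zn un cn; have [_ _ sz] := pair_strK x (mkseq (fun t => c (t %/ n) == t %% n) (2 * n * n)).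
rewrite /vcol zn sz.
have h a : a < n -> nth false (mkseq (fun t => c (t %/ n) == t %% n) (2 * n * n))
    (u * n + a) = (c u == a).
  move=> an; rewrite nth_mkseq; last by nia.
  by rewrite divnMDl ?(divn_small an) ?addn0 ?modnMDl ?modn_small //; lia.
apply: find_iota; rewrite ?h ?eqxx // => i ic; rewrite h; last by lia.
by rewrite neq_ltn ic orbT.
Qed.

Theorem identification_in_NP H : sparse_class H -> in_NP (Identification H).
Proof.
move=> hH; have [k hk] := sparse_kind hH.
exists (fun z => [:: verify k z]), 4; split; first exact: (ps_polytime (verify_ps k)).
move=> x; split.
- case=> n [e [es [ei [b [/encodesP[A [s [<- hx sA eA]]] /(identifiableP _ _ hH)]]]]].
  subst e; case=> Q [f [hf hQ]]; rewrite card_ord => hn.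
  rewrite hk in hQ.
  have [c0 [l0 [hc hl hcl]]] :=
    @chk_complete n (fun u v => nth false A (u * n + v)) es ei k Q f hf hQ.
  pose c u := if u < n then (if insub u is Some u' then c0 u' else 0) else l0 (u - n).
  exists (mkseq (fun t => c (t %/ n) == t %% n) (2 * n * n)); split.
    rewrite size_mkseq hx !size_pair_str size_nseq.
    have : n <= n.*2.+1 + (2 * size A + size s) by lia.
    move: (_ + _) => N h; rewrite (_ : size A = n * n) // !expnS expn0; nia.
  set z := pair_str x _; congr [:: _].
  have [z1 z2 z3] := pair_strK x (mkseq (fun t => c (t %/ n) == t %% n) (2 * n * n)).
  rewrite -/z in z1 z2 z3.
  have [x1 x2 x3] := pair_strK (nseq n true) (pair_str A s); rewrite -hx in x1 x2 x3.
  have [r1 r2 r3] := pair_strK A s.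
  have zn : vn z = n by rewrite /vn z2 x2 size_nseq.
  have zA : vA z = A by rewrite /vA z2 x3 r2.
  have zs : vs z = s by rewrite /vs z2 x3 r3.
  have za u v : vadj z u v = nth false A (u * n + v) by rewrite /vadj zA zn.
  have cE (u : 'I_n) : c u = c0 u by rewrite /c ltn_ord valK.
  have zc (u : 'I_n) : vcol z u = c0 u.
    rewrite -cE; apply: vcol_mkseq => //; last by rewrite cE.
    by have := ltn_ord u; lia.
  have zl a : a < n -> vlev z a = l0 a.
    move=> an; have ca : c (n + a) = l0 a by rewrite /c ltnNge leq_addr /= addKn.
    by rewrite /vlev zn -ca; apply: vcol_mkseq => //; [lia | rewrite ca hl].
  have [chk nc] := hcl _ _ zc zl.
  have -> : verify k z = true; last by [].
  apply/and4P; split.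
  + apply/and5P; split=> //; rewrite ?z2 ?x3 //.
      by rewrite zn x2; apply/all_iotaP => i hi; rewrite nth_nseq hi.
    rewrite zA zn sA eqxx; apply/all_iotaP => i hi; rewrite !za.
    have := ei (Ordinal hi); rewrite /seq_adj /= => -> /=.
    apply/all_iotaP => j hj; rewrite !za.
    by have := es (Ordinal hi) (Ordinal hj); rewrite /seq_adj /= => ->.
  + by rewrite zn; apply/all_iotaP => u hu; rewrite (zc (Ordinal hu)).
  + rewrite zn (_ : vadj z = fun u v => nth false A (u * n + v)) //.
    by apply: functional_extensionality => u; apply: functional_extensionality => v.
  + by rewrite zn nc vkE zn zs; move: hn; lia.
- case=> y [_ [hv]]; set z := pair_str x y in hv.
  have [z1 z2 z3] := pair_strK x y; rewrite -/z in z1 z2 z3.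
  case/and4P: hv => /and5P[_ x1 xt r1 /andP[/eqP sA adjP]] cP chk nk.
  rewrite z2 in x1 xt r1.
  have hx := unpair x1; have hr := unpair r1.
  have zn : vn z = size (fstp x) by rewrite /vn z2.
  have hx1 : fstp x = nseq (vn z) true.
    apply: (@eq_from_nth _ false); rewrite ?size_nseq // => i hi.
    by rewrite -zn in hi; rewrite nth_nseq hi; move/all_iotaP: xt => ->.
  have zA : vA z = fstp (sndp x) by rewrite /vA z2.
  have zs : vs z = sndp (sndp x) by rewrite /vs z2.
  rewrite -zA -zs in hr; rewrite hr hx1 in hx.
  set n := vn z in sA adjP cP chk nk hx.
  have es : symmetric (@seq_adj (vA z) n).
    move=> i j; move/all_iotaP: adjP => /(_ i (ltn_ord i))/andP[_ /all_iotaP].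
    by move/(_ j (ltn_ord j))/eqP.
  have ei : irreflexive (@seq_adj (vA z) n).
    by move=> i; move/all_iotaP: adjP => /(_ i (ltn_ord i))/andP[/negbTE].
  exists n, (@seq_adj (vA z) n), es, ei, (binval (vs z)); split.
    by apply/encodesP; exists (vA z), (vs z).
  apply/(identifiableP _ _ hH); rewrite hk.
  have hc u : u < n -> vcol z u < n by move/all_iotaP: cP => h /h.
  have hQ := @chk_sound n (vadj z) es ei _ hc k _ chk.
  exists (SGraph (@col_edge_sym n (vadj z) es (vcol z)) (@col_edge_irr n (vadj z) (vcol z))).
  exists (@col_map n (vadj z) es ei _ hc); split=> //; first exact: col_quotient.
  rewrite card_col card_ord; apply: leq_trans nk _.
  by rewrite leq_add2l vkE geq_minr.
Qed.

(** * From cliques of compatible vertices to identifications *)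

Definition clique (N q : nat) (C : rel nat) : Prop :=
  exists s : seq nat, [/\ uniq s, size s = q, all (fun u => u < N) s &
    {in s &, forall u v, u != v -> C u v}].

(* Complement of the compatibility graph [C] on [0, N), with [N] as an
   additional universal vertex. *)
Definition cadj (N : nat) (C : rel nat) : rel nat := fun u v =>
  (u != v) && [|| u == N, v == N, ~~ C u v | ~~ C v u].

Definition bits (k : nat) : seq bool := mkseq (fun i => odd (iter i half k)) k.

Definition clique_str (N q : nat) (C : rel nat) : seq bool :=
  pair_str (nseq N.+1 true)
    (pair_str (mkseq (fun t => cadj N C (t %/ N.+1) (t %% N.+1)) (N.+1 * N.+1))
              (bits (N - q))).

Lemma binval_bits k : binval (bits k) = k.
Proof.
rewrite /bits; suff h n m : m < 2 ^ n -> binval (mkseq (fun i => odd (iter i half m)) n) = m.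
  exact/h/ltn_expl.
elim: n m => [|n IH] m; first by case: m.
rewrite expnS => hm.
have -> : mkseq (fun i => odd (iter i half m)) n.+1 =
    odd m :: mkseq (fun i => odd (iter i half m./2)) n.
  rewrite /mkseq /= -[1]addn0 iotaDl -map_comp; congr (_ :: _).
  by apply: eq_map => i; rewrite /= -iterSr.
by rewrite /= IH; lia.
Qed.

Section StarGraph.
Variable T : finType.

Definition star_edge : rel (option T) := fun a b => isSome a (+) isSome b.

Lemma star_edge_sym : symmetric star_edge.
Proof. by move=> a b; rewrite /star_edge addbC. Qed.

Lemma star_edge_irr : irreflexive star_edge.
Proof. by move=> a; rewrite /star_edge addbb. Qed.

Definition star_graph := SGraph star_edge_sym star_edge_irr.

Lemma star_graph_star : is_star star_graph.
Proof.
apply: (@center_star star_graph None); split=> [[]|[a|] [b|]] //; by [left | right].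
Qed.

End StarGraph.

Lemma star_class H (G : sgraph) : sparse_class H -> is_star G -> H G.
Proof. by move=> [->|[->|->]] // [[]]. Qed.

Lemma class_forest H (G : sgraph) : sparse_class H -> H G -> is_forest G.
Proof. by move=> [->|[->|->]] // => [[[]]|[]]. Qed.

Section CliqueGraph.
Variables (N q : nat) (C : rel nat).
Let A := mkseq (fun t => cadj N C (t %/ N.+1) (t %% N.+1)) (N.+1 * N.+1).
Variables (es : symmetric (@seq_adj A N.+1)) (ei : irreflexive (@seq_adj A N.+1)).
Let G := SGraph es ei.

Lemma clique_adjE (i j : 'I_N.+1) : seq_adj A i j = cadj N C i j.
Proof.
have hi := ltn_ord i; have hj := ltn_ord j; rewrite /seq_adj nth_mkseq; last by nia.
by rewrite divnMDl // (divn_small hj) addn0 modnMDl modn_small.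
Qed.

Lemma ident_clique H : sparse_class H -> q <= N ->
  identifiable H G (N - q) -> clique N q C.
Proof.
move=> hH qN /(identifiableP _ _ hH)[Q [f [hf hQ]]]; rewrite card_ord => hcard.
have hF := class_forest hH hQ.
(* This comes from [N.+1 <= #|vertex Q| + (N - q)]. So [q] parts are left besides that of the
   universal vertex [z]. *)
have Qq : q < #|vertex Q| by lia.
pose z : 'I_N.+1 := ord_max.
pose rep a : 'I_N.+1 := odflt z [pick u | f u == a].
have fr a : f (rep a) = a.
  rewrite /rep; case: pickP => [u /eqP //|h]; have [u ua] := quot_surj hf a.
  by have := h u; rewrite ua eqxx.
pose L := [seq val (rep a) | a <- enum (vertex Q) & a != f z].
have sL : size L = #|vertex Q|.-1.
  by rewrite size_map -(cardC1 (f z)) cardE /enum_mem -filter_predI; congr size;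
     apply: eq_filter => a; rewrite /= !inE andbT.
have uL : uniq L.
  rewrite map_inj_uniq ?filter_uniq -?enumT ?enum_uniq // => a b /val_inj e.
  by rewrite -(fr a) -(fr b) e.
have ze (u : 'I_N.+1) : f u != f z -> edge (f u) (f z).
  move=> h; apply/(quot_edge hf); split=> //; exists u, z; split=> //.
  rewrite /edge /= clique_adjE /cadj eqxx orbT andbT.
  by apply: contraNneq h => e; apply/eqP; congr f; apply: val_inj.
exists (take q L); split.
- exact: take_uniq.
- by rewrite size_takel // sL; lia.
- apply/allP => u /mem_take/mapP[a]; rewrite mem_filter => /andP[az _] ->.
  rewrite ltn_neqAle -ltnS ltn_ord andbT.
  by apply: contraNneq az => e; rewrite -(fr a); apply/eqP; congr f; apply: val_inj.
- move=> u v /mem_take/mapP[a]; rewrite mem_filter => /andP[az _] ->.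
  move=> /mem_take/mapP[b]; rewrite mem_filter => /andP[bz _] -> ab.
  apply/negPn/negP => hC.
  have nab : a != b by apply: contraNneq ab => ->.
  have ea : edge a (f z) by rewrite -{1}(fr a) ze // fr.
  have eb : edge b (f z) by rewrite -{1}(fr b) ze // fr.
  have eab : edge a b.
    apply/(quot_edge hf); split=> //; exists (rep a), (rep b); split=> //.
    by rewrite /edge /= clique_adjE /cadj ab hC !orbT.
  apply: (hF [:: a; b; f z]) => //.
  by rewrite /ucycle /= eab eb edge_sym ea !inE negb_or nab az bz.
Qed.

(** All vertices outside the clique join the universal vertex and form the center; the members of
    the clique, pairwise non-adjacent in the complement, become the leaves. *)
Lemma clique_ident H : sparse_class H -> q <= N ->
  clique N q C -> identifiable H G (N - q).
Proof.
move=> hH qN [s [us ss sN sC]]; apply/(identifiableP _ _ hH).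
pose T : finType := {x : 'I_N.+1 | val x \in s}.
exists (star_graph T), (fun u => insub u : option T); split.
- have hN : (insub (ord_max : 'I_N.+1) : option T) = None.
    rewrite insubF //; apply/negP => /(allP sN) /=; by rewrite ltnn.
  split=> [[x|]|a b]; first by exists (val x); rewrite valK.
    by exists ord_max.
  split=> [|[ab [u [v [ua vb]]]]].
    case: a b => [a|] [b|] // _; split=> //.
      exists (val a), ord_max; rewrite valK hN; split=> //.
      rewrite /edge /= clique_adjE /cadj eqxx orbT andbT.
      by have /(allP sN) := valP a => h; rewrite neq_ltn h.
    exists ord_max, (val b); rewrite valK hN; split=> //.
    rewrite /edge /= clique_adjE /cadj eqxx andbT.
    by have /(allP sN) := valP b => h; rewrite neq_ltn h orbT.
  rewrite /edge /= clique_adjE /cadj => /andP[uv h].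
  case: a b ua vb ab => [a|] [b|] //; case: insubP => // a' ha _ _.
  case: insubP => // b' hb _ _ _.
  have vu : val v != val u by rewrite eq_sym.
  move: h; rewrite (ltn_eqF (allP sN _ ha)) (ltn_eqF (allP sN _ hb)) /=.
  by rewrite (sC _ _ ha hb uv) (sC _ _ hb ha vu).
- exact: star_class hH (star_graph_star T).
- rewrite card_ord /= card_option card_sig.
  have -> : #|[pred x : 'I_N.+1 | val x \in s]| = q; last by lia.
  rewrite (card_count_iota N.+1 (fun a => a \in s)) -size_filter -ss.
  apply/perm_size/uniq_perm => //; first exact/filter_uniq/iota_uniq.
  move=> a; rewrite mem_filter mem_iota /= add0n.
  by case: (boolP (a \in s)) => //= /(allP sN)/ltnW.
Qed.

End CliqueGraph.

Lemma cadj_sym N C : symmetric (cadj N C).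
Proof.
by move=> u v; rewrite /cadj eq_sym; case: (u == N); case: (v == N); rewrite ?orbT //= orbC.
Qed.

Section CliqueString.
Variables (H : sgraph -> Prop) (hH : sparse_class H) (N q : nat) (C : rel nat).
Hypothesis qN : q <= N.

Let A := mkseq (fun t => cadj N C (t %/ N.+1) (t %% N.+1)) (N.+1 * N.+1).

(** The problems quantify over all decodings of a string; injectivity of [pair_str] leaves only the
    intended one. *)
Lemma clique_str_inv n (e : rel 'I_n) (es : symmetric e) (ei : irreflexive e) k :
  encodes (clique_str N q C) e k -> identifiable H (SGraph es ei) k ->
  [/\ n = N.+1, k = N - q & clique N q C].
Proof.
case/encodesP=> A' [s [hk /pair_str_inj[hn /pair_str_inj[hA hs]] _ he]].
have {}hn : n = N.+1 by move/(congr1 size): hn; rewrite !size_nseq.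
subst n e; rewrite -hs binval_bits in hk; rewrite -hk -{}hA in es ei *.
by move=> /(ident_clique hH qN).
Qed.

Lemma clique_str_intro : clique N q C -> exists (e : rel 'I_N.+1) (es : symmetric e)
  (ei : irreflexive e), encodes (clique_str N q C) e (N - q) /\
  identifiable H (SGraph es ei) (N - q).
Proof.
move=> hc.
have es : symmetric (@seq_adj A N.+1) by move=> i j; rewrite !clique_adjE cadj_sym.
have ei : irreflexive (@seq_adj A N.+1) by move=> i; rewrite clique_adjE /cadj eqxx.
exists (@seq_adj A N.+1), es, ei; split; last exact: clique_ident.
apply/encodesP; exists A, (bits (N - q)); split=> //; first exact: binval_bits.
by rewrite size_mkseq.
Qed.

Lemma ident_clique_str : Identification H (clique_str N q C) <-> clique N q C.
Proof.
split=> [[n [e [es [ei [k [h1 h2]]]]]]|/clique_str_intro[e [es [ei [h1 h2]]]]].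
  by have [] := clique_str_inv h1 h2.
by exists N.+1, e, es, ei, (N - q).
Qed.

Lemma ident_dual_clique_str :
  Identification_dual H (clique_str N q C) q.+1 <-> clique N q C.
Proof.
split=> [[n [e [es [ei [k [h1 _ h2]]]]]]|/clique_str_intro[e [es [ei [h1 h2]]]]].
  by have [] := clique_str_inv h1 h2.
by exists N.+1, e, es, ei, (N - q); split=> //; lia.
Qed.

End CliqueString.

(** Compatible vertices belong to different variables, so a clique of size [q] contains exactly one
    value for each variable. By [1 < q] every member of the clique has a partner, and this yields
    [idx u < q]. *)
Lemma csp_clique N q (C : rel nat) (idx : nat -> nat) : 1 < q ->
  (forall u v, C u v -> idx u < q /\ idx u <> idx v) ->
  clique N q C <-> exists w : nat -> nat, forall t, t < q ->
    [/\ w t < N, idx (w t) = t & forall t', t' < q -> t <> t' -> C (w t) (w t')].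
Proof.
move=> q1 hidx; split=> [[s [us ss sN sC]]|[w hw]].
  have lt u : u \in s -> idx u < q.
    move=> uin; have [v vs uv] : exists2 v, v \in s & u != v.
      move: us ss uin; case: s {sN sC} => [|a [|b s]] //; rewrite ?inE.
        by move=> _ e _; move: q1; rewrite -e.
      rewrite /= inE negb_or => /andP[/andP[ab _] _] _ uin.
      by case: (eqVneq u a) => [->|]; [exists b; rewrite ?inE ?eqxx ?orbT | exists a; rewrite ?inE ?eqxx].
    by have [] := hidx _ _ (sC _ _ uin vs uv).
  have ui : uniq (map idx s).
    rewrite map_inj_in_uniq // => u v uin vin e; apply/eqP/negPn/negP => uv.
    by have [] := hidx _ _ (sC _ _ uin vin uv).
  have me : map idx s =i iota 0 q.
    apply: (uniq_min_size ui _ _).2 => [u /mapP[v vin ->]|]; last by rewrite size_map size_iota ss.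
    by rewrite mem_iota /= add0n lt.
  pose w t := nth 0 s (index t (map idx s)).
  have hw t : t < q -> w t \in s /\ idx (w t) = t.
    move=> tq; have tin : t \in map idx s by rewrite me mem_iota.
    have ti : index t (map idx s) < size s by rewrite -(size_map idx) index_mem.
    by rewrite /w mem_nth // -(nth_map 0 0) // nth_index.
  exists w => t tq; have [h1 h2] := hw t tq; split=> //; first exact: (allP sN).
  move=> t' tq' tt; have [h1' h2'] := hw t' tq'; apply: sC => //.
  by apply: contra_not_neq tt => e; rewrite -h2 -h2' e.
exists (mkseq w q); split; rewrite ?size_mkseq //.
- rewrite map_inj_in_uniq ?iota_uniq // => t t'; rewrite !mem_iota => tq tq' e.
  by have [_ <- _] := hw t tq; have [_ <- _] := hw t' tq'; rewrite e.
- by apply/allP => u /mapP[t]; rewrite mem_iota => /hw[h _ _] ->.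
- move=> u v /mapP[t]; rewrite mem_iota => /hw[_ _ h] -> /mapP[t' ht' ->] ne.
  by apply: h; [rewrite mem_iota in ht' | move=> e; rewrite e eqxx in ne].
Qed.

(** Vertices are numbers whose digits in a suitable base are the fields of a tuple. *)
Definition dig (B u i : nat) : nat := (u %/ B ^ i) %% B.

Fixpoint undig (B m : nat) (f : nat -> nat) : nat :=
  if m is m'.+1 then undig B m' (fun i => f i.+1) * B + f 0 else 0.

Lemma undig_lt B m f : (forall i, i < m -> f i < B) -> undig B m f < B ^ m.
Proof.
elim: m f => [|m IH] f hf //=; have f0 : f 0 < B by apply: hf.
have := IH (fun i => f i.+1) (fun i im => hf i.+1 im); rewrite expnS; nia.
Qed.

Lemma dig_undig B m f i : (forall i, i < m -> f i < B) -> i < m ->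
  dig B (undig B m f) i = f i.
Proof.
elim: m f i => [|m IH] f i hf //; have f0 : f 0 < B by apply: hf.
case: i => [|i] im; first by rewrite /dig expn0 divn1 /= modnMDl modn_small.
rewrite -(IH (fun i => f i.+1)) //; last by move=> j jm; apply: hf.
by rewrite /dig expnS divnMA /= divnMDl ?(divn_small f0) ?addn0 //; lia.
Qed.

Lemma pc_dig B F i : pc B -> pc F -> pc (fun c => dig (B c) (F c) i).
Proof. by move=> hB hF; rewrite /dig; pc_tac. Qed.

Lemma ps_bits F : pc F -> ps (fun c => bits (F c)).
Proof.
move=> hF; rewrite /bits; apply: (ps_mkseq (P := fun c i => odd (iter i half (F c)))) => //.
apply: pcb_odd.
apply: (pc_iter (N := top) (a := fun c => F (pop c)) (B := fun c => F (pop c)) (f := fun=> half)).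
- exact: pc_top.
- exact: pc_pop.
- exact/pc_pbd/pc_pop.
- exact/pc_half/pc_top.
- move=> c i _; elim: i => //= i; lia.
Qed.

Lemma ps_clique_str (N q : seq bool -> nat) (C : seq bool -> rel nat) :
  (forall S, ps S -> pc (fun c => N (S c))) ->
  (forall S, ps S -> pc (fun c => q (S c))) ->
  (forall S F F', ps S -> pc F -> pc F' -> pcb (fun c => C (S c) (F c) (F' c))) ->
  forall S, ps S -> ps (fun c => clique_str (N (S c)) (q (S c)) (C (S c))).
Proof.
move=> hN hq hC S hS; rewrite /clique_str /cadj.
have h1 := hN _ hS; have h2 := hq _ hS.
apply: ps_pair; first by pc_tac.
apply: ps_pair; last by apply: ps_bits; pc_tac.
apply: (ps_mkseq (P := fun c t => (t %/ (N (S c)).+1 != t %% (N (S c)).+1) && _)); first by pc_tac.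
have h3 : pc (fun c => N (S (pop c))) := pc_pop h1.
by repeat first [apply: hC | progress pc_tac].
Qed.

(** * Tableaux of Turing machines *)

Section TapeDynamics.
Variables (M : tm) (T : nat) (z : seq bool).
Notation K1 := (tm_tapes M).+1.
Notation tsym := (option (bool + tm_aux M))%type.

Definition loc : finType := (tm_state M * {ffun 'I_K1 -> tsym})%type.

(* After time [T] the head of tape 0 moves right once more, so that the symbol
   next to the output bit is scanned too. *)
Definition delta (fl : bool) (s : loc) :
    tm_state M * {ffun 'I_K1 -> tsym * direction} :=
  if fl then (s.1, [ffun i => (s.2 i, if i == ord0 then MoveR else Stay)])
  else if tm_halt s.1 then (s.1, [ffun i => (s.2 i, Stay)])
  else tm_trans s.1 s.2.

Definition mv (d : direction) (p : nat) : nat :=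
  match d with MoveL => p.-1 | MoveR => p.+1 | Stay => p end.

Record acfg := ACfg {
  astate : tm_state M;
  apos : 'I_K1 -> nat;
  acell : 'I_K1 -> nat -> tsym }.

Definition aloc (c : acfg) : loc := (astate c, [ffun i => acell c i (apos c i)]).

Definition astep (fl : bool) (c : acfg) : acfg :=
  let d := delta fl (aloc c) in
  ACfg d.1 (fun i => mv (d.2 i).2 (apos c i))
       (fun i p => if p == apos c i then (d.2 i).1 else acell c i p).

(** Cells are numbered absolutely. The heads start at [T.+2], so they are at positive positions up
    to time [T.+1], and [predn] in [mv] is always a proper move to the left. *)
Definition acell0 (i : 'I_K1) (p : nat) : tsym :=
  if (i == ord0) && (T.+2 <= p) then nth None [seq Some (inl b) | b <- z] (p - T.+2)
  else None.

Fixpoint arun (t : nat) : acfg :=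
  if t is t'.+1 then astep (t' == T) (arun t')
  else ACfg (tm_start M) (fun=> T.+2) acell0.

Lemma apos_bounds t i : T.+2 <= apos (arun t) i + t /\ apos (arun t) i <= T.+2 + t.
Proof.
elim: t => [|t [h1 h2]] /=; first by rewrite addn0.
by case: (_.2) => /=; lia.
Qed.

Lemma acell_written t i :
  acell (arun t.+1) i (apos (arun t) i) = ((delta (t == T) (aloc (arun t))).2 i).1.
Proof. by rewrite /= eqxx. Qed.

Lemma acell_kept a t i p : a <= t -> (forall j, a <= j < t -> apos (arun j) i <> p) ->
  acell (arun t) i p = acell (arun a) i p.
Proof.
elim: t => [|t IH]; first by rewrite leqn0 => /eqP->.
rewrite leq_eqVlt => /predU1P[-> //|at_ h] /=.
case: eqP => [e|_]; first by case: (h t); rewrite ?e //; lia.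
by apply: IH => // j hj; apply: h; lia.
Qed.

Definition tcell (t : tape M) (pos p : nat) : tsym :=
  if pos <= p then nth None t.2 (p - pos) else nth None t.1 (pos.-1 - p).

Lemma tcell_write a d (t : tape M) pos p : 0 < pos ->
  tcell (write_move (a, d) t) (mv d pos) p = if p == pos then a else tcell t pos p.
Proof.
case: t => l r; case: pos => // pos _; rewrite /tcell; case: d => /=.
- case: (ltngtP p pos.+1) => [hp|hp|->].
  + rewrite ltnS in hp; case: (ltngtP pos p) hp => [//|hp _|<- _].
      by rewrite nth_behead; congr nth; lia.
    by rewrite subnn /=; case: (l).
  + rewrite (ltnW (ltnW hp)); have -> : p - pos = (p - pos.+1).-1.+2 by lia.
    by rewrite /= nth_behead prednK // subn_gt0.
  + by rewrite leqnSn subSnn.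
- case: (ltngtP p pos.+1) => [hp|hp|->].
  + by have -> : pos.+1 - p = (pos - p).+1 by lia.
  + by rewrite nth_behead; congr nth; lia.
  + by rewrite subnn.
- case: (ltngtP p pos.+1) => [hp|hp|->] //; last by rewrite subnn.
  have -> : p - pos.+1 = (p - pos.+2).+1 by lia.
  by rewrite /= nth_behead.
Qed.

Lemma arun_tm t : t <= T ->
  let c := iter t (@tm_step M) (tm_init M z) in
  astate (arun t) = c.1 /\
  forall i p, acell (arun t) i p = tcell (c.2 i) (apos (arun t) i) p.
Proof.
elim: t => [_|t IH tT].
  split=> // i p; rewrite /= /acell0 /tcell /=.
  by case: leqP => hp; rewrite ?andbF ?nth_nil //= andbT; case: eqP; rewrite ?nth_nil.
have /= [h1 h2] := IH (ltnW tT); set c := iter t _ _ in h1 h2.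
have hl : aloc (arun t) = (c.1, [ffun i => scanned (c.2 i)]).
  rewrite /aloc h1; congr pair; apply/ffunP => i; rewrite !ffunE h2 /tcell leqnn subnn.
  by rewrite nth0.
have tT' : (t == T) = false by rewrite ltn_eqF.
have pos0 i : 0 < apos (arun t) i by have [] := apos_bounds t i; lia.
rewrite /= tT' /astep hl /delta /= /tm_step.
case: (tm_halt c.1) => /=.
  split=> // i p; rewrite !ffunE h2 /=; case: eqP => [->|] //.
  by rewrite /tcell leqnn subnn nth0.
case: tm_trans => q act /=; split=> // i p.
by rewrite h2; case: (act i) => a d; rewrite tcell_write.
Qed.

Definition isbt (a : tsym) : bool := if a is Some (inl _) then true else false.

Definition accepting : Prop :=
  [/\ tm_halt (aloc (arun T)).1, (aloc (arun T)).2 ord0 = Some (inl true) &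
      ~~ isbt ((aloc (arun T.+1)).2 ord0)].

Lemma leading_bits_true (r : seq (tm_sym M)) : leading_bits r = [:: true] <->
  nth None r 0 = Some (inl true) /\ ~~ isbt (nth None r 1).
Proof.
case: r => [|[[[]|a]|] r] /=; try by split=> // -[].
by split; case: r => [|[[b|a]|] r] //= [].
Qed.

Lemma acceptingP y T' : outputs_within M z y T' -> T' <= T ->
  accepting <-> y = [:: true].
Proof.
move=> [hh hy] TT; have := arun_tm (leqnn T); set c := iter T _ _ => -[h1 h2].
have ec : c = iter T' (@tm_step M) (tm_init M z).
  by rewrite /c -(subnK TT) iterD tm_halt_iter.
rewrite -ec in hh hy.
have pos i : 0 < apos (arun T) i by have [] := apos_bounds T i; lia.
have r0 : (aloc (arun T)).2 ord0 = nth None (c.2 ord0).2 0.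
  by rewrite ffunE h2 /tcell leqnn subnn.
have r1 : (aloc (arun T.+1)).2 ord0 = nth None (c.2 ord0).2 1.
  rewrite ffunE /= eqxx /delta /= !ffunE eqxx /= gtn_eqF // h2 /tcell leqnSn.
  by rewrite subSnn.
rewrite /accepting r0 r1 /= h1 -hy.
by split=> [[_ a b]|/leading_bits_true[a b]]; [apply/leading_bits_true | split].
Qed.

End TapeDynamics.

Section Tableau.
Variables (M : tm) (T Y : nat) (x : seq bool).
Notation K1 := (tm_tapes M).+1.
Notation tsym := (option (bool + tm_aux M))%type.
Notation loc := (loc M).

(** A function on the finite set [loc] is a constant of the reduction; as a table it is computed by
    [pc_table]. *)
Definition tab (g : loc -> nat) : seq nat := map g (enum loc).
Definition dloc : loc := (tm_start M, [ffun=> None]).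
Definition lv (s : nat) : loc := nth dloc (enum loc) s.

Lemma tabE g s : s < #|loc| -> nth 0 (tab g) s = g (lv s).
Proof. by rewrite cardE => hs; rewrite (nth_map dloc). Qed.

Definition rs (q : tm_state M) : nat := enum_rank q.
Definition ra (a : tsym) : nat := enum_rank a.
Definition dn (d : direction) : nat :=
  match d with Stay => 0 | MoveL => 1 | MoveR => 2 end.
Definition mvn (d p : nat) : nat := if d == 1 then p.-1 else if d == 2 then p.+1 else p.

Lemma rs_inj : injective rs.
Proof. by move=> a b /ord_inj/enum_rank_inj. Qed.

Lemma ra_inj : injective ra.
Proof. by move=> a b /ord_inj/enum_rank_inj. Qed.

Lemma mvnE d p : mvn (dn d) p = mv d p.
Proof. by case: d. Qed.

Definition g_state (s : loc) := rs s.1.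
Definition g_halt (s : loc) : nat := tm_halt s.1.
Definition g_bit (s : loc) : nat := isbt (s.2 ord0).
Definition g_read i (s : loc) := ra (s.2 i).
Definition g_next fl (s : loc) := rs (delta fl s).1.
Definition g_write fl i (s : loc) := ra ((delta fl s).2 i).1.
Definition g_dir fl i (s : loc) := dn ((delta fl s).2 i).2.

(** Exceeds every field: positions are at most [2 T + 3], times and numbers of previous visits at
    most [T + 1]. *)
Definition tbase := T.*2 + Y + #|loc| + 5.
Definition tfields := K1.*2.+3.

(* A vertex stands for one time step: time, certificate length, control state
   with the scanned symbols, and for each tape the head position and one plus
   the time of the previous visit to that position (0 if there is none). *)
Definition ft u := dig tbase u 0.
Definition fy u := dig tbase u 1.
Definition fs u := dig tbase u 2.
Definition fp u i := dig tbase u i.*2.+3.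
Definition fl u i := dig tbase u i.*2.+4.

Definition look (g : bool -> loc -> nat) u : nat :=
  if ft u == T then nth 0 (tab (g true)) (fs u) else nth 0 (tab (g false)) (fs u).
Definition rd i u := nth 0 (tab (g_read i)) (fs u).

Definition pre_size := (size x).*2.+1.

(** The symbol found on a first visit. Only the length of the certificate is known, so each of its
    cells may show either bit; the fixed prefix of the input is [pair_str x [::]]. *)
Definition init_chk (i : 'I_K1) u : bool :=
  if (i == ord0) && (T.+2 <= fp u i) then
    if fp u i - T.+2 < pre_size then
      rd i u == (if nth false (pair_str x [::]) (fp u i - T.+2)
                 then ra (Some (inl true)) else ra (Some (inl false)))
    else if fp u i - T.+2 < pre_size + fy u then
      (rd i u == ra (Some (inl true))) || (rd i u == ra (Some (inl false)))
    else rd i u == ra None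
  else rd i u == ra None.

Definition tvalid u : bool :=
  [&& ft u <= T.+1, fy u <= Y, fs u < #|loc|,
      all (fun i : 'I_K1 => (fl u i <= ft u) && ((fl u i == 0) ==> init_chk i u)) (enum 'I_K1),
      (ft u == 0) ==> ((nth 0 (tab g_state) (fs u) == rs (tm_start M)) &&
        all (fun i : 'I_K1 => fp u i == T.+2) (enum 'I_K1)),
      (ft u == T) ==> ((nth 0 (tab g_halt) (fs u) == 1) && (rd ord0 u == ra (Some (inl true)))) &
      (ft u == T.+1) ==> (nth 0 (tab g_bit) (fs u) == 0)].

(** For [u] before [v]. The recorded previous visit is checked from both sides: the named step
    scanned the same cell and wrote the symbol that [v] reads, and every step between that one and
    [v] scanned another cell. *)
Definition tpair u v : bool :=
  [&& fy u == fy v,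
      (ft v == (ft u).+1) ==> ((nth 0 (tab g_state) (fs v) == look g_next u) &&
        all (fun i : 'I_K1 => fp v i == mvn (look (fun b => g_dir b i) u) (fp u i)) (enum 'I_K1)) &
      all (fun i : 'I_K1 =>
        ((fl v i == (ft u).+1) ==>
           ((fp u i == fp v i) && (rd i v == look (fun b => g_write b i) u))) &&
        ((fl v i < (ft u).+1) ==> (fp u i != fp v i))) (enum 'I_K1)].

Definition tcompat u v : bool :=
  [&& tvalid u, tvalid v, ft u != ft v & (ft u < ft v) ==> tpair u v].

Lemma lookE g u : fs u < #|loc| -> look g u = g (ft u == T) (lv (fs u)).
Proof. by move=> h; rewrite /look !tabE //; case: eqP. Qed.

Lemma acell0_pair y p : T.+2 <= p ->
  @acell0 M T (pair_str x y) ord0 p =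
    let a := p - T.+2 in
    if a < pre_size then Some (inl (nth false (pair_str x [::]) a))
    else if a < pre_size + size y then Some (inl (nth false y (a - pre_size)))
    else None.
Proof.
move=> hp; rewrite /acell0 eqxx hp /=; set a := p - _.
have e : size (pair_str x y) = pre_size + size y by rewrite size_pair_str.
case: (ltnP a (pre_size + size y)) => ha; last first.
  rewrite nth_default ?size_map ?e // ltnNge (leq_trans _ ha) // leq_addr //.
rewrite (nth_map false) ?e // !nth_pair_str -/pre_size.
case: (ltnP a pre_size) => ha'; last first.
  by rewrite ltnNge (ltnW ha') gtn_eqF.
case: ltnP => // h; have -> : a = (size x).*2 by rewrite /pre_size in ha'; lia.
by rewrite eqxx.
Qed.

Lemma tableau_sound (w : nat -> nat) :
  (forall t, t < T.+2 -> ft (w t) = t /\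
     forall t', t' < T.+2 -> t <> t' -> tcompat (w t) (w t')) ->
  exists2 y, size y <= Y & accepting M T (pair_str x y).
Proof.
move=> hw.
have wt t : t < T.+2 -> ft (w t) = t by move=> /hw[].
have vd t : t < T.+2 -> tvalid (w t).
  move=> tT; have [_ h] := hw t tT.
  case: (eqVneq t 0) => [t0|t0].
    have t1 : t <> 1 by rewrite t0.
    by have /and4P[] := h 1 isT t1.
  by have /and4P[] := h 0 isT (elimN eqP t0).
have pr t t' : t < t' -> t' < T.+2 -> tpair (w t) (w t').
  move=> tt tT; have tT' := ltn_trans tt tT; have [_ h] := hw t tT'.
  have ne : t <> t' by lia.
  have /and4P[_ _ _] := h t' tT ne; by rewrite !wt // tt.
pose s t := lv (fs (w t)).
have sv t : t < T.+2 -> fs (w t) < #|loc| by move=> /vd/and5P[].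
pose p t (i : 'I_K1) := fp (w t) i; pose L t (i : 'I_K1) := fl (w t) i.
pose l := fy (w 0).
have lE t : t < T.+2 -> fy (w t) = l.
  by case: t => // t tT; have /and3P[/eqP] := pr 0 t.+1 isT tT.
have lY : l <= Y by have /and5P[] := vd 0 isT.
have rdE i t : t < T.+2 -> rd i (w t) = ra ((s t).2 i) by move=> h; rewrite /rd tabE ?sv.
have P1 t : t < T.+1 -> (s t.+1).1 = (delta (t == T) (s t)).1 /\
    forall i, p t.+1 i = mv ((delta (t == T) (s t)).2 i).2 (p t i).
  move=> tT; have tT1 : t < T.+2 := ltnW tT.
  have /and3P[_ + _] := pr t t.+1 (leqnn _) tT; rewrite !wt // eqxx /=.
  rewrite tabE ?sv // lookE ?sv // wt // => /andP[/eqP/rs_inj -> /all_enum_ordP h].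
  by split=> // i; apply/eqP; have := h i; rewrite lookE ?sv // wt // mvnE.
have P23 t t' i : t < t' -> t' < T.+2 ->
    (L t' i = t.+1 -> p t i = p t' i /\ (s t').2 i = ((delta (t == T) (s t)).2 i).1) /\
    (L t' i < t.+1 -> p t i <> p t' i).
  move=> tt tT; have tT1 := ltn_trans tt tT.
  have /and3P[_ _ /all_enum_ordP/(_ i)] := pr t t' tt tT; rewrite !wt // -/(L t' i).
  case/andP=> /implyP h1 /implyP h2; split=> [e|/h2/eqP //].
  have /andP[/eqP e1] := h1 (introT eqP e).
  by rewrite rdE // lookE ?sv // wt // => /eqP/ra_inj.
have V12 t i : t < T.+2 -> L t i <= t /\ (L t i = 0 -> init_chk i (w t)).
  move=> tT; have /and5P[_ _ _ /all_enum_ordP/(_ i)/andP[h1 /implyP h2] _] := vd t tT.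
  by rewrite wt // in h1; split=> // e; apply: h2; apply/eqP.
(* The certificate is read off from the first visits to its cells; bits that are never scanned
   become [false]. *)
pose y := mkseq (fun a => has (fun t =>
  [&& L t ord0 == 0, p t ord0 == T.+2 + pre_size + a & (s t).2 ord0 == Some (inl true)])
  (iota 0 T.+2)) l.
exists y; first by rewrite size_mkseq.
set z := pair_str x y.
have initE i t : t < T.+2 -> L t i = 0 -> (s t).2 i = @acell0 M T z i (p t i).
  move=> tT L0; have [_ /(_ L0)] := V12 t i tT; rewrite /init_chk.
  case: (eqVneq i ord0) => [i0|i0] /=; last first.
    by rewrite rdE // /acell0 (negbTE i0) /= => /eqP/ra_inj.
  rewrite i0 in L0 *; rewrite -/(p t ord0) rdE // lE //.
  case: (leqP T.+2 (p t ord0)) => hp; last by rewrite /acell0 (leqNgt T.+2) hp andbF => /eqP/ra_inj.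
  rewrite acell0_pair //= size_mkseq; case: ltnP => ha.
    by case: (nth _ _ _) => /eqP/ra_inj.
  case: ltnP => hb; last by move/eqP/ra_inj.
  have hal : p t ord0 - T.+2 - pre_size < l by lia.
  rewrite nth_mkseq //.
  have -> : T.+2 + pre_size + (p t ord0 - T.+2 - pre_size) = p t ord0 by lia.
  case/orP=> /eqP/ra_inj e; rewrite e; congr (Some (inl _)); symmetry; first last.
    (* Two different steps cannot both be first visits to one cell, so no other step sets this
       bit. *)
    apply/has_iotaP => -[t' tT' /and3P[/eqP L0' /eqP ep /eqP e']].
    case: (ltngtP t t') => tt.
    - by have [_ /(_ _)] := P23 t t' ord0 tt tT'; rewrite L0' => /(_ isT); rewrite ep.
    - by have [_ /(_ _)] := P23 t' t ord0 tt tT; rewrite L0 => /(_ isT); rewrite ep.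
    - by rewrite tt e' in e.
  by apply/has_iotaP; exists t; rewrite // L0 e !eqxx.
(* By strong induction the vertices follow the actual run: the symbol read at time [t] is the
   initial one, or it was written at the recorded time and not changed since. *)
have inv t : t < T.+2 -> [/\ aloc (arun M T z t) = s t & forall i, apos (arun M T z t) i = p t i].
  elim/ltn_ind: t => t IH tT.
  have [hst hp] : astate (arun M T z t) = (s t).1 /\ forall i, apos (arun M T z t) i = p t i.
    case: t IH tT => [_ _|t IH tT].
      have /and5P[_ _ _ _ /and3P[/implyP h _ _]] := vd 0 isT.
      have /andP[] := h (introT eqP (wt 0 isT)); rewrite tabE ?sv // => /eqP/rs_inj e /all_enum_ordP hp.
      by split=> [|i]; [rewrite /s e | rewrite /p (eqP (hp i))].
    have [e1 e2] := IH t (leqnn _) (ltnW tT); have [h1 h2] := P1 t tT.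
    by split=> [|i]; rewrite /= e1 ?h1 // h2 e2.
  split=> //; rewrite /aloc hst [RHS]surjective_pairing; congr pair.
  apply/ffunP => i; rewrite ffunE hp; have [Lt _] := V12 t i tT.
  case E: (L t i) => [|j].
    rewrite (initE i) // (@acell_kept _ _ _ 0 t) // => j /andP[_ jt].
    have [_ ->] := IH j jt (ltn_trans jt tT).
    by have [_] := P23 j t i jt tT; rewrite E; apply.
  have jt : j < t by rewrite -E.
  have jT := ltn_trans jt tT; have [e1 e2] := IH j jt jT.
  have [/(_ E)[hpj hsj] _] := P23 j t i jt tT.
  rewrite (@acell_kept _ _ _ j.+1 t) // => [|j' /andP[jj jt']]; last first.
    have [_ ->] := IH j' jt' (ltn_trans jt' tT).
    by have [_] := P23 j' t i jt' tT; rewrite E; apply.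
  by rewrite -hpj -e2 acell_written e1 hsj.
have T2 : T < T.+2 by [].
have [eT _] := inv T T2; have [eT1 _] := inv T.+1 (leqnn _).
have /and5P[_ _ _ _ /and3P[_ /implyP hT _]] := vd T T2.
have /and5P[_ _ _ _ /and3P[_ _ /implyP hT1]] := vd T.+1 (leqnn _).
have /andP[] := hT (introT eqP (wt T T2)); rewrite tabE ?sv // rdE // => hh /eqP/ra_inj hr.
have := hT1 (introT eqP (wt T.+1 (leqnn _))); rewrite tabE ?sv // => hb.
rewrite /accepting eT eT1 -/(s T) -/(s T.+1) in hh hr hb *; split=> //.
  by move: hh; rewrite /g_halt; case: tm_halt.
by move: hb; rewrite /g_bit; case: isbt.
Qed.

Section Complete.
Variable y : seq bool.
Hypothesis yY : size y <= Y.
Let z := pair_str x y.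
Notation ar := (arun M T z).
Hypothesis acc : accepting M T z.

Definition lst t (i : 'I_K1) : nat :=
  \max_(j < t | apos (ar j) i == apos (ar t) i) j.+1.

Lemma lst_le t i : lst t i <= t.
Proof. by apply/bigmax_leqP => j _; apply: ltn_ord. Qed.

Lemma lst_lt t i j : j < t -> lst t i < j.+1 -> apos (ar j) i <> apos (ar t) i.
Proof.
move=> jt h e; have := @leq_bigmax_cond _ (fun j : 'I_t => apos (ar j) i == apos (ar t) i)
  (fun j : 'I_t => j.+1) (Ordinal jt); rewrite -/(lst t i) /= e eqxx => /(_ isT).
by rewrite leqNgt h.
Qed.

Lemma lst_eq t i j : lst t i = j.+1 -> j < t /\ apos (ar j) i = apos (ar t) i.
Proof.
suff [-> //|[k ek ->]] : lst t i = 0 \/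
    exists2 k : 'I_t, apos (ar k) i == apos (ar t) i & lst t i = k.+1.
  by move=> [<-]; rewrite (eqP ek).
rewrite /lst; elim/big_ind: _ => [|m n hm hn|k hk]; first by left.
  by case: (leqP m n).
by right; exists k.
Qed.

Definition fld t i : nat :=
  match i with
  | 0 => t
  | 1 => size y
  | 2 => enum_rank (aloc (ar t))
  | i'.+3 => if odd i' then lst t (inord i'./2) else apos (ar t) (inord i'./2)
  end.

Lemma fld_lt t i : t < T.+2 -> fld t i < tbase.
Proof.
move=> tT; rewrite /tbase; case: i => [|[|[|i]]] /=; try lia.
  by apply: leq_trans (ltn_ord (enum_rank _)) _; rewrite -addnA addnC -addnA leq_addr.
case: odd; first by have := lst_le t (inord i./2); lia.
by have [_] := @apos_bounds M T z t (inord i./2); lia.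
Qed.

Definition vert t := undig tbase tfields (fld t).

Lemma vert_lt t : t < T.+2 -> vert t < tbase ^ tfields.
Proof. by move=> tT; apply: undig_lt => i _; apply: fld_lt. Qed.

Lemma vertE t i : t < T.+2 -> i < tfields -> dig tbase (vert t) i = fld t i.
Proof. by move=> tT hi; apply: dig_undig => // j _; apply: fld_lt. Qed.

Lemma vert_ft t : t < T.+2 -> ft (vert t) = t.
Proof. by move=> tT; rewrite /ft vertE. Qed.

Lemma vert_fy t : t < T.+2 -> fy (vert t) = size y.
Proof. by move=> tT; rewrite /fy vertE. Qed.

Lemma vert_fs t : t < T.+2 -> fs (vert t) < #|loc| /\ lv (fs (vert t)) = aloc (ar t).
Proof.
move=> tT; rewrite /fs vertE //=; split; first exact: (ltn_ord (enum_rank _)).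
by rewrite /lv nth_enum_rank.
Qed.

Lemma vert_fp t (i : 'I_K1) : t < T.+2 -> fp (vert t) i = apos (ar t) i.
Proof.
move=> tT; rewrite /fp vertE //; last by rewrite /tfields; have := ltn_ord i; lia.
by rewrite /= odd_double doubleK inord_val.
Qed.

Lemma vert_fl t (i : 'I_K1) : t < T.+2 -> fl (vert t) i = lst t i.
Proof.
move=> tT; rewrite /fl vertE //; last by rewrite /tfields; have := ltn_ord i; lia.
by rewrite /= odd_double /= uphalf_double inord_val.
Qed.

Lemma vert_tab g t : t < T.+2 -> nth 0 (tab g) (fs (vert t)) = g (aloc (ar t)).
Proof. by move=> /vert_fs[h1 h2]; rewrite tabE // h2. Qed.

Lemma vert_look g t : t < T.+2 -> look g (vert t) = g (t == T) (aloc (ar t)).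
Proof. by move=> tT; have [h1 h2] := vert_fs tT; rewrite lookE // h2 vert_ft. Qed.

Lemma vert_read t i : t < T.+2 -> (aloc (ar t)).2 i = acell (ar t) i (apos (ar t) i).
Proof. by rewrite ffunE. Qed.

Lemma vert_valid t : t < T.+2 -> tvalid (vert t).
Proof.
move=> tT; have [h1 _] := vert_fs tT; have [a1 a2 a3] := acc.
apply/and5P; split; rewrite ?vert_ft ?vert_fy //.
  apply/all_enum_ordP => i; rewrite vert_fl // lst_le /=; apply/implyP => /eqP L0.
  have e : (aloc (ar t)).2 i = @acell0 M T z i (apos (ar t) i).
    rewrite vert_read // (@acell_kept _ _ _ 0 t) // => j /andP[_ jt].
    by apply: lst_lt; rewrite ?L0.
  rewrite /init_chk /rd vert_tab // /g_read e vert_fp // vert_fy //.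
  case: (eqVneq i ord0) => [->|i0] /=; last by rewrite /acell0 (negbTE i0).
  case: (leqP T.+2 (apos (ar t) ord0)) => hp; last by rewrite /acell0 (leqNgt T.+2) hp andbF.
  rewrite acell0_pair //=; case: ltnP => ha; first by case: nth.
  by case: ltnP => // hb; case: nth; rewrite eqxx ?orbT.
apply/and3P; split; apply/implyP => /eqP e.
- rewrite vert_tab // e eqxx; apply/all_enum_ordP => i.
  by rewrite -e vert_fp // e.
- by rewrite /rd !vert_tab // e /g_halt a1 /g_read a2 eqxx.
- by rewrite vert_tab // e /g_bit (negbTE a3).
Qed.

Lemma vert_compat t t' : t < T.+2 -> t' < T.+2 -> t <> t' -> tcompat (vert t) (vert t').
Proof.
move=> tT tT' ne; apply/and4P; split; rewrite ?vert_valid ?vert_ft //; first exact/eqP.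
apply/implyP => tt; apply/and3P; split; rewrite ?vert_fy ?vert_ft //.
  apply/implyP => /eqP e; rewrite vert_tab // vert_look // e /g_state /g_next /= eqxx.
  apply/all_enum_ordP => i; rewrite -e vert_fp // e vert_look // vert_fp //.
  by rewrite /g_dir mvnE.
apply/all_enum_ordP => i; rewrite vert_fl // !vert_fp //; apply/andP; split; apply/implyP.
  move/eqP=> /[dup] h /lst_eq[_ ep]; rewrite ep eqxx /rd vert_tab // vert_look //.
  rewrite /g_read /g_write vert_read // (@acell_kept _ _ _ t.+1 t') //.
    by rewrite -ep acell_written eqxx.
  move=> j /andP[tj jt]; apply: lst_lt => //; by rewrite h.
by move=> h; apply/eqP; apply: lst_lt.
Qed.

End Complete.

Lemma tableau_clique : clique (tbase ^ tfields) T.+2 tcompat <->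
  exists2 y, size y <= Y & accepting M T (pair_str x y).
Proof.
have hidx u v : tcompat u v -> ft u < T.+2 /\ ft u <> ft v.
  by case/and4P=> /and5P[h _ _ _ _] _ /eqP ne _.
have -> := @csp_clique (tbase ^ tfields) T.+2 tcompat ft isT hidx.
split=> [[w hw]|[y yY acc]].
  by apply: (@tableau_sound w) => t /hw[_ h1 h2].
exists (vert y) => t tT; split; [exact: vert_lt | exact: vert_ft | ].
by move=> t' tT'; apply: vert_compat.
Qed.

End Tableau.

Lemma pcb_all_const (I : Type) (l : seq I) (P : ctx -> I -> bool) :
  (forall i, pcb (fun c => P c i)) -> pcb (fun c => all (P c) l).
Proof.
by move=> h; elim: l => [|i l IH]; [apply: pcb_const | apply: pcb_and].
Qed.

Ltac pc_user ::= lazymatch goal with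
  | |- pc (fun c => dig (@?B c) (@?F c) ?i) => apply (@pc_dig B F i)
  | |- pcb (fun c => all (@?P c) ?l) => apply (@pcb_all_const _ l P); intro
  end.

Lemma pcb_tcompat M T Y S F F' : pc T -> pc Y -> ps S -> pc F -> pc F' ->
  pcb (fun c => tcompat M (T c) (Y c) (S c) (F c) (F' c)).
Proof.
move=> hT hY hS hF hF'.
have hnil : ps (fun _ : ctx => [::]).
  by split; [apply: pc_const | apply: pc_ext (pcb_const false) => c; rewrite nth_nil].
have hB : pc (fun c => tbase M (T c) (Y c)) by rewrite /tbase; pc_tac.
have ht G : pc G -> pc (fun c => ft M (T c) (Y c) (G c)) by move=> hG; apply: pc_dig.
have hy G : pc G -> pc (fun c => fy M (T c) (Y c) (G c)) by move=> hG; apply: pc_dig.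
have hs G : pc G -> pc (fun c => fs M (T c) (Y c) (G c)) by move=> hG; apply: pc_dig.
have hp G i : pc G -> pc (fun c => fp M (T c) (Y c) (G c) i) by move=> hG; apply: pc_dig.
have hl G i : pc G -> pc (fun c => fl M (T c) (Y c) (G c) i) by move=> hG; apply: pc_dig.
have hrd G i : pc G -> pc (fun c => @rd M (T c) (Y c) i (G c)).
  by move=> hG; apply: pc_table; apply: hs.
have hk G (g : bool -> loc M -> nat) : pc G -> pc (fun c => look (T c) (Y c) g (G c)).
  by move=> hG; rewrite /look; repeat first [apply: ht | apply: hs | progress pc_tac].
have hpre : pc (fun c => pre_size (S c)) by rewrite /pre_size; pc_tac.
have hv G : pc G -> pcb (fun c => tvalid M (T c) (Y c) (S c) (G c)).
  move=> hG; rewrite /tvalid /init_chk.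
  by repeat first [apply: ht | apply: hy | apply: hs | apply: hp | apply: hl
    | apply: hrd | progress pc_tac].
rewrite /tcompat /tpair /mvn.
by repeat first [apply: hv | apply: ht | apply: hy | apply: hs | apply: hp | apply: hl
  | apply: hrd | apply: hk | progress pc_tac].
Qed.

Theorem identification_NP_hard H : sparse_class H -> NP_hard (Identification H).
Proof.
move=> hH L [V [c0 [[M [c1 hM]] hL]]].
pose Y (x : seq bool) := c0 * (size x).+1 ^ c0.
(* Bounds the running time of the verifier on [pair_str x y] for every certificate [y] of length at
   most [Y x]. *)
pose T (x : seq bool) := c1 * ((size x).*2.+1 + Y x).+1 ^ c1.
pose C x := tcompat M (T x) (Y x) x.
pose N x := tbase M (T x) (Y x) ^ tfields M.
have hY S : ps S -> pc (fun c => Y (S c)) by move=> hS; rewrite /Y; pc_tac.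
have hT S : ps S -> pc (fun c => T (S c)).
  by move=> hS; have := hY _ hS => h; rewrite /T; pc_tac.
exists (fun x => clique_str (N x) (T x).+2 (C x)); split.
  apply: (ps_polytime (S := fun c => clique_str (N c.1) (T c.1).+2 (C c.1))).
  apply: (@ps_clique_str N (fun x => (T x).+2) C) ps_input => [S hS|S hS|S F F' hS hF hF'].
  - have h1 := hY _ hS; have h2 := hT _ hS; rewrite /N /tbase; pc_tac.
  - have h2 := hT _ hS; pc_tac.
  - by apply: pcb_tcompat => //; [apply: hT | apply: hY].
move=> x; have qN : (T x).+2 <= N x.
  rewrite /N /tfields expnS; apply: leq_trans (leq_pmulr _ _); first by rewrite /tbase; lia.
  by rewrite expn_gt0 /tbase addnS.
rewrite (ident_clique_str hH _ qN) tableau_clique hL.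
have hacc y : size y <= Y x -> accepting M (T x) (pair_str x y) <-> V (pair_str x y) = [:: true].
  move=> hy; apply: acceptingP (hM _) _; rewrite /T leq_mul2l; apply/orP; right.
  by apply: leq_expl; rewrite size_pair_str ltnS leq_add2l.
by split=> [[y [h1 h2]]|[y h1 h2]]; exists y; rewrite ?hacc // -?hacc.
Qed.

(** * Circuits *)

Section CircuitParser.
Variable x : seq bool.

Definition run (p : nat) : nat := find (fun i => ~~ nth false x (p + i)) (iota 0 (size x)).
(** The cap [(size x).+1] keeps iterations bounded, and a value beyond [size x] signals a number
    without end mark. *)
Definition nx (p : nat) : nat := minn (p + run p).+1 (size x).+1.
Definition gend (p : nat) : nat :=
  if nth false x p then iter (run p.+2).+1 nx (minn p.+2 (size x).+1)
  else if nth false x p.+1 then nx (minn p.+2 (size x).+1) else minn p.+2 (size x).+1.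
Definition gst (j : nat) : nat := iter j gend (nx 0).
Definition kd (j : nat) : nat :=
  (nth false x (gst j)).*2 + nth false x (gst j).+1.
Definition na (j : nat) : nat :=
  if nth false x (gst j) then run (gst j).+2 else nth false x (gst j).+1.
Definition ag (j i : nat) : nat :=
  if nth false x (gst j) then run (iter i.+1 nx (gst j).+2) else run (gst j).+2.

Definition gate_at (p : nat) : gate :=
  if nth false x p then
    let s := mkseq (fun i => run (iter i.+1 nx p.+2)) (run p.+2) in
    if nth false x p.+1 then Or s else And s
  else if nth false x p.+1 then Not (run p.+2) else Input.

Definition circ : circuit := mkseq (fun j => gate_at (gst j)) (run 0).
Definition parse_ok : bool := gst (run 0) == size x.

Lemma run_true p i : i < run p -> nth false x (p + i).
Proof.
move=> hi; have := before_find 0 hi; rewrite nth_iota.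
  by move/negbT; rewrite negbK.
by apply: leq_trans hi _; rewrite /run (leq_trans (find_size _ _)) ?size_iota.
Qed.

Lemma run_end p : p + run p < size x -> nth false x (p + run p) = false.
Proof.
move=> h; have hh : has (fun i => ~~ nth false x (p + i)) (iota 0 (size x)).
  by rewrite has_find size_iota -/(run p); lia.
have := nth_find 0 hh; rewrite -/(run p) nth_iota; first by move/negbTE.
by lia.
Qed.

Lemma take_nx p : nx p <= size x ->
  p < nx p /\ take (nx p) x = take p x ++ unary_str (run p).
Proof.
move=> h; have e : nx p = (p + run p).+1 by rewrite /nx in h *; lia.
rewrite e in h *; split; first lia.
rewrite (take_nth false) // run_end // /unary_str -rcons_cat; congr rcons.
rewrite takeD; congr cat; apply: (@eq_from_nth _ false).
  by rewrite size_takel ?size_nseq // size_drop; lia.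
move=> i; rewrite size_takel ?size_drop; last lia.
by move=> hi; rewrite nth_take // nth_drop run_true // nth_nseq hi.
Qed.

Lemma take_iter_nx q i : iter i nx q <= size x ->
  q <= iter i nx q /\ take (iter i nx q) x =
    take q x ++ flatten [seq unary_str (run (iter k nx q)) | k <- iota 0 i].
Proof.
elim: i => [|i IH]; first by rewrite cats0.
rewrite iterS => /[dup] h /take_nx[lt ->].
have [le ->] := IH (leq_trans (ltnW lt) h); split; first exact: leq_trans le (ltnW lt).
by rewrite -addn1 iotaD map_cat flatten_cat /= add0n cats0 catA.
Qed.

Lemma take2 p : p.+2 <= size x ->
  take p.+2 x = take p x ++ [:: nth false x p; nth false x p.+1].
Proof. by move=> h; rewrite !(take_nth false) ?(ltnW h) // -!cats1 -catA. Qed.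

Lemma take_gend p : gend p <= size x ->
  p < gend p /\ take (gend p) x = take p x ++ gate_str (gate_at p).
Proof.
rewrite /gend /gate_at; case e0: (nth false x p).
  move=> h; have [le] := take_iter_nx h; move: h; set q := minn _ _ in le *.
  have q2 : iter (run p.+2).+1 nx q <= size x -> q = p.+2 by move=> /(leq_trans le); rewrite /q; lia.
  move=> h; have e2 := q2 h; rewrite e2 in le h *; move=> ->; split; first exact: leq_trans le.
  have p2 := leq_trans le h; rewrite take2 // -catA; congr cat; rewrite e0.
  rewrite /= -[1]addn0 iotaDl -map_comp.
  by case: (nth _ _ _); rewrite /= /list_str size_mkseq /mkseq -map_comp.
case e1: (nth false x p.+1).
  move=> h; have [lt] := take_nx h; move: h; set q := minn _ _ in lt *.
  have q2 : nx q <= size x -> q = p.+2 by move=> /(leq_trans (ltnW lt)); rewrite /q; lia.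
  move=> h; have e2 := q2 h; rewrite e2 in lt h *; move=> ->; split; first exact: ltn_trans lt.
  by have p2 := leq_trans (ltnW lt) h; rewrite take2 // -catA e0 e1.
move=> h; have q2 : minn p.+2 (size x).+1 = p.+2 by lia.
by rewrite q2 in h *; rewrite take2 // e0 e1.
Qed.

(** Positions increase during parsing, so ending at [size x] excludes an earlier overrun, and each
    consumed prefix is the encoding of what has been read. *)
Lemma parse_sound : parse_ok -> x = circuit_str circ.
Proof.
move=> /eqP h.
have take_gst j : gst j <= size x ->
    take (gst j) x = unary_str (run 0) ++ flatten [seq gate_str (gate_at (gst i)) | i <- iota 0 j].
  elim: j => [|j IH]; first by rewrite cats0 => /take_nx[_ ->]; rewrite take0.
  rewrite /gst iterS => /[dup] hg /take_gend[lt ->].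
  rewrite IH; last exact: leq_trans (ltnW lt) hg.
  by rewrite -addn1 iotaD map_cat flatten_cat /= add0n cats0 catA.
by rewrite -{1}[x]take_size -h take_gst ?h // /circuit_str size_mkseq /circ /mkseq -map_comp.
Qed.

Lemma drop_nx p m r : p <= size x -> drop p x = unary_str m ++ r ->
  [/\ run p = m, nx p <= size x & drop (nx p) x = r].
Proof.
move=> hp e.
have hn i : nth false x (p + i) = nth false (unary_str m ++ r) i by rewrite -e nth_drop.
have sz : size x - p = m.+1 + size r.
  by rewrite -size_drop e size_cat size_rcons size_nseq.
have er : run p = m.
  apply: find_iota; first lia.
    by rewrite hn nth_cat size_rcons size_nseq leqnn nth_rcons size_nseq ltnn eqxx.
  move=> i im; rewrite negbK hn nth_cat size_rcons size_nseq ltnS (ltnW im).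
  by rewrite nth_rcons size_nseq im nth_nseq im.
have en : nx p = m.+1 + p by rewrite /nx er; lia.
split=> //; first by rewrite en; lia.
by rewrite en -drop_drop e drop_size_cat // size_rcons size_nseq.
Qed.

Lemma drop_iter_nx s q r : q <= size x -> drop q x = flatten (map unary_str s) ++ r ->
  [/\ mkseq (fun i => run (iter i nx q)) (size s) = s, iter (size s) nx q <= size x &
      drop (iter (size s) nx q) x = r].
Proof.
elim: s q => [|m s IH] q hq //=; rewrite -catA => /(drop_nx hq)[h1 h2 h3].
have [e1 e2 e3] := IH _ h2 h3; rewrite -iterS iterSr; split=> //.
rewrite /mkseq /= h1 -[1]addn0 iotaDl -map_comp; congr (_ :: _).
rewrite -[RHS]e1 /mkseq; apply: eq_map => i /=.
by rewrite -iterS iterSr.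
Qed.

Lemma drop_gend p g r : p <= size x -> drop p x = gate_str g ++ r ->
  [/\ gate_at p = g, gend p <= size x & drop (gend p) x = r].
Proof.
move=> hp e.
have hn i : nth false x (p + i) = nth false (gate_str g ++ r) i by rewrite -e nth_drop.
have := hn 0; have := hn 1; rewrite addn0 addn1 => b1 b0.
have sg : 2 <= size (gate_str g) by case: (g).
have p2 : p.+2 <= size x.
  have : size (drop p x) = size (gate_str g) + size r by rewrite e size_cat.
  by rewrite size_drop; lia.
have d2 : drop p.+2 x = drop 2 (gate_str g) ++ r.
  by rewrite -add2n -drop_drop e; case: (g) => [|i|s|s] /=; rewrite ?drop0.
have m2 : minn p.+2 (size x).+1 = p.+2 by lia.
rewrite /gate_at /gend m2 b0 b1; case: g d2 {e hn b0 b1 sg} => [|i|s|s] /= d2.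
- by [].
- rewrite ?drop0 in d2; by have [-> h2 h3] := drop_nx p2 d2.
- rewrite ?drop0 /list_str -catA in d2; have [h1 h2 h3] := drop_nx p2 d2.
  have [e1 e2 e3] := drop_iter_nx h2 h3.
  rewrite h1 -iterS iterSr; split=> //; congr And; rewrite -[RHS]e1.
  by apply: eq_map => i; rewrite -iterSr.
- rewrite ?drop0 /list_str -catA in d2; have [h1 h2 h3] := drop_nx p2 d2.
  have [e1 e2 e3] := drop_iter_nx h2 h3.
  rewrite h1 -iterS iterSr; split=> //; congr Or; rewrite -[RHS]e1.
  by apply: eq_map => i; rewrite -iterSr.
Qed.

Lemma parse_complete C : x = circuit_str C -> parse_ok /\ circ = C.
Proof.
move=> e; have [|h1 h2 h3] := @drop_nx 0 (size C) (flatten (map gate_str C)) (leq0n _).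
  by rewrite drop0.
have h j : j <= size C ->
    gst j <= size x /\ drop (gst j) x = flatten (map gate_str (drop j C)).
  elim: j => [|j IH] jC; first by rewrite drop0.
  have [g1] := IH (ltnW jC); rewrite (drop_nth Input jC) /= => g2.
  by have [_ g3 g4] := drop_gend g1 g2.
have hg j : j < size C -> gate_at (gst j) = nth Input C j.
  move=> jC; have [g1] := h j (ltnW jC); rewrite (drop_nth Input jC) /= => g2.
  by have [] := drop_gend g1 g2.
split.
  have [g1 g2] := h _ (leqnn _); rewrite drop_size /= in g2.
  rewrite /parse_ok h1 eqn_leq g1 /=; have := size_drop (gst (size C)) x.
  by rewrite g2 /=; lia.
apply: (@eq_from_nth _ Input); rewrite size_mkseq h1 // => j hj.
by rewrite nth_mkseq ?h1 // hg.
Qed.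

Lemma circ_kd j : j < size circ ->
  kd j = match nth Input circ j with Input => 0 | Not _ => 1 | And _ => 2 | Or _ => 3 end.
Proof.
rewrite size_mkseq => hj; rewrite nth_mkseq // /kd /gate_at.
by case: (nth false x (gst j)); case: (nth _ _ _).
Qed.

Lemma circ_args j : j < size circ -> gate_args (nth Input circ j) = mkseq (ag j) (na j).
Proof.
rewrite size_mkseq => hj; rewrite nth_mkseq // /na /ag /gate_at.
by case: (nth false x (gst j)); case: (nth _ _ _).
Qed.

End CircuitParser.

Lemma pc_run S F : ps S -> pc F -> pc (fun c => run (S c) (F c)).
Proof. by move=> hS hF; rewrite /run; pc_tac. Qed.

Lemma pc_iter_nx S F N : ps S -> pc F -> pc N -> pc (fun c => iter (N c) (nx (S c)) (F c)).
Proof.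
move=> hS hF hN.
apply: (pc_iter (f := fun c => nx (S c))
  (B := fun c => F c + (size (S c)).+1)) => //.
- by apply: pc_pbd; pc_tac.
- apply: pc_min; last by pc_tac.
  apply: pc_S; apply: pc_add pc_top _; apply: pc_run; by pc_tac.
- by move=> c [|i] _; rewrite ?iterS /= ?leq_addr // /nx geq_min (leq_addl (F c)) orbT.
Qed.

Lemma pc_gst S F : ps S -> pc F -> pc (fun c => gst (S c) (F c)).
Proof.
move=> hS hF.
have hr := @pc_run; have hi := @pc_iter_nx.
have hS' : ps (fun c => S (pop c)) := ps_cm (cm_pop cm_id) hS.
have nx1 S' G : ps S' -> pc G -> pc (fun c => nx (S' c) (G c)).
  by move=> hS1 hG; apply: (pc_iter_nx (N := fun=> 1)) => //; apply: pc_const.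
apply: (pc_iter (f := fun c => gend (S c)) (a := fun c => nx (S c) 0)
  (B := fun c => (size (S c)).+1)) => //.
- by apply: nx1 => //; apply: pc_0.
- by apply: pc_pbd; pc_tac.
- rewrite /gend.
  by repeat first [progress pc_tac | apply: pc_iter_nx | apply: nx1 | apply: pc_run].
- move=> c i _; case: i => [|i]; first by rewrite /= /nx geq_minr.
  rewrite iterS /gend; case: ifP => _; first by rewrite iterS /nx geq_minr.
  by case: ifP => _; rewrite ?/nx geq_minr.
Qed.

Ltac pc_user ::= lazymatch goal with
  | |- pc (fun c => gst (@?S c) (@?F c)) => apply (@pc_gst S F)
  | |- pc (fun c => run (@?S c) (@?F c)) => apply (@pc_run S F)
  | |- pc (fun c => iter (@?N c) (nx (@?S c)) (@?F c)) => apply (@pc_iter_nx S F N)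
  end.

Lemma pc_kd S F : ps S -> pc F -> pc (fun c => kd (S c) (F c)).
Proof. by move=> hS hF; rewrite /kd; pc_tac. Qed.

Lemma pc_na S F : ps S -> pc F -> pc (fun c => na (S c) (F c)).
Proof. by move=> hS hF; rewrite /na; pc_tac. Qed.

Lemma pc_ag S F F' : ps S -> pc F -> pc F' -> pc (fun c => ag (S c) (F c) (F' c)).
Proof. by move=> hS hF hF'; rewrite /ag; pc_tac. Qed.

(** * Values, depth and weft by recursion over the nodes *)

Section NodeValues.
Variables (T : Type) (h : seq T -> gate -> T) (x0 : T).

Lemma node_values_rcons C g :
  node_values h (rcons C g) = rcons (node_values h C) (h (node_values h C) g).
Proof. by rewrite /node_values -cats1 foldl_cat. Qed.

Lemma size_node_values C : size (node_values h C) = size C.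
Proof. by elim/last_ind: C => // C g IH; rewrite node_values_rcons !size_rcons IH. Qed.

Lemma nth_node_values C j : j < size C ->
  nth x0 (node_values h C) j = h (take j (node_values h C)) (nth Input C j).
Proof.
elim/last_ind: C => // C g IH; rewrite size_rcons node_values_rcons ltnS leq_eqVlt.
rewrite !nth_rcons size_node_values.
case: (ltngtP j (size C)) => // [jC _|-> _].
  by rewrite IH // -cats1 take_cat size_node_values jC.
by rewrite -cats1 take_cat size_node_values ltnn subnn take0 cats0.
Qed.

End NodeValues.

Section CircuitSemantics.
Variables (C : circuit) (a : nat -> bool).
Hypothesis wf : circuit_wf C.

Definition cval (j : nat) : bool :=
  nth false (node_values (fun vs g => match g with
    | Input => a (size vs)
    | Not i => ~~ nth false vs i
    | And s => all (nth false vs) s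
    | Or s => has (nth false vs) s
    end) C) j.

Definition cdep (j : nat) : nat :=
  nth 0 (node_values (fun ds g =>
    if is_input g then 0 else (\max_(i <- gate_args g) nth 0 ds i).+1) C) j.

Definition cwft (j : nat) : nat :=
  nth 0 (node_values (fun ws g =>
    \max_(i <- gate_args g) nth 0 ws i + (2 < size (gate_args g))) C) j.

Lemma arg_lt j i : j < size C -> i \in gate_args (nth Input C j) -> i < j.
Proof. by move=> jC; apply: (allP (wf jC)). Qed.

Lemma cvalE j : j < size C -> cval j = match nth Input C j with
  | Input => a j | Not i => ~~ cval i | And s => all cval s | Or s => has cval s end.
Proof.
move=> jC; have hj := arg_lt jC; rewrite /cval nth_node_values //.
case: (nth Input C j) hj => [|i|s|s] /= hj.
- by rewrite size_takel // size_node_values ltnW.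
- by rewrite nth_take // hj ?inE.
- by apply: eq_in_all => i /hj ij; rewrite nth_take.
- by apply: eq_in_has => i /hj ij; rewrite nth_take.
Qed.

Lemma cdepE j : j < size C -> cdep j = if is_input (nth Input C j) then 0
  else (\max_(i <- gate_args (nth Input C j)) cdep i).+1.
Proof.
move=> jC; have hj := arg_lt jC; rewrite /cdep nth_node_values //.
case: is_input => //; congr S; apply: eq_big_seq => i /hj ij; by rewrite nth_take.
Qed.

Lemma cwftE j : j < size C -> cwft j =
  \max_(i <- gate_args (nth Input C j)) cwft i + (2 < size (gate_args (nth Input C j))).
Proof.
move=> jC; have hj := arg_lt jC; rewrite /cwft nth_node_values //.
congr addn; apply: eq_big_seq => i /hj ij; by rewrite nth_take.
Qed.

End CircuitSemantics.

(** * Checks of bounded depth, partial evaluation and proof trees *)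

Section CircuitChecks.
Variable x : seq bool.

(** Here and below, the recursion is on a depth bound that is a constant of the reduction, so each
    check unfolds into a fixed expression with bounded quantifiers. The weft checks [w0] and [w1]
    are exact for nodes of depth at most [D]. *)
Fixpoint dle (D j : nat) : bool :=
  (kd x j == 0) ||
  (if D is D'.+1 then all (fun i => dle D' (ag x j i)) (iota 0 (na x j)) else false).

Fixpoint w0 (D j : nat) : bool :=
  (na x j <= 2) &&
  (if D is D'.+1 then all (fun i => w0 D' (ag x j i)) (iota 0 (na x j)) else true).

Fixpoint w1 (D j : nat) : bool :=
  if D is D'.+1 then
    if na x j <= 2 then all (fun i => w1 D' (ag x j i)) (iota 0 (na x j))
    else all (fun i => w0 D' (ag x j i)) (iota 0 (na x j))
  else true.

(* Three-valued evaluation: [ev dc mb D b j] says that node [j] has value [b]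
   whatever the inputs outside [dc] are, where [mb] gives the values on [dc]. *)
Fixpoint ev (dc mb : nat -> bool) (D : nat) (b : bool) (j : nat) : bool :=
  if kd x j == 0 then dc j && (mb j == b)
  else if D is D'.+1 then
    if kd x j == 1 then ev dc mb D' (~~ b) (ag x j 0)
    else if (kd x j == 2) == b then
      all (fun i => ev dc mb D' b (ag x j i)) (iota 0 (na x j))
    else has (fun i => ev dc mb D' b (ag x j i)) (iota 0 (na x j))
  else false.

Fixpoint ins (D j : nat) : seq nat :=
  if kd x j == 0 then [:: j]
  else if D is D'.+1 then flatten [seq ins D' (ag x j i) | i <- iota 0 (na x j)]
  else [::].

Definition okc (d : nat) : bool :=
  [&& parse_ok x, 0 < run x 0,
      all (fun j => all (fun i => ag x j i < j) (iota 0 (na x j))) (iota 0 (run x 0)),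
      dle d (run x 0).-1 & w1 d (run x 0).-1].

Notation C := (circ x).
Notation n := (run x 0).
Hypothesis wf : circuit_wf C.

Lemma size_circ : size C = n.
Proof. by rewrite size_mkseq. Qed.

Lemma kdP j : j < n ->
  kd x j = match nth Input C j with Input => 0 | Not _ => 1 | And _ => 2 | Or _ => 3 end.
Proof. by rewrite -size_circ; apply: circ_kd. Qed.

Lemma argsP j : j < n -> gate_args (nth Input C j) = mkseq (ag x j) (na x j).
Proof. by rewrite -size_circ; apply: circ_args. Qed.

Lemma all_args (P : pred nat) j : j < n ->
  all P (gate_args (nth Input C j)) = all (fun i => P (ag x j i)) (iota 0 (na x j)).
Proof. by move=> jn; rewrite argsP // all_map. Qed.

Lemma ag_lt j i : j < n -> i < na x j -> ag x j i < j.
Proof.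
move=> jn hi; apply: (arg_lt wf); rewrite ?size_circ // argsP //.
by apply/mapP; exists i; rewrite // mem_iota.
Qed.

Lemma ag_n j i : j < n -> i < na x j -> ag x j i < n.
Proof. by move=> jn hi; apply: ltn_trans (ag_lt jn hi) jn. Qed.

Lemma bigmax_le s (F : nat -> nat) m :
  (\max_(i <- s) F i <= m) = all (fun i => F i <= m) s.
Proof. by elim: s => [|i s IH]; rewrite ?big_nil // big_cons geq_max IH. Qed.

Lemma kd0_na j : j < n -> kd x j = 0 -> na x j = 0.
Proof.
move=> jn; rewrite kdP // => h; rewrite -[na x j](size_mkseq (ag x j)) -argsP //.
by case: (nth Input C j) h.
Qed.

Lemma kd1_na j : j < n -> kd x j = 1 -> na x j = 1.
Proof.
move=> jn; rewrite kdP // => h; rewrite -[na x j](size_mkseq (ag x j)) -argsP //.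
by case: (nth Input C j) h.
Qed.

Lemma cdep_rec j : j < n ->
  cdep C j = if kd x j == 0 then 0 else (\max_(i <- mkseq (ag x j) (na x j)) cdep C i).+1.
Proof.
move=> jn; rewrite (cdepE wf) ?size_circ // argsP // kdP //.
by case: (nth Input C j).
Qed.

Lemma cwft_rec j : j < n ->
  cwft C j = \max_(i <- mkseq (ag x j) (na x j)) cwft C i + (2 < na x j).
Proof. by move=> jn; rewrite (cwftE wf) ?size_circ // argsP // size_mkseq. Qed.

Lemma cdep_arg D j i : j < n -> i < na x j -> cdep C j <= D.+1 -> cdep C (ag x j i) <= D.
Proof.
move=> jn hi; rewrite cdep_rec //; case: eqP => [/(kd0_na jn) e|_]; first by rewrite e in hi.
by rewrite ltnS bigmax_le all_map => /all_iotaP; apply.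
Qed.

Lemma dleP D j : j < n -> dle D j = (cdep C j <= D).
Proof.
elim: D j => [|D IH] j jn; rewrite /= cdep_rec //; case: eqP => //= _.
rewrite ltnS bigmax_le all_map; apply: eq_in_all => i; rewrite mem_iota => hi /=.
by rewrite IH // ag_n.
Qed.

Lemma cdep0_kd j : j < n -> cdep C j <= 0 -> kd x j = 0.
Proof. by move=> jn; rewrite cdep_rec //; case: eqP. Qed.

Lemma w0P D j : j < n -> cdep C j <= D -> w0 D j = (cwft C j == 0).
Proof.
elim: D j => [|D IH] j jn hD.
  by rewrite /= cwft_rec // (kd0_na jn (cdep0_kd jn hD)) big_nil.
rewrite /= cwft_rec // addn_eq0 andbC -leqn0 bigmax_le all_map ltnNge eqb0 negbK.
congr andb; apply: eq_in_all => i; rewrite mem_iota => hi /=.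
by rewrite IH ?leqn0 // ?ag_n //; apply: cdep_arg hD.
Qed.

Lemma w1P D j : j < n -> cdep C j <= D -> w1 D j = (cwft C j <= 1).
Proof.
elim: D j => [|D IH] j jn hD.
  by rewrite /= cwft_rec // (kd0_na jn (cdep0_kd jn hD)) big_nil.
rewrite /= cwft_rec //; case: (leqP (na x j) 2) => h.
  rewrite addn0 bigmax_le all_map; apply: eq_in_all => i; rewrite mem_iota => hi /=.
  by rewrite IH // ?ag_n //; apply: cdep_arg hD.
rewrite addn1 ltnS bigmax_le all_map; apply: eq_in_all => i; rewrite mem_iota => hi /=.
by rewrite w0P ?leqn0 // ?ag_n //; apply: cdep_arg hD.
Qed.

Lemma cwft_arg j i : j < n -> i < na x j -> cwft C (ag x j i) + (2 < na x j) <= cwft C j.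
Proof.
move=> jn hi; rewrite (cwft_rec jn) leq_add2r; move: (leqnn (\max_(k <- mkseq (ag x j) (na x j)) cwft C k)).
by rewrite {1}bigmax_le all_map => /all_iotaP; apply.
Qed.

Section Values.
Variable a : nat -> bool.
Notation val := (cval C a).

Lemma val_input j : j < n -> kd x j = 0 -> val j = a j.
Proof.
by move=> jn; rewrite kdP // (cvalE _ wf) ?size_circ //; case: (nth Input C j).
Qed.

Lemma val_not j : j < n -> kd x j = 1 -> val j = ~~ val (ag x j 0).
Proof.
move=> jn k1; have := argsP jn; rewrite (kd1_na jn k1); move: k1.
rewrite kdP // (cvalE _ wf) ?size_circ //.
by case: (nth Input C j) => //= i _ [->].
Qed.

(** [And] with value true and [Or] with value false: the cases in which all arguments must have
    value [b]. The dual [val_exist] covers those in which one argument is enough. *)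
Lemma val_univ b j : j < n -> 1 < kd x j -> (kd x j == 2) == b ->
  (val j == b) = all (fun i => val (ag x j i) == b) (iota 0 (na x j)).
Proof.
move=> jn k1 /eqP <-; rewrite -(all_args (fun i => val i == (kd x j == 2))) //.
move: k1; rewrite kdP // (cvalE _ wf) ?size_circ //.
case: (nth Input C j) => //= s _.
  by rewrite eqb_id; apply: eq_all => i /=; rewrite eqb_id.
by rewrite eqbF_neg -all_predC; apply: eq_all => i /=; rewrite eqbF_neg.
Qed.

Lemma val_exist b j : j < n -> 1 < kd x j -> (kd x j == 2) != b ->
  (val j == b) = has (fun i => val (ag x j i) == b) (iota 0 (na x j)).
Proof.
move=> jn k1 kb; have kb' : (kd x j == 2) == ~~ b by case: (_ == 2) b kb => [] [].
have e v : (v == ~~ b) = ~~ (v == b) by case: v b {kb kb'} => [] [].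
rewrite -[LHS]negbK -e (val_univ jn k1 kb') -has_predC; apply: eq_has => i /=.
by rewrite e negbK.
Qed.

Section Views.
Variables dc mb : nat -> bool.
Hypothesis view : forall c, c < n -> kd x c = 0 -> dc c -> mb c = a c.

Lemma ev_sound D b j : j < n -> ev dc mb D b j -> val j = b.
Proof.
elim: D b j => [|D IH] b j jn /=.
  by case: eqP => // k0 /andP[dj /eqP <-]; rewrite val_input // view.
case: eqP => [k0 /andP[dj /eqP <-]|k0]; first by rewrite val_input // view.
case: eqP => [k1 h|k1].
  by rewrite val_not // (IH _ _ _ h) ?negbK // ag_n // kd1_na.
have k2 : 1 < kd x j by case: (kd x j) k0 k1 => [|[]].
case: ifP => [kb /all_iotaP h|/negbT kb /has_iotaP[i hi h]]; apply/eqP.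
  by rewrite (val_univ jn k2 kb); apply/all_iotaP => i hi; rewrite (IH _ _ _ (h i hi)) // ag_n.
rewrite (val_exist jn k2 kb); apply/has_iotaP; exists i => //.
by rewrite (IH _ _ _ h) // ag_n.
Qed.

Lemma ev_complete D j : j < n -> cdep C j <= D -> {in ins D j, forall c, dc c} ->
  ev dc mb D (val j) j.
Proof.
elim: D j => [|D IH] j jn hD /=.
  have k0 := cdep0_kd jn hD; rewrite k0 eqxx => h.
  have dj : dc j by apply: h; rewrite inE.
  by rewrite dj view // val_input // eqxx.
case: eqP => [k0|k0] h.
  have dj : dc j by apply: h; rewrite inE.
  by rewrite dj view // val_input // eqxx.
have IH' i : i < na x j -> ev dc mb D (val (ag x j i)) (ag x j i).
  move=> hi; apply: IH; [exact: ag_n | exact: cdep_arg hD | move=> c hc].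
  by apply: h; apply/flattenP; exists (ins D (ag x j i)) => //; apply/mapP; exists i;
    rewrite // mem_iota.
case: eqP => [k1|k1].
  by rewrite val_not // negbK; apply: IH'; rewrite kd1_na.
have k2 : 1 < kd x j by case: (kd x j) k0 k1 => [|[]].
case: ifP => [kb|/negbT kb].
  have := val_univ jn k2 kb; rewrite eqxx => /esym/all_iotaP hu.
  by apply/all_iotaP => i hi; rewrite -(eqP (hu i hi)); apply: IH'.
have := val_exist jn k2 kb; rewrite eqxx => /esym/has_iotaP[i hi /eqP e].
by apply/has_iotaP; exists i => //; rewrite -e; apply: IH'.
Qed.

End Views.

Lemma ins_lt D j : j < n -> {in ins D j, forall c, c < n}.
Proof.
elim: D j => [|D IH] j jn c /=; case: eqP => // _; rewrite ?inE; try by move/eqP->.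
case/flattenP=> s /mapP[i]; rewrite mem_iota => hi -> /IH; apply; exact: ag_n.
Qed.

(** Weft 0 means fan-in at most 2, so the number of inputs at most doubles with every level. *)
Lemma size_ins D j : j < n -> cdep C j <= D -> cwft C j = 0 -> size (ins D j) <= 2 ^ D.
Proof.
elim: D j => [|D IH] j jn hD hw /=; case: eqP => _ //; first by rewrite expn_gt0.
have hw2 : na x j <= 2.
  by move: hw; rewrite cwft_rec //; case: (leqP (na x j) 2) => //= _; rewrite addn1.
have h i : i < na x j -> size (ins D (ag x j i)) <= 2 ^ D.
  move=> hi; apply: IH; [exact: ag_n | exact: cdep_arg hD |].
  by have := cwft_arg jn hi; rewrite hw leqn0 addn_eq0 => /andP[/eqP].
rewrite size_flatten /shape -map_comp.
have hs m : m <= na x j -> sumn [seq size (ins D (ag x j i)) | i <- iota 0 m] <= m * 2 ^ D.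
  elim: m => [|m IHm] hm //.
  rewrite -addn1 iotaD map_cat sumn_cat /= addn0 add0n mulnDl mul1n.
  by apply: leq_add; [apply: IHm; lia | apply: h; lia].
by apply: leq_trans (hs _ (leqnn _)) _; rewrite expnS leq_mul2r hw2 orbT.
Qed.

End Values.

Section Claims.
Variables (d R : nat) (F : nat -> nat).

(* A claim [2 j + b] asserts that node [j] has value [b]. *)
Definition claimed (j : nat) (b : bool) : bool :=
  has (fun e : 'I_R => F e == j.*2 + b) (enum 'I_R).

(** Local correctness of a node of the proof tree. Nodes of weft 0 and large gates that need all
    arguments may be leaves; they are supported not by further claims but by the absence of a
    refutation. *)
Definition closed (g : nat) (c : bool) : bool :=
  w0 d g ||
  (if kd x g == 1 then claimed (ag x g 0) (~~ c)
   else if (kd x g == 2) == c then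
     (2 < na x g) || all (fun i => claimed (ag x g i) c) (iota 0 (na x g))
   else has (fun i => claimed (ag x g i) c) (iota 0 (na x g))).

Variable a : nat -> bool.
Notation val := (cval C a).

Hypothesis cl : forall g c, g < n -> claimed g c -> closed g c.
Hypothesis views : forall cs : seq nat, size cs <= 2 ^ d -> all (fun c => c < n) cs ->
  exists dc mb : nat -> bool,
    [/\ forall c, c < n -> kd x c = 0 -> dc c -> mb c = a c,
        {in cs, forall c, dc c} &
        forall g c, g < n -> claimed g c -> ~~ ev dc mb d (~~ c) g].

(** Induction in topological order. Some view decides all inputs below a leaf of weft 0 and would
    refute a false claim about it. If a large gate had an argument of the wrong value, the view that
    covers the inputs of this argument would refute the gate. *)
Lemma claim_true g c : g < n -> cdep C g <= d -> cwft C g <= 1 -> claimed g c -> val g = c.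
Proof.
elim/ltn_ind: g c => g IH c gn hd hw hc.
have k4 : cwft C g <> 0 -> kd x g <> 0.
  move=> h k0; apply: h; by rewrite cwft_rec // (kd0_na gn k0) big_nil.
have := cl gn hc; rewrite /closed w0P //.
case: eqP => [w00 _|/[dup] w00 /k4 k0] /=.
  have [] := views (size_ins gn hd w00).
    by apply/allP => j; apply: ins_lt.
  move=> dc [mb [v1 v2 v3]]; have := v3 _ _ gn hc; have := ev_complete v1 gn hd v2.
  by case: (val g) (c) => [] [] // ->.
have dS : 0 < d by case: (posnP d) hd => // -> /(cdep0_kd gn).
have argd i : i < na x g -> cdep C (ag x g i) <= d.
  by move=> hi; apply: leq_trans (leq_pred d); apply: (@cdep_arg _ g) => //; rewrite prednK.
have argw i : i < na x g -> cwft C (ag x g i) <= 1.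
  by move=> hi; apply: leq_trans hw; apply: leq_trans (cwft_arg gn hi); apply: leq_addr.
case: eqP => [k1 h|k1].
  have h0 : 0 < na x g by rewrite kd1_na.
  by rewrite val_not // (IH _ _ _ _ _ _ h) ?negbK // ?ag_lt ?ag_n ?argd ?argw.
have k2 : 1 < kd x g by case: (kd x g) k0 k1 => [|[]].
case: ifP => [kb|/negbT kb].
  case/orP=> [big|/all_iotaP h]; apply/eqP; rewrite (val_univ _ gn k2 kb);
    apply/all_iotaP => i hi; apply/eqP; last first.
    by apply: IH; rewrite ?ag_lt ?ag_n ?argd ?argw ?h.
  have hi' := ag_n gn hi; have hd' : cdep C (ag x g i) <= d.-1.
    by apply: (@cdep_arg _ g) => //; rewrite prednK.
  have hw' : cwft C (ag x g i) = 0 by have := cwft_arg gn hi; rewrite big; lia.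
  have [||dc [mb [v1 v2 v3]]] := views (cs := ins d.-1 (ag x g i)).
  - by apply: leq_trans (size_ins hi' hd' hw') _; rewrite leq_exp2l // leq_pred.
  - by apply/allP => j; apply: ins_lt.
  apply/eqP; apply: contraTT (v3 _ _ gn hc) => hv; rewrite negbK -(prednK dS) /=.
  have ev' : val (ag x g i) = ~~ c by case: (val _) (c) hv => [] [].
  have := ev_complete v1 hi' hd' v2; rewrite ev' => he.
  rewrite (introF eqP k0) (introF eqP k1).
  have -> : ((kd x g == 2) == ~~ c) = false by rewrite (eqP kb); case: (c).
  by apply/has_iotaP; exists i.
case/has_iotaP=> i hi h; apply/eqP; rewrite (val_exist _ gn k2 kb).
by apply/has_iotaP; exists i => //; rewrite (IH _ _ _ _ _ _ h) ?ag_lt ?ag_n ?argd ?argw.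
Qed.

End Claims.

(* [L] lists the nodes of a proof tree for the value of [g]. *)
Lemma claims_exist a d D g : g < n -> cdep C g <= D -> D <= d -> cwft C g <= 1 ->
  exists L : seq nat, [/\ g \in L, all (fun j => j < n) L, size L < 2 ^ D.+1 &
    forall R F, (forall j, j \in L -> claimed R F j (cval C a j)) ->
    forall j, j \in L -> closed d R F j (cval C a j)].
Proof.
elim: D g => [|D IH] g gn hD Dd hw; case: (eqVneq (cwft C g) 0) => [w00|w00].
- exists [:: g]; split; rewrite ?inE //= ?gn // => R F _ j; rewrite inE => /eqP->.
  by rewrite /closed w0P ?w00 // (leq_trans hD).
- case/negP: w00; rewrite cwft_rec // (kd0_na gn (cdep0_kd gn hD)) big_nil //.
- exists [:: g]; split; rewrite ?inE //= ?gn //; last first.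
    by move=> R F _ j; rewrite inE => /eqP->; rewrite /closed w0P ?w00 // (leq_trans hD).
  by rewrite -{1}(expn0 2) ltn_exp2l.
have gd : cdep C g <= d := leq_trans hD Dd.
have k0 : kd x g <> 0.
  by move=> k0; case/negP: w00; rewrite cwft_rec // (kd0_na gn k0) big_nil.
have hIH i : i < na x g -> exists L : seq nat, [/\ ag x g i \in L, all (fun j => j < n) L,
    size L < 2 ^ D.+1 & forall R F, (forall j, j \in L -> claimed R F j (cval C a j)) ->
    forall j, j \in L -> closed d R F j (cval C a j)].
  move=> hi; apply: IH; [exact: ag_n | exact: cdep_arg hD | exact: ltnW|].
  by apply: leq_trans hw; apply: leq_trans (cwft_arg gn hi); apply: leq_addr.
(* The case of a gate justified by a single argument: put [g] in front of the tree of this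
   argument. *)
have one i : i < na x g ->
    (forall R F L, ag x g i \in L -> (forall j, j \in g :: L -> claimed R F j (cval C a j)) ->
      closed d R F g (cval C a g)) ->
    exists L : seq nat, [/\ g \in L, all (fun j => j < n) L, size L < 2 ^ D.+2 &
      forall R F, (forall j, j \in L -> claimed R F j (cval C a j)) ->
      forall j, j \in L -> closed d R F j (cval C a j)].
  move=> hi hg; have [L [l1 l2 l3 l4]] := hIH i hi; exists (g :: L); split.
  - exact: mem_head.
  - by rewrite /= gn.
  - by rewrite /= expnS; lia.
  - move=> R F hcl j; rewrite inE => /predU1P[->|jL]; first exact: (hg R F L l1 hcl).
    by apply: l4 jL => j' hj'; apply: hcl; rewrite inE hj' orbT.
case: (eqVneq (kd x g) 1) => [k1|k1].
  apply: (one 0); first by rewrite kd1_na.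
  move=> R F L l1 h; rewrite /closed k1 eqxx; apply/orP; right.
  by rewrite val_not // negbK; apply: h; rewrite inE l1 orbT.
have k2 : 1 < kd x g by case: (kd x g) k0 k1 => [|[]].
case: (boolP ((kd x g == 2) == cval C a g)) => kb; last first.
  have := val_exist a gn k2 kb; rewrite eqxx => /esym/has_iotaP[i hi /eqP e].
  apply: (one i hi) => R F L l1 h; rewrite /closed (negbTE k1) (negbTE kb).
  by apply/orP; right; apply/has_iotaP; exists i => //; rewrite -e; apply: h;
     rewrite inE l1 orbT.
have := val_univ a gn k2 kb; rewrite eqxx => /esym/all_iotaP hu.
case: (ltnP 2 (na x g)) => big.
  exists [:: g]; split; rewrite ?inE //= ?gn //; last first.
    move=> R F _ j; rewrite inE => /eqP->; rewrite /closed (negbTE k1) kb big.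
    by rewrite orTb orbT.
  by rewrite -{1}(expn0 2) ltn_exp2l.
(* The trees of the arguments are joined. With at most two arguments, two trees of fewer than
   [2 ^ D.+1] nodes and [g] itself stay below [2 ^ D.+2]. *)
have hL m : m <= na x g -> exists L : seq nat,
   [/\ forall i, i < m -> ag x g i \in L, all (fun j => j < n) L,
      size L <= m * (2 ^ D.+1).-1 & forall R F,
      (forall j, j \in L -> claimed R F j (cval C a j)) ->
      forall j, j \in L -> closed d R F j (cval C a j)].
  elim: m => [|m IHm] hm; first by exists [::].
  have [L [l1 l2 l3 l4]] := IHm (ltnW hm); have [L' [m1 m2 m3 m4]] := hIH m hm.
  exists (L ++ L'); split.
  - move=> i; rewrite ltnS leq_eqVlt mem_cat => /predU1P[->|/l1->] //; by rewrite m1 orbT.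
  - by rewrite all_cat l2.
  - by rewrite size_cat mulSn addnC; apply: leq_add => //; lia.
  - move=> R F hcl j; rewrite mem_cat => /orP[jL|jL].
      by apply: l4 jL => j' hj; apply: hcl; rewrite mem_cat hj.
    by apply: m4 jL => j' hj; apply: hcl; rewrite mem_cat hj orbT.
have [L [l1 l2 l3 l4]] := hL _ (leqnn _); exists (g :: L); split.
- exact: mem_head.
- by rewrite /= gn.
- have : 0 < 2 ^ D.+1 by rewrite expn_gt0.
  by rewrite /= (expnS 2 D.+1); nia.
- move=> R F hcl j; rewrite inE => /predU1P[->|jL]; last first.
    by apply: l4 jL => j' hj'; apply: hcl; rewrite inE hj' orbT.
  rewrite /closed (negbTE k1) kb; apply/orP; right; apply/orP; right.
  apply/all_iotaP => i hi; rewrite -(eqP (hu i hi)); apply: hcl.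
  by rewrite inE l1 // orbT.
Qed.

End CircuitChecks.

(** * Circuits of weft one *)

Section WeftOne.
Variables (d : nat) (x : seq bool) (k : nat).

(** [wr] intervals cover the inputs below any node of weft 0, and [wR] exceeds the size of a proof
    tree. The base [k.+2] of the index gives at least two variables even for [k = 0], as
    [csp_clique] demands, and lets [X_{k+1}] occur as a lower end. *)
Definition wr := 2 ^ d.
Definition wR := 2 ^ d.+1.
Definition wq := k.+2 ^ wr.
Definition wbase := wq + (run x 0).*2 + 5.
Definition wfields := (wR + wr.*2).+1.
Notation n := (run x 0).
Notation C := (circ x).

(* A vertex consists of an index [tau] in base [k + 2] with digits
   [i_0, ..., i_{r-1}], a list of claims, and the values [X_{i_l}] and
   [X_{i_l + 1}], where [0 = X_0 < X_1 < ... < X_k < X_{k+1} = n + 1] lists the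
   true inputs [j] as [j + 1]. *)
Definition tau u := dig wbase u 0.
Definition clm u e := dig wbase u e.+1.
Definition lo u l := dig wbase u (wR + l.*2).+1.
Definition hi u l := dig wbase u (wR + l.*2).+2.
Definition il u l := dig k.+2 (tau u) l.

Definition dcd u c : bool :=
  has (fun l : 'I_wr => (lo u l <= c.+1) && (c.+1 <= hi u l)) (enum 'I_wr).
Definition mbr u c : bool :=
  has (fun l : 'I_wr => (lo u l == c.+1) || (hi u l == c.+1)) (enum 'I_wr).

(** Imposed on all pairs of vertices, this makes the recorded points the values of a single strictly
    increasing function of the index. *)
Definition mono i a i' a' : bool :=
  [&& (i < i') ==> (a < a'), (i == i') ==> (a == a') & (i' < i) ==> (a' < a)].
Definition pts u v : bool :=
  all (fun l : 'I_wr => all (fun l' : 'I_wr =>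
    [&& mono (il u l) (lo u l) (il v l') (lo v l'),
        mono (il u l) (lo u l) (il v l').+1 (hi v l'),
        mono (il u l).+1 (hi u l) (il v l') (lo v l') &
        mono (il u l).+1 (hi u l) (il v l').+1 (hi v l')])
  (enum 'I_wr)) (enum 'I_wr).
Definition ptok i a : bool :=
  [&& (i == 0) ==> (a == 0), (i == k.+1) ==> (a == n.+1) &
      ((0 < i) && (i <= k)) ==> [&& 0 < a, a <= n & kd x a.-1 == 0]].

Definition cvalid u : bool :=
  [&& okc x d, tau u < wq, pts u u,
      all (fun l : 'I_wr => ptok (il u l) (lo u l) && ptok (il u l).+1 (hi u l)) (enum 'I_wr),
      clm u 0 == n.-1.*2.+1 &
      all (fun e : 'I_wR => [&& (clm u e)./2 < n,
          closed x d wR (clm u) (clm u e)./2 (odd (clm u e)) &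
          ~~ ev x (dcd u) (mbr u) d (~~ odd (clm u e)) (clm u e)./2]) (enum 'I_wR)].
Definition cpair u v : bool :=
  all (fun e : 'I_wR => clm u e == clm v e) (enum 'I_wR) && pts u v.
Definition ccompat u v : bool :=
  [&& cvalid u, cvalid v, tau u != tau v & cpair u v].

Lemma wr_gt0 : 0 < wr. Proof. by rewrite expn_gt0. Qed.

Lemma wq_gt1 : 1 < wq.
Proof. by rewrite /wq -{1}(expn0 k.+2) ltn_exp2l ?wr_gt0. Qed.

Section Points.
Variables (X : nat -> nat) (a : nat -> bool).
Hypotheses (X0 : X 0 = 0) (Xk : X k.+1 = n.+1).
Hypothesis Xlt : forall i i', i < i' -> i' <= k.+2 -> X i < X i'.
Hypothesis aX : forall c, c < n -> kd x c = 0 ->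
  a c = has (fun i => X i.+1 == c.+1) (iota 0 k).
Variable u : nat.
Hypothesis uX : forall l : 'I_wr,
  [/\ il u l <= k.+1, lo u l = X (il u l) & hi u l = X (il u l).+1].

(** No point lies strictly between [X i] and [X i.+1], so an input in this closed interval is true
    exactly if it is an endpoint. The sentinels [X 0], [X k.+1] and [X k.+2] correspond to no
    input. *)
Lemma view_sound c : c < n -> kd x c = 0 -> dcd u c -> mbr u c = a c.
Proof.
move=> cn kc /has_enum_ordP[l /andP[h1 h2]]; have [i1 i2 i3] := uX l.
have inner i : i <= k.+2 -> X i = c.+1 -> 0 < i <= k.
  move=> ik e; have i0 : i <> 0 by move=> i0; rewrite i0 X0 in e.
  have ik1 : i <> k.+1 by move=> e1; rewrite e1 Xk in e; lia.
  have ik2 : i <> k.+2.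
    by move=> e2; have := @Xlt k.+1 k.+2 (leqnn _) (leqnn _); rewrite -e2 e Xk; lia.
  by lia.
have toa i : i <= k.+2 -> X i = c.+1 -> a c.
  move=> ik e; have /andP[p1 p2] := inner i ik e.
  by rewrite aX //; apply/has_iotaP; exists i.-1; [lia | rewrite prednK ?e].
apply/idP/idP => [/has_enum_ordP[l' /orP[]/eqP e]|].
- by have [j1 j2 j3] := uX l'; apply: (toa (il u l')); [apply: leqW | rewrite -j2].
- by have [j1 j2 j3] := uX l'; apply: (toa (il u l').+1) => //; rewrite -j3.
rewrite aX // => /has_iotaP[i ik /eqP e].
rewrite i2 -e in h1; rewrite i3 -e in h2.
have c1 : il u l <= i.+1.
  by rewrite leqNgt; apply/negP => h; have := Xlt h (leqW i1); rewrite ltnNge h1.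
have c2 : i.+1 <= (il u l).+1.
  rewrite leqNgt; apply/negP => h; have ik2 : i.+1 <= k.+2 by lia.
  by have := Xlt h ik2; rewrite ltnNge h2.
apply/has_enum_ordP; exists l; rewrite i2 i3 -e.
have [->|->] : il u l = i.+1 \/ il u l = i by lia.
  by rewrite eqxx.
by rewrite eqxx orbT.
Qed.

Definition locate c := find (fun i => c.+1 <= X i.+1) (iota 0 k.+1).

Lemma locateP c : c < n -> locate c <= k /\ X (locate c) <= c.+1 <= X (locate c).+1.
Proof.
move=> cn; pose P i := c.+1 <= X i.+1.
have hh : has P (iota 0 k.+1) by apply/has_iotaP; exists k; rewrite // /P Xk; lia.
have ik : locate c < k.+1 by move: hh; rewrite has_find size_iota.
split=> //; apply/andP; split; last by have := nth_find 0 hh; rewrite nth_iota.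
case E: (locate c) => [|j]; first by rewrite X0.
have ji : j < locate c by rewrite E.
have := before_find 0 ji; rewrite nth_iota ?add0n; last by lia.
by move/negbT; rewrite -ltnNge => /ltnW.
Qed.

End Points.

Lemma wcs_sound (w : nat -> nat) :
  (forall t, t < wq -> tau (w t) = t /\
     forall t', t' < wq -> t <> t' -> ccompat (w t) (w t')) ->
  WCS 1 d x k.
Proof.
move=> hw; have q0 : 0 < wq := ltnW wq_gt1.
have wt t : t < wq -> tau (w t) = t by move=> /hw[].
have vd t : t < wq -> cvalid (w t).
  move=> tq; have [_ h] := hw t tq.
  case: (eqVneq t 0) => [t0|t0].
    have t1 : t <> 1 by rewrite t0.
    by have /and4P[] := h 1 wq_gt1 t1.
  by have /and4P[] := h 0 q0 (elimN eqP t0).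
have pr t t' : t < wq -> t' < wq -> pts (w t) (w t') /\
    forall e : 'I_wR, clm (w t) e = clm (w t') e.
  move=> tq tq'; case: (eqVneq t t') => [<-|ne]; first by have /and5P[] := vd t tq.
  have [_ /(_ t' tq' (elimN eqP ne))/and4P[_ _ _ /andP[/all_enum_ordP h1 h2]]] := hw t tq.
  by split=> // e; apply/eqP.
have ilE t l : t < wq -> il (w t) l = dig k.+2 t l by move=> tq; rewrite /il wt.
have il_le t l : t < wq -> il (w t) l <= k.+1.
  by move=> tq; rewrite ilE // -ltnS; apply: ltn_mod.
pose l0 : 'I_wr := Ordinal wr_gt0.
pose cst i := undig k.+2 wr (fun=> i).
have cst_lt i : i <= k.+1 -> cst i < wq by move=> ik; apply: undig_lt.
have il_cst i l : i <= k.+1 -> l < wr -> il (w (cst i)) l = i.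
  by move=> ik lr; rewrite ilE ?cst_lt // dig_undig.
(* The points are read off from the constant tuples; [X k.+2] is available only as an upper end. *)
pose X i := if i <= k.+1 then lo (w (cst i)) l0 else hi (w (cst k.+1)) l0.
have point t (l : 'I_wr) i (b : bool) : t < wq -> i <= k.+2 ->
    mono (il (w t) l + b) (if b then hi (w t) l else lo (w t) l) i (X i).
  move=> tq ik; rewrite /X; case: leqP => ik1.
    have [/all_enum_ordP/(_ l)/all_enum_ordP/(_ l0)/and4P[h1 _ h3 _] _] :=
      pr t (cst i) tq (cst_lt _ ik1).
    by rewrite il_cst ?wr_gt0 // in h1 h3; case: b; rewrite ?addn1 ?addn0.
  have -> : i = k.+2 by lia.
  have [/all_enum_ordP/(_ l)/all_enum_ordP/(_ l0)/and4P[_ h2 _ h4] _] :=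
    pr t (cst k.+1) tq (cst_lt _ (leqnn _)).
  by rewrite il_cst ?wr_gt0 // in h2 h4; case: b; rewrite ?addn1 ?addn0.
have wX t (l : 'I_wr) : t < wq -> [/\ il (w t) l <= k.+1, lo (w t) l = X (il (w t) l) &
    hi (w t) l = X (il (w t) l).+1].
  move=> tq; have hi1 := il_le t l tq; split=> //; apply/eqP.
    have /and3P[_ + _] := point t l (il (w t) l) false tq (leqW hi1).
    by rewrite addn0 eqxx.
  have /and3P[_ + _] := point t l (il (w t) l).+1 true tq hi1.
  by rewrite addn1 eqxx.
have Xlt i i' : i < i' -> i' <= k.+2 -> X i < X i'.
  move=> ii ik; have ik1 : i <= k.+1 by lia.
  have /and3P[+ _ _] := point (cst i) l0 i' false (cst_lt _ ik1) ik.
  by rewrite il_cst ?wr_gt0 // addn0 ii /= {2}/X ik1.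
have Xok i : i <= k.+1 -> ptok i (X i).
  move=> ik; have /and5P[_ _ _ /all_enum_ordP/(_ l0)/andP[h _] _] := vd _ (cst_lt i ik).
  by rewrite il_cst ?wr_gt0 // in h; rewrite /X ik.
have X0 : X 0 = 0 by have /and3P[/eqP] := Xok 0 isT.
have Xk : X k.+1 = n.+1 by have /and3P[_ +] := Xok k.+1 (leqnn _); rewrite eqxx => /eqP.
have Xin i : i < k -> [/\ 0 < X i.+1, X i.+1 <= n & kd x (X i.+1).-1 = 0].
  move=> ik; have /and3P[_ _] := Xok i.+1 (leqW ik); rewrite ik /=.
  by case/and3P=> ? ? /eqP.
pose a c := has (fun i => X i.+1 == c.+1) (iota 0 k).
have /and5P[/and5P[pk n0 wfp dep wft] _ _ _ /andP[/eqP c0 /all_enum_ordP cls]] := vd 0 q0.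
have wf : circuit_wf C.
  move=> j; rewrite size_circ => jn; rewrite argsP // all_map.
  by move/all_iotaP: wfp => /(_ j jn).
have n1 : n.-1 < n by rewrite prednK.
rewrite dleP // in dep; rewrite w1P // in wft.
have hval : cval C a n.-1 = true.
  apply: (@claim_true x wf d wR (clm (w 0)) a) => //.
  - move=> g c gn /has_enum_ordP[e /eqP he]; have /and3P[_ + _] := cls e; rewrite he.
    by rewrite halfD odd_double doubleK oddD odd_double /=; case: c {he}; rewrite /= ?addn0.
  (* The required view belongs to the tuple of intervals around the members of [cs]; [minn] keeps
     every digit legal, also behind the end of [cs]. *)
  - move=> cs scs csn; pose t := undig k.+2 wr (fun l => minn (locate X (nth 0 cs l)) k).
    have tq : t < wq by apply: undig_lt => i _; lia.
    exists (dcd (w t)), (mbr (w t)); split.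
    + by move=> c; apply: (view_sound X0 Xk Xlt) => // l; apply: wX.
    + move=> c cin; have cn := allP csn c cin; have [h1 h2] := locateP X0 Xk cn.
      have lr : index c cs < wr by apply: leq_trans scs; rewrite index_mem.
      apply/has_enum_ordP; exists (Ordinal lr); have [_ -> ->] := wX t (Ordinal lr) tq.
      rewrite ilE // dig_undig //; last by move=> i _; lia.
      by rewrite /= nth_index // (minn_idPl h1).
    + move=> g c gn /has_enum_ordP[e /eqP he].
      have /and5P[_ _ _ _ /andP[_ /all_enum_ordP/(_ e)/and3P[_ _]]] := vd t tq.
      have [_ /(_ e) <-] := pr 0 t q0 tq; rewrite he.
      by rewrite halfD odd_double doubleK oddD odd_double /=; case: c {he}; rewrite /= ?addn0.
  - have R0 : 0 < wR by rewrite expn_gt0.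
    by apply/has_enum_ordP; exists (Ordinal R0); rewrite /= c0 addn1.
exists C; split=> //.
- exact: parse_sound.
- by rewrite /circuit_weft -nth_last size_node_values size_circ.
- by rewrite /circuit_depth -nth_last size_node_values size_circ.
exists a; split; last by rewrite /circuit_value -nth_last size_node_values size_circ.
(* The true inputs are the predecessors of [X 1], ..., [X k]; these are distinct, so the weight is
   exactly [k]. *)
rewrite /circuit_weight size_circ -size_filter -(size_mkseq (fun i => (X i.+1).-1) k).
apply/perm_size/uniq_perm.
- exact/filter_uniq/iota_uniq.
- rewrite map_inj_in_uniq ?iota_uniq // => i i'; rewrite !mem_iota => ik ik' e.
  have [p1 _ _] := Xin i ik; have [p2 _ _] := Xin i' ik'.
  case: (ltngtP i i') => // ii.
    by have := @Xlt i.+1 i'.+1 ii (leqW (leqW ik')); lia.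
  by have := @Xlt i'.+1 i.+1 ii (leqW (leqW ik)); lia.
move=> j; rewrite mem_filter mem_iota /= add0n; apply/andP/mapP.
  case=> /andP[_ /has_iotaP[i ik /eqP e]] jn; exists i; first by rewrite mem_iota.
  by rewrite e.
case=> i; rewrite mem_iota => ik ->; have [p1 p2 p3] := Xin i ik.
have jn : (X i.+1).-1 < n by lia.
split=> //; apply/andP; split; first by move: p3; rewrite kdP //; case: (nth Input C _).
by apply/has_iotaP; exists i; rewrite // prednK.
Qed.

Lemma wcs_complete : WCS 1 d x k -> exists w : nat -> nat, forall t, t < wq ->
  [/\ w t < wbase ^ wfields, tau (w t) = t &
      forall t', t' < wq -> t <> t' -> ccompat (w t) (w t')].
Proof.
case=> C0 [hx wf hwft hdep [a [hwt hval]]].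
have [pk eC] := parse_complete hx; rewrite -{}eC in wf hwft hdep hwt hval.
have sC := size_circ x.
have n0 : 0 < n.
  case: (posnP n) => // n0; have C0E : C = [::] by apply: size0nil; rewrite sC.
  by move: hval; rewrite C0E.
have n1 : n.-1 < n by rewrite prednK.
rewrite /circuit_weft -nth_last size_node_values sC -/(cwft C n.-1) in hwft.
rewrite /circuit_depth -nth_last size_node_values sC -/(cdep C n.-1) in hdep.
rewrite /circuit_value -nth_last size_node_values sC -/(cval C a n.-1) in hval.
pose s := [seq j <- iota 0 n | is_input (nth Input C j) && a j].
have ss : size s = k by rewrite size_filter -hwt /circuit_weight sC.
have sP j : j \in s -> [/\ j < n, kd x j = 0 & a j].
  rewrite mem_filter mem_iota /= add0n => /andP[/andP[h1 h2] jn]; split=> //.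
  by rewrite kdP //; case: (nth Input C j) h1.
have slt : sorted ltn s by apply: sorted_filter; [exact: ltn_trans | exact: iota_ltn_sorted].
(* Behind the [k] true inputs the formula continues with the sentinels [n.+1] and [n.+2]. *)
pose X i := if i == 0 then 0 else if i <= k then (nth 0 s i.-1).+1 else n + (i - k).
have X0 : X 0 = 0 by [].
have Xk : X k.+1 = n.+1 by rewrite /X /= ltnn subSnn addn1.
have XS i : i < k -> X i.+1 = (nth 0 s i).+1 by move=> ik; rewrite /X /= ik.
have snth i : i < k -> nth 0 s i \in s by move=> ik; rewrite mem_nth ?ss.
have Xlt i i' : i < i' -> i' <= k.+2 -> X i < X i'.
  case: i' => // i'; rewrite ltnS; case: i => [|i] ii ik.
    case: (ltnP i' k) => ik'; first by rewrite XS.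
    by rewrite /X /= (ltnNge i' k) ik' /=; lia.
  case: (ltnP i' k) => ik'.
    rewrite !XS ?ltnS; [|lia|lia].
    by apply: (sorted_ltn_nth ltn_trans 0 slt); rewrite ?inE ?ss //; lia.
  rewrite {2}/X /= (ltnNge i' k) ik' /=; case: (ltnP i k) => ik2.
    by rewrite XS //; have [] := sP _ (snth i ik2); lia.
  by rewrite /X /= (ltnNge i k) ik2 /=; lia.
have Xle i : i <= k.+2 -> X i <= n.+2.
  case: i => // i ik; case: (ltnP i k) => ik'.
    by rewrite XS //; have [] := sP _ (snth i ik'); lia.
  by rewrite /X /= (ltnNge i k) ik' /=; lia.
have aX c : c < n -> kd x c = 0 -> a c = has (fun i => X i.+1 == c.+1) (iota 0 k).
  move=> cn kc; apply/idP/has_iotaP => [ac|[i ik]].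
    have cs : c \in s.
      rewrite mem_filter mem_iota /= add0n cn ac andbT.
      by move: kc; rewrite kdP //; case: (nth Input C c).
    by exists (index c s); rewrite ?XS ?nth_index // -ss index_mem.
  by rewrite XS // eqSS => /eqP <-; have [] := sP _ (snth i ik).
have Xok i : i <= k.+2 -> ptok i (X i).
  move=> ik; apply/and3P; split; apply/implyP.
  - by move/eqP->.
  - by move/eqP->; rewrite Xk.
  case/andP=> i0 ik'; have i1 : i.-1 < k by lia.
  rewrite -(prednK i0) XS //=; have [p1 -> _] := sP _ (snth _ i1).
  by rewrite p1.
have monoX i i' : i <= k.+2 -> i' <= k.+2 -> mono i (X i) i' (X i').
  move=> h1 h2; apply/and3P; split; apply/implyP => h; [exact: Xlt | | exact: Xlt].
  by rewrite (eqP h).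
have [L [gL Ln Lsz Lcl]] := @claims_exist x wf a d d n.-1 n1 hdep (leqnn d) hwft.
(* The output is put first because [cvalid] expects it as claim 0. The default pads the list with
   further copies of the output, which belongs to [L] anyway. *)
pose F e := let j := nth n.-1 (n.-1 :: L) e in j.*2 + cval C a j.
have FL e : nth n.-1 (n.-1 :: L) e \in L.
  case: (ltnP e (size L).+1) => he; last by rewrite nth_default.
  by have := mem_nth n.-1 (he : e < size (n.-1 :: L)); rewrite inE => /predU1P[->|].
pose fld t i := if i == 0 then t else if i <= wR then F i.-1
  else X (dig k.+2 t (i - wR.+1)./2 + odd (i - wR.+1)).
have dk t l : dig k.+2 t l <= k.+1 by rewrite -ltnS; apply: ltn_mod.
have fld_lt t i : t < wq -> fld t i < wbase.
  move=> tq; rewrite /fld /wbase; case: ifP => _; first lia.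
  case: ifP => _.
    rewrite /F; have := allP Ln _ (FL i.-1); case: (cval _ _ _); lia.
  have hh : dig k.+2 t (i - wR.+1)./2 + odd (i - wR.+1) <= k.+2.
    by have := dk t (i - wR.+1)./2; case: odd; lia.
  by have := Xle _ hh; lia.
pose w t := undig wbase wfields (fld t).
have wE t i : t < wq -> i < wfields -> dig wbase (w t) i = fld t i.
  by move=> tq hi; apply: dig_undig => // j _; apply: fld_lt.
have wt t : t < wq -> tau (w t) = t by move=> tq; rewrite /tau wE.
have wc t e : t < wq -> e < wR -> clm (w t) e = F e.
  by move=> tq he; rewrite /clm wE ?/fld /= ?he // /wfields; lia.
have wX t (l : 'I_wr) : t < wq -> [/\ il (w t) l <= k.+1, lo (w t) l = X (il (w t) l) &
    hi (w t) l = X (il (w t) l).+1].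
  move=> tq; have lr := ltn_ord l; rewrite /il wt // dk; split=> //.
    rewrite /lo wE ?/wfields //; last by lia.
    rewrite /fld /= ltnNge leq_addr /= subSS addKn odd_double doubleK addn0 //.
  rewrite /hi wE ?/wfields //; last by lia.
  rewrite /fld /= ltnNge (leq_trans (leq_addr _ _) (leqnSn _)) /= subSS.
  by rewrite -addnS addKn /= odd_double uphalf_double addn1.
have hpts t t' : t < wq -> t' < wq -> pts (w t) (w t').
  move=> tq tq'; apply/all_enum_ordP => l; apply/all_enum_ordP => l'.
  have [i1 -> ->] := wX t l tq; have [i2 -> ->] := wX t' l' tq'.
  by apply/and4P; split; apply: monoX; rewrite ?ltnS // leqW.
have hvalid t : t < wq -> cvalid (w t).
  move=> tq; have R0 : 0 < wR by rewrite expn_gt0.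
  apply/and5P; split; rewrite ?wt ?hpts //.
  - apply/and5P; split; rewrite ?dleP ?w1P //.
    apply/all_iotaP => j jn; apply/all_iotaP => i hi; exact: ag_lt.
  - apply/all_enum_ordP => l; have [i1 -> ->] := wX t l tq.
    by rewrite !Xok // leqW.
  apply/andP; split; first by rewrite wc // /F /= hval addn1.
  have hcl j : j \in L -> claimed wR (clm (w t)) j (cval C a j).
    move=> jL; have ir : index j (n.-1 :: L) < wR.
      apply: leq_trans Lsz; rewrite ltnS -ltnS -[(size L).+1]/(size (n.-1 :: L)) index_mem.
      by rewrite inE jL orbT.
    apply/has_enum_ordP; exists (Ordinal ir); rewrite wc // /F nth_index //.
    by rewrite inE jL orbT.
  apply/all_enum_ordP => e; rewrite wc // /F; set j := nth _ _ _; have jL : j \in L := FL e.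
  have jn := allP Ln j jL.
  rewrite halfD oddD odd_double doubleK /= oddb.
  have -> : j + (cval C a j)./2 = j by case: cval; rewrite addn0.
  rewrite jn (Lcl _ _ hcl _ jL) /=; apply/negP => /ev_sound he.
  have := he wf a (fun c cn kc => view_sound X0 Xk Xlt aX (fun l => wX t l tq) cn kc) jn.
  by case: (cval _ _ _).
exists w => t tq; split; [by apply: undig_lt => i _; apply: fld_lt | exact: wt|].
move=> t' tq' ne; apply/and4P; split; rewrite ?hvalid ?wt //; first exact/eqP.
by rewrite /cpair hpts // andbT; apply/all_enum_ordP => e; rewrite !wc.
Qed.

Lemma wcs_clique : clique (wbase ^ wfields) wq ccompat <-> WCS 1 d x k.
Proof.
have hidx u v : ccompat u v -> tau u < wq /\ tau u <> tau v.
  by case/and4P=> /and5P[_ h _ _ _] _ /eqP ne _.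
have -> := @csp_clique (wbase ^ wfields) wq ccompat tau wq_gt1 hidx.
split=> [[w hw]|/wcs_complete //].
by apply: (@wcs_sound w) => t /hw[_ h1 h2].
Qed.

End WeftOne.

(** * The compatibility test for weft one is computable in polynomial time *)

Lemma pcb_has_const (I : Type) (l : seq I) (P : ctx -> I -> bool) :
  (forall i, pcb (fun c => P c i)) -> pcb (fun c => has (P c) l).
Proof.
by move=> h; elim: l => [|i l IH]; [apply: pcb_const | apply: pcb_or].
Qed.

Ltac pc_user ::= lazymatch goal with
  | |- pc (fun c => run (@?S c) (@?F c)) => apply (@pc_run S F)
  | |- pc (fun c => gst (@?S c) (@?F c)) => apply (@pc_gst S F)
  | |- pc (fun c => kd (@?S c) (@?F c)) => apply (@pc_kd S F)
  | |- pc (fun c => na (@?S c) (@?F c)) => apply (@pc_na S F)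
  | |- pc (fun c => ag (@?S c) (@?F c) (@?F' c)) => apply (@pc_ag S F F')
  | |- pc (fun c => dig (@?B c) (@?F c) ?i) => apply (@pc_dig B F i)
  | |- pcb (fun c => all (@?P c) ?l) => apply (@pcb_all_const _ l P); intro
  | |- pcb (fun c => has (@?P c) ?l) => apply (@pcb_has_const _ l P); intro
  end.

Lemma pcb_dle D S F : ps S -> pc F -> pcb (fun c => dle (S c) D (F c)).
Proof.
elim: D S F => [|D IH] S F hS hF /=; first by pc_tac.
by apply: pcb_or; pc_tac; apply: IH; pc_tac.
Qed.

Lemma pcb_w0 D S F : ps S -> pc F -> pcb (fun c => w0 (S c) D (F c)).
Proof.
elim: D S F => [|D IH] S F hS hF /=; first by pc_tac.
by apply: pcb_and; pc_tac; apply: IH; pc_tac.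
Qed.

Lemma pcb_w1 D S F : ps S -> pc F -> pcb (fun c => w1 (S c) D (F c)).
Proof.
elim: D S F => [|D IH] S F hS hF /=; first by pc_tac.
by apply: pcb_if; pc_tac; [apply: IH | apply: pcb_w0]; pc_tac.
Qed.

Section WeftOneComputable.
Variable d : nat.

Lemma pc_wbase S K : ps S -> pc K -> pc (fun c => wbase d (S c) (K c)).
Proof. by move=> hS hK; rewrite /wbase /wq; pc_tac. Qed.

Lemma pc_wdig S K U i : ps S -> pc K -> pc U ->
  pc (fun c => dig (wbase d (S c) (K c)) (U c) i).
Proof. by move=> hS hK hU; apply: pc_dig => //; apply: pc_wbase. Qed.

Lemma pc_il S K U l : ps S -> pc K -> pc U -> pc (fun c => il d (S c) (K c) (U c) l).
Proof.
by move=> hS hK hU; rewrite /il; apply: pc_dig; [pc_tac | apply: pc_wdig].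
Qed.

Ltac w_tac := repeat first [progress pc_tac | apply: pc_wbase | apply: pc_il].

Lemma pcb_dcd S K U F : ps S -> pc K -> pc U -> pc F ->
  pcb (fun c => dcd d (S c) (K c) (U c) (F c)).
Proof. by move=> hS hK hU hF; rewrite /dcd /lo /hi; w_tac. Qed.

Lemma pcb_mbr S K U F : ps S -> pc K -> pc U -> pc F ->
  pcb (fun c => mbr d (S c) (K c) (U c) (F c)).
Proof. by move=> hS hK hU hF; rewrite /mbr /lo /hi; w_tac. Qed.

(** The asserted value is a function [P] of the context because the induction passes through
    negations and under quantifiers. *)
Lemma pcb_ev D S K U P F : ps S -> pc K -> pc U -> pcb P -> pc F ->
  pcb (fun c => ev (S c) (dcd d (S c) (K c) (U c)) (mbr d (S c) (K c) (U c)) D (P c) (F c)).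
Proof.
elim: D S K U P F => [|D IH] S K U P F hS hK hU hP hF /=.
  by apply: pcb_if; [pc_tac | apply: pcb_and; [exact: pcb_dcd|] | pc_tac];
     apply: pcb_eqb => //; apply: pcb_mbr.
apply: pcb_if; first by pc_tac.
  by apply: pcb_and; [exact: pcb_dcd | apply: pcb_eqb => //; apply: pcb_mbr].
apply: pcb_if; first by pc_tac.
  by apply: IH => //; pc_tac.
have hP' : pcb (fun c => P (pop c)) by apply: (pc_pop hP).
apply: pcb_if; first by pc_tac.
  apply: (@pcb_all (fun c => na (S c) (F c)) (fun c i => ev (S c) (dcd d (S c) (K c) (U c))
    (mbr d (S c) (K c) (U c)) D (P c) (ag (S c) (F c) i))); first by pc_tac.
  by apply: IH => //; pc_tac.
apply: (@pcb_has (fun c => na (S c) (F c)) (fun c i => ev (S c) (dcd d (S c) (K c) (U c))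
  (mbr d (S c) (K c) (U c)) D (P c) (ag (S c) (F c) i))); first by pc_tac.
by apply: IH => //; pc_tac.
Qed.

Lemma pcb_pts S K U V : ps S -> pc K -> pc U -> pc V ->
  pcb (fun c => pts d (S c) (K c) (U c) (V c)).
Proof. by move=> hS hK hU hV; rewrite /pts /mono /lo /hi; w_tac. Qed.

Lemma pcb_cvalid S K U : ps S -> pc K -> pc U -> pcb (fun c => cvalid d (S c) (K c) (U c)).
Proof.
move=> hS hK hU; rewrite /cvalid /okc /parse_ok /wq /ptok /closed /claimed /tau /clm /lo /hi.
by repeat first [apply: pcb_dle | apply: pcb_w1 | apply: pcb_w0 | apply: pcb_ev
  | apply: pcb_pts | apply: pc_il | apply: pc_wbase | progress pc_tac].
Qed.

Lemma pcb_ccompat S K U V : ps S -> pc K -> pc U -> pc V ->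
  pcb (fun c => ccompat d (S c) (K c) (U c) (V c)).
Proof.
move=> hS hK hU hV; rewrite /ccompat /cpair /tau /clm.
by repeat first [apply: pcb_cvalid | apply: pcb_pts | apply: pc_wbase | progress pc_tac].
Qed.

End WeftOneComputable.

Theorem identification_W1_hard H : sparse_class H -> W1_hard (Identification_dual H).
Proof.
move=> hH P [d hP].
pose K z := size (fstp z); pose N z := wbase d (sndp z) (K z) ^ wfields d.
pose q z := wq d (K z); pose C z := ccompat d (sndp z) (K z).
have hK S : ps S -> pc (fun c => K (S c)) by move=> hS; apply/ps_size/ps_fstp.
have hq S : ps S -> pc (fun c => q (S c)).
  by move=> hS; have := hK _ hS => h; rewrite /q /wq; pc_tac.
have paramK x k : sndp (param_str x k) = x /\ K (param_str x k) = k.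
  by have [_ h1 h2] := pair_strK (nseq k true) x; rewrite /K h1 size_nseq.
(* The graph has [N.+1] vertices and the budget is [N - q], so the parameter of the new instance is
   [q.+1], which for fixed [d] depends on the weight alone. *)
apply: (@fpt_ps P (WCS 1 d) _ (fun z => clique_str (N z) (q z) (C z)) (fun z => (q z).+1)
  (fun k => (wq d k).+1)) => //.
- apply: ps_pair; first by apply: ps_nseq; apply: pc_S; apply: hq ps_input.
  apply: (@ps_clique_str N q C) ps_input => // [S hS|S F F' hS hF hF'].
    apply: pc_exp; apply: pc_wbase; [exact: ps_sndp | exact: hK].
  by apply: pcb_ccompat => //; [apply: ps_sndp | apply: hK].
- move=> x k; rewrite /q /N /C; have [-> ->] := paramK x k.
  rewrite ident_dual_clique_str // ?wcs_clique //.
  rewrite /wfields expnS; apply: leq_trans (leq_pmulr _ _); first by rewrite /wbase; lia.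
  by rewrite expn_gt0 /wbase addnS.
- by move=> x k; rewrite /q; have [_ ->] := paramK x k.
- by move=> m n mn; rewrite ltnS; apply: leq_expl.
- by rewrite /wq; pc_tac.
Qed.

Theorem theorem3p1 (H : sgraph -> Prop)
  (H_class : H = is_star \/ H = is_tree \/ H = is_forest) :
  NP_complete (Identification H) /\ W1_hard (Identification_dual H).
Proof.
split; last exact: identification_W1_hard.
by split; [apply: identification_in_NP | apply: identification_NP_hard].
Qed.
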